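(* Let $\mathbf{U}_\varepsilon(\widetilde B)$ be a root of unity upper quantum cluster algebra, with associated root of unity quantum cluster algebra $\mathbf{A}_\varepsilon(\widetilde B)$, such that (i) $\mathbf{U}_\varepsilon(\widetilde B)$ is strict; (ii) $\ell$ is an odd positive integer coprime to the diagonal entries of the skew-symmetrizing matrix $D$; (iii) $\mathbf{A}_\varepsilon(\widetilde B)=\mathbf{U}_\varepsilon(\widetilde B)$; (iv) $\mathbf{U}_\varepsilon(\widetilde B)$ is a finitely generated algebra over $\mathbb{C}$. Then $(\mathbf{U}_\varepsilon(\widetilde B),\mathbf{CU}_\varepsilon(\widetilde B),\partial_{\mathrm{sp}}|_{\mathbf{CU}_\varepsilon(\widetilde B)},\mathrm{tr}_{\mathrm{reg}}|_{\mathbf{U}_\varepsilon(\widetilde B)})$ is a Poisson trace order.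
   Context: Poisson order (over $\mathbb{C}$): $(R,C,\partial)$ with $C$ a central subalgebra of $R$ over which $R$ is a finitely generated module, $C$ a Poisson algebra with bracket $\{.,.\}$, and $\partial:C\to\mathrm{Der}_{\mathbb{C}}(R)$ a linear map with $\partial_c|_C=\{c,-\}$. Poisson trace order: $(R,C,\partial,\mathrm{tr})$ with $(R,C,\partial)$ a Poisson order and $\mathrm{tr}:R\to C$ a $C$-linear map with $\mathrm{tr}(xy)=\mathrm{tr}(yx)$ and $\mathrm{tr}(\partial_c(r))=\{c,\mathrm{tr}(r)\}$ for all $c\in C$, $r\in R$. Root of unity quantum cluster algebras: let $N$ be a positive integer, $\mathbf{ex}\subseteq[1,N]$, $\widetilde B=(b_{ik})$ an integer matrix with rows indexed by $[1,N]$ and columns by $\mathbf{ex}$ whose principal ($\mathbf{ex}\times\mathbf{ex}$) part $B$ is skew-symmetrizable. Let $\ell$ be a positive integer, $\varepsilon^{1/2}\in\mathbb{C}$ a primitive $\ell$-th root of unity, $\Omega\in M_{N\times N}(\mathbb{Z}/\ell)$ skew-symmetric. $(\Omega,\widetilde B)$ is $\ell$-compatible if there is a diagonal matrix $D=\mathrm{diag}(d_k)_{k\in\mathbf{ex}}$ with positive integer entries, with $DB$ skew-symmetric, such that $(\widetilde B^\top\Omega)_{kj}=\delta_{kj}d_k$ modulo $\ell$ for $k\in\mathbf{ex}$, $j\in[1,N]$; this is assumed. The quantum torus $\mathcal{T}_\varepsilon(\Omega)$ has $\mathbb{C}$-basis $X^f$, $f\in\mathbb{Z}^N$, and product $X^fX^g=\varepsilon^{\Omega(f,g)/2}X^{f+g}$,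 where $\Omega(f,g)=f^\top\Omega g$; $x_i=X^{e_i}$. The mixed quantum torus $\mathcal{T}_\varepsilon(\Omega)_\ge$ is its subalgebra generated by $x_k^{\pm1}$, $k\in\mathbf{ex}$, and $x_i$, $i\in[1,N]\setminus\mathbf{ex}$. Let $\mathcal{F}$ be the division ring of fractions of $\mathcal{T}_\varepsilon(\Omega)$. The initial seed is $(M,\widetilde B,\Omega)$ with $M(f)=X^f$. The mutation in direction $k\in\mathbf{ex}$ of a seed $(M,\widetilde B,\Omega)$ is the seed $(M',\widetilde B',\Omega')$: $\widetilde B'=\mu_k(\widetilde B)$ is the usual matrix mutation; $\Omega'=E^\top\Omega E$ with $E_{ij}=\delta_{ij}$ for $j\ne k$, $E_{kk}=-1$, $E_{ik}=\max(0,-b_{ik})$ for $i\ne k$; $M'(e_i)=M(e_i)$ for $i\neq k$, $M'(e_k)=M(-e_k+\sum_i\max(b_{ik},0)e_i)+M(-e_k+\sum_i\max(-b_{ik},0)e_i)$, extended to $\mathbb{Z}^N$ by $M'(f)M'(g)=\varepsilon^{\Omega'(f,g)/2}M'(f+g)$. For each seed obtained from the initial one by iterated mutations in directions in $\mathbf{ex}$, the cluster variables are $M'(e_i)$, and its mixed quantum torus is the subalgebra of $\mathcal{F}$ generated by $M'(e_k)^{\pm1}$, $k\in\mathbf{ex}$, and $M'(e_i)$, $i\notin\mathbf{ex}$. $\mathbf{A}_\varepsilon(\widetilde B)$ is the $\mathbb{C}$-subalgebra of $\mathcal{F}$ generated by all cluster variables of all these seeds, and $\mathbf{U}_\varepsilon(\widetilde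 B)$ is the intersection of the mixed quantum tori of all these seeds; $\mathbf{A}_\varepsilon(\widetilde B)\subseteq\mathbf{U}_\varepsilon(\widetilde B)$. Central subalgebra: $\mathcal{L}_\varepsilon(\Omega)_\ge=\mathbb{C}[x_k^{\pm\ell},x_i^\ell;k\in\mathbf{ex},i\in[1,N]\setminus\mathbf{ex}]$, a central subalgebra of $\mathcal{T}_\varepsilon(\Omega)_\ge$; $\mathbf{CU}_\varepsilon(\widetilde B)$ is the intersection, over all seeds obtained from the initial one by iterated mutation, of the analogous algebras generated by $M'(e_k)^{\pm\ell}$, $k\in\mathbf{ex}$, and $M'(e_i)^\ell$, $i\notin\mathbf{ex}$. It is a central subalgebra of $\mathbf{U}_\varepsilon(\widetilde B)$. $\mathcal{T}_\varepsilon(\Omega)_\ge$ is a free $\mathcal{L}_\varepsilon(\Omega)_\ge$-module of rank $\ell^N$, and $\mathrm{tr}_{\mathrm{reg}}:\mathcal{T}_\varepsilon(\Omega)_\ge\to\mathcal{L}_\varepsilon(\Omega)_\ge$ sends an element to the trace of the $\mathcal{L}_\varepsilon(\Omega)_\ge$-linear operator of left multiplication by it. It is known that under (ii) it restricts to a trace map $\mathrm{tr}_{\mathrm{reg}}|_{\mathbf{U}_\varepsilon(\widetilde B)}:\mathbf{U}_\varepsilon(\widetilde B)\to\mathbf{CU}_\varepsilon(\widetilde B)$. Strict: there is a skew-symmetric $\Lambda\in M_{N\times N}(\mathbb{Z})$ reducing to $\Omega$ modulo $\ell$ with $(\widetilde B^\top\Lambda)_{kj}=\delta_{kj}d_k$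 over $\mathbb{Z}$. The corresponding upper quantum cluster algebra $\mathbf{U}_q$ is the $\mathbb{C}[q^{\pm1/2}]$-algebra defined by the same construction with $\Lambda$ in place of $\Omega$, an indeterminate $q^{1/2}$ in place of $\varepsilon^{1/2}$, and $\mathbb{C}[q^{\pm1/2}]$ in place of $\mathbb{C}$. Under (i)–(iii) it is known that $\mathbf{U}_\varepsilon(\widetilde B)\cong\mathbf{U}_q/(q^{1/2}-\varepsilon^{1/2})\mathbf{U}_q$. Specialization: let $T=\mathbf{U}_q$, $\hbar=q^{1/2}-\varepsilon^{1/2}$, $\theta:T\to R=T/\hbar T=\mathbf{U}_\varepsilon(\widetilde B)$, $\mathcal{Z}(R)$ the center of $R$. Choose a linear map $\iota:\mathcal{Z}(R)\to T$ with $\theta\iota=\mathrm{id}$. Then $(\partial_{\mathrm{sp}})_c(\theta(y))=\theta(\hbar^{-1}[\iota(c),y])$ for $y\in T$, and $\{c,c'\}=(\partial_{\mathrm{sp}})_c(c')$ on $\mathcal{Z}(R)$. It is known that under (i)–(iii) $\mathbf{CU}_\varepsilon(\widetilde B)$ is a Poisson subalgebra of $\mathcal{Z}(\mathbf{U}_\varepsilon(\widetilde B))$. *)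

(* Defs.v *)
From HB Require Import structures.
From mathcomp Require Import all_boot all_order all_algebra.
From mathcomp Require Import all_classical all_reals.
From mathcomp Require Import complex.

Set Implicit Arguments.
Unset Strict Implicit.
Unset Printing Implicit Defensive.

Import Order.TTheory GRing.Theory Num.Theory.
Local Open Scope classical_set_scope.
Local Open Scope ring_scope.

Section Algebras.
Variables (K : fieldType) (A : algType K).
Implicit Types (S Rs Cs : set A) (br der : A -> A -> A) (tr : A -> A).

Definition is_subalg (S : set A) : Prop := GRing.subalg_closed [in S].

Definition alg_gen (S : set A) : set A := smallest is_subalg S.

Definition alg_center (S : set A) : set A :=
  [set c | S c /\ forall r, S r -> c * r = r * c].

Definition lin_span (I : choiceType) (b : I -> A) : set A :=
  [set x | exists (s : seq I) (c : I -> K), x = \sum_(i <- s) c i *: b i].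

Definition lin_indep (I : choiceType) (b : I -> A) : Prop :=
  forall (s : seq I) (c : I -> K), uniq s ->
    \sum_(i <- s) c i *: b i = 0 -> forall i, i \in s -> c i = 0.

Definition linear_on (V : lmodType K) (S : set A) (f : A -> V) : Prop :=
  forall (a : K) x y, S x -> S y -> f (a *: x + y) = a *: f x + f y.

Definition derivation_on (S : set A) (f : A -> A) : Prop :=
  [/\ forall x, S x -> S (f x), linear_on S f
    & forall x y, S x -> S y -> f (x * y) = f x * y + x * f y].

Definition fg_module (Cs Rs : set A) : Prop :=
  exists (n : nat) (g : 'I_n -> A), (forall i, Rs (g i)) /\
    forall r, Rs r -> exists a : 'I_n -> A,
      (forall i, Cs (a i)) /\ r = \sum_i a i * g i.

Definition free_basis (Cs Rs : set A) n (b : 'I_n -> A) : Prop :=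
  [/\ forall i, Rs (b i),
      forall r, Rs r -> exists a : 'I_n -> A,
        (forall i, Cs (a i)) /\ r = \sum_i a i * b i
    & forall a : 'I_n -> A, (forall i, Cs (a i)) ->
        \sum_i a i * b i = 0 -> forall i, a i = 0].

(* Trace of left multiplication by x on Rs, regarded as a free module of
   finite rank over its central subalgebra Cs; 0 outside this situation. *)
Definition reg_trace (Cs Rs : set A) (x : A) : A :=
  xget 0 [set t | exists (n : nat) (b : 'I_n -> A) (a : 'M[A]_n),
    [/\ free_basis Cs Rs b, forall i j, Cs (a i j),
        forall j, x * b j = \sum_i a i j * b i & t = \tr a]].

Definition poisson_algebra (Cs : set A) (br : A -> A -> A) : Prop :=
  [/\ is_subalg Cs /\ (forall x y, Cs x -> Cs y -> x * y = y * x),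
      (forall x, Cs x -> derivation_on Cs (br x)),
      (forall y, Cs y -> linear_on Cs (br^~ y)),
      (forall x, Cs x -> br x x = 0)
    & forall x y z, Cs x -> Cs y -> Cs z ->
        br x (br y z) + br y (br z x) + br z (br x y) = 0].

(* All algebras involved are subalgebras of A; the functions br, der, tr are
   only considered on these subalgebras. *)
Definition poisson_order (Rs Cs : set A) br der : Prop :=
  [/\ is_subalg Rs /\ is_subalg Cs,
      Cs `<=` alg_center Rs /\ fg_module Cs Rs,
      poisson_algebra Cs br,
      (forall c, Cs c -> derivation_on Rs (der c)) /\
        (forall r, Rs r -> linear_on Cs (der^~ r))
    & forall c c', Cs c -> Cs c' -> der c c' = br c c'].

Definition poisson_trace_order (Rs Cs : set A) br der tr : Prop :=
  [/\ poisson_order Rs Cs br der,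
      (forall r, Rs r -> Cs (tr r)),
      (forall r s, Rs r -> Rs s -> tr (r + s) = tr r + tr s) /\
        (forall c r, Cs c -> Rs r -> tr (c * r) = c * tr r),
      (forall x y, Rs x -> Rs y -> tr (x * y) = tr (y * x))
    & forall c r, Cs c -> Rs r -> tr (der c r) = br c (tr r)].

End Algebras.

Definition form N (L : 'M[int]_N) (f g : 'cV[int]_N) : int :=
  (f^T *m L *m g) ord0 ord0.

Definition e_ N (i : 'I_N) : 'cV[int]_N := delta_mx i ord0.

Definition dir N (ex : {set 'I_N}) := {k : 'I_N | k \in ex}.

Definition exmatrix N (ex : {set 'I_N}) := 'I_N -> dir ex -> int.

Definition mutate_exmatrix N (ex : {set 'I_N}) (k : dir ex) (B : exmatrix ex) :
    exmatrix ex := fun i j =>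
  if (i == val k) || (j == k) then - B i j
  else B i j + Num.max 0 (B i k) * Num.max 0 (B (val k) j)
             - Num.max 0 (- B i k) * Num.max 0 (- B (val k) j).

Definition mutation_mx N (ex : {set 'I_N}) (k : dir ex) (B : exmatrix ex) :
    'M[int]_N := \matrix_(i, j)
  if j != val k then (i == j)%:R
  else if i == val k then - 1 else Num.max 0 (- B i k).

(* dB skew-symmetric on the principal part *)
Definition skew_symmetrizer N (ex : {set 'I_N}) (B : exmatrix ex)
    (d : dir ex -> nat) : Prop :=
  (forall k, (0 < d k)%N) /\
  (forall j k : dir ex, (d j)%:Z * B (val j) k = - ((d k)%:Z * B (val k) j)).

(* (Om, B) is l-compatible with witness d. Matrices over Z/l are represented
   by integer matrices: 'Z_l is not Z/l for l = 1. *)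
Definition root_compatible N (ex : {set 'I_N}) (l : nat) (Om : 'M[int]_N)
    (B : exmatrix ex) (d : dir ex -> nat) : Prop :=
  [/\ skew_symmetrizer B d,
      forall i j, (Om i j = - Om j i %[mod l])%Z
    & forall (k : dir ex) (j : 'I_N),
        (\sum_i B i k * Om i j = (val k == j)%:R * (d k)%:Z %[mod l])%Z].

Definition strict_lift N (ex : {set 'I_N}) (l : nat) (Om La : 'M[int]_N)
    (B : exmatrix ex) (d : dir ex -> nat) : Prop :=
  [/\ La^T = - La,
      forall i j, (La i j = Om i j %[mod l])%Z
    & forall (k : dir ex) (j : 'I_N),
        \sum_i B i k * La i j = (val k == j)%:R * (d k)%:Z].

Section QuantumTori.
Variables (K : fieldType) (F : unitAlgType K) (N : nat).

(* F is the division ring of (Ore) fractions of its subalgebra T. *)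
Definition division_ring_of_fractions (T : set F) : Prop :=
  (forall x : F, x != 0 -> x \is a GRing.unit) /\
  (forall x : F, exists a b, [/\ T a, T b, b != 0 & x = a / b]).

(* The quantum torus over K with q^{1/2} = v in K, its basis X^f = X f being
   indexed by Z^N, inside its division ring of fractions F. *)
Definition frac_qtorus (v : K) (L : 'M[int]_N) (X : 'cV[int]_N -> F) : Prop :=
  [/\ forall f g, X f * X g = v ^ form L f g *: X (f + g),
      lin_indep X & division_ring_of_fractions (lin_span X)].

(* The K-basis q^{m/2} X^f, (m, f) in Z x Z^N, of the quantum torus over
   K[q^{+-1/2}], where v = q^{1/2} is now an element of F. *)
Definition laurent_monomial (v : F) (X : 'cV[int]_N -> F)
    (p : int * 'cV[int]_N) : F := v ^ p.1 * X p.2.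

(* The quantum torus over K[q^{+-1/2}], q^{1/2} = v an indeterminate, inside
   its division ring of fractions F. *)
Definition frac_generic_qtorus (v : F) (L : 'M[int]_N) (X : 'cV[int]_N -> F) :
    Prop :=
  [/\ forall x : F, v * x = x * v,
      forall f g, X f * X g = v ^ form L f g * X (f + g),
      lin_indep (laurent_monomial v X)
    & division_ring_of_fractions (lin_span (laurent_monomial v X))].

End QuantumTori.

(* The construction of quantum cluster algebras in a division ring F, for a
   central unit v of F in the role of q^{1/2}. The coefficient ring is the
   subalgebra K[v^{+-1}] of F: this is K if v is in K, and the ring of Laurent
   polynomials if v is transcendental over K. *)
Section ClusterAlgebras.
Variables (K : fieldType) (F : unitAlgType K) (v : F).
Variables (N : nat) (ex : {set 'I_N}).

Record seed := Seed {
  frame : 'cV[int]_N -> F;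
  exmat : exmatrix ex;
  qform : 'M[int]_N
}.

Record mutation (k : dir ex) (s s' : seed) : Prop := Mutation {
  mutation_exmat : forall i j, exmat s' i j = mutate_exmatrix k (exmat s) i j;
  mutation_qform :
    qform s' = (mutation_mx k (exmat s))^T *m qform s *m mutation_mx k (exmat s);
  mutation_frame_ne : forall i, i != val k -> frame s' (e_ i) = frame s (e_ i);
  mutation_frame_eq : frame s' (e_ (val k)) =
    frame s (- e_ (val k) + \sum_i Num.max 0 (exmat s i k) *: e_ i) +
    frame s (- e_ (val k) + \sum_i Num.max 0 (- exmat s i k) *: e_ i);
  mutation_frame_mul : forall f g,
    frame s' f * frame s' g = v ^ form (qform s') f g * frame s' (f + g)
}.

Inductive mutation_equiv (s0 : seed) : seed -> Prop :=
| mutation_equiv_refl : mutation_equiv s0 s0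
| mutation_equiv_step k s s' :
    mutation_equiv s0 s -> mutation k s s' -> mutation_equiv s0 s'.

Definition coef_alg_gen (S : set F) : set F := alg_gen (S `|` [set v; v^-1]).

(* The algebra generated by M(e_k)^{+-p}, k in ex, and M(e_i)^p, i notin ex:
   the mixed quantum torus for p = 1, the central subalgebra L for p = l. *)
Definition mixed_torus (p : nat) (s : seed) : set F :=
  coef_alg_gen [set x | (exists i : 'I_N, x = frame s (e_ i) ^+ p) \/
                        (exists k : dir ex, x = frame s (e_ (val k)) ^- p)].

Definition mixed_torus_cap (p : nat) (s0 : seed) : set F :=
  [set x | forall s, mutation_equiv s0 s -> mixed_torus p s x].

Definition cluster_algebra (s0 : seed) : set F :=
  coef_alg_gen [set x | exists s (i : 'I_N),
    mutation_equiv s0 s /\ x = frame s (e_ i)].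

Definition upper_cluster_algebra (s0 : seed) : set F := mixed_torus_cap 1 s0.

End ClusterAlgebras.

Section Specialization.
Variables (K : fieldType) (F Fq : unitAlgType K).

(* The map sum a(q^{1/2}) X^f |-> sum a(eps^{1/2}) X^f from the quantum torus
   over K[q^{+-1/2}] to that over K. Restricted to U_q, it is the projection
   U_q -> U_q / (q^{1/2} - eps^{1/2}) U_q = U_eps. *)
Definition specialize N (eps : K) (X : 'cV[int]_N -> F) (v : Fq)
    (Xq : 'cV[int]_N -> Fq) (y : Fq) : F :=
  xget 0 [set z | exists (s : seq (int * 'cV[int]_N)%type)
                         (c : int * 'cV[int]_N -> K),
    y = \sum_(p <- s) c p *: laurent_monomial v Xq p /\
    z = \sum_(p <- s) (c p * eps ^ p.1) *: X p.2].

Definition center_section (R : set F) (T : set Fq) (theta : Fq -> F)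
    (iota : F -> Fq) : Prop :=
  linear_on (alg_center R) iota /\
  (forall c, alg_center R c -> T (iota c) /\ theta (iota c) = c).

(* (c, theta y) |-> theta (h^-1 [iota c, y]) *)
Definition d_sp (T : set Fq) (h : Fq) (theta : Fq -> F) (iota : F -> Fq)
    (c r : F) : F :=
  xget 0 [set z | exists y, [/\ T y, theta y = r
    & z = theta (h^-1 * (iota c * y - y * iota c))]].

End Specialization.

(* Main.v *)
(* The integer lift La of Om is used at the root of unity as well, so one theory
   covers both quantum tori: a division ring F, a central unit v, and frames
   which are free over C0 = K[v^{+-1}].

   Laurent phenomenon: an element of the tori of a seed and of all its
   neighbours lies in the tori of the neighbours of each neighbour. This is a
   statement about two directions k, j. If b_jk = 0 it follows from the
   coprimality of the two exchange elements; otherwise the map sending an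
   element of the torus of mu_k(s) to its lowest e_j-degree part in the torus
   of s is an injective morphism, and one removes leading terms inductively.
   Nonnegativity of the frozen exponents is carried along.

   Root of unity: exch^l is the sum of two monomials with exponents divisible
   by l, so the central tori of all seeds have the same fractions, the
   projections onto l Z^N agree on U, and tr_reg is l^N times this projection.
   Hence tr_reg maps U to CU. It commutes with a derivation D preserving CU
   because b^l in CU forces D(b^l) in CU, i.e. the projection of D(b) vanishes
   for the monomials b outside l Z^N.

   Finiteness: for X in U[T], Cayley-Hamilton gives a monic equation of fixed
   degree n over CU[T], its coefficients being polynomials in traces of powers
   of X. In the associated graded of the filtration of U by word length over CU
   all elements of positive degree are thus nilpotent of index n, and by the
   Nagata-Higman theorem long words are combinations of shorter ones.

   Specialization: q^{1/2} |-> eps extends to a place from Fq to F, computed on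
   fractions whose denominator does not specialize to 0. It maps each
   mutated frame to the corresponding one, has kernel hbar on each torus, and
   so identifies U_q / hbar U_q with U as soon as A = U. On central elements
   brackets can be computed from arbitrary lifts; lifting CU inside the quantum
   torus of a given seed shows that CU is closed under the bracket. *)
Require Import Defs.
From HB Require Import structures.
From mathcomp Require Import all_boot all_order all_algebra.
From mathcomp Require Import all_classical all_reals.
From mathcomp Require Import complex.
From mathcomp Require Import perm zify ring.
(* Imported again because MathComp shadows [form]. *)
Require Import Defs.
Import Order.TTheory GRing.Theory Num.Theory.
Local Open Scope classical_set_scope.
Local Open Scope ring_scope.

Set Implicit Arguments.
Unset Strict Implicit.
Unset Printing Implicit Defensive.

(** * Exponents and spans *)

(** Strictness contributes compatibility over the integers. The functionals [form L f] are then
    genuine gradings by integers, even at the root of unity, where products of frames see their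
    values only modulo l. These gradings separate the two terms of an exchange element. Finiteness
    does not follow from the finite rank of the mixed torus over its central subalgebra: CU is a
    smaller intersection, not known in advance to be Noetherian, and the torus need not be a finite
    CU-module. Only traces are known to land in CU; dividing by integers turns them into
    coefficients of a characteristic polynomial. A derivation is given on U alone and cannot be
    applied to an arbitrary torus monomial. Monomials of the initial seed with nonnegative exponents
    do lie in U, and a central monomial clears the remaining denominators. The specialization is
    carried as a relation on Fq: mutated frames are fractions over the initial torus, and some
    fractions have no value at eps. *)

Section Exponents.
Variable N : nat.
Implicit Types (L E : 'M[int]_N) (f g h : 'cV[int]_N) (k : 'I_N).

Definition co k f : int := f k ord0.

Lemma coD k f g : co k (f + g) = co k f + co k g.
Proof. by rewrite /co !mxE. Qed.
Lemma coN k f : co k (- f) = - co k f.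
Proof. by rewrite /co !mxE. Qed.
Lemma co0 k : co k 0 = 0.
Proof. by rewrite /co !mxE. Qed.
Lemma coZ k n f : co k (n *: f) = n * co k f.
Proof. by rewrite /co !mxE. Qed.
Lemma coMn k n f : co k (f *+ n) = n%:Z * co k f.
Proof. by rewrite -scaler_nat coZ natz. Qed.
Lemma coe k i : co k (e_ i) = (k == i)%:R.
Proof. by rewrite /co /e_ !mxE andbT. Qed.
Lemma coek k : co k (e_ k) = 1.
Proof. by rewrite coe eqxx. Qed.
Lemma co_eqP f g : (forall k, co k f = co k g) -> f = g.
Proof. by move=> e; apply/colP => k; apply: e. Qed.

Definition coE := (coD, coN, coZ, co0, coe).

Lemma formDl L f g h : form L (f + g) h = form L f h + form L g h.
Proof. by rewrite /form linearD /= !mulmxDl mxE. Qed.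
Lemma formDr L h f g : form L h (f + g) = form L h f + form L h g.
Proof. by rewrite /form mulmxDr mxE. Qed.
Lemma formZl L n f h : form L (n *: f) h = n * form L f h.
Proof. by rewrite /form linearZ /= -!scalemxAl mxE. Qed.
Lemma formZr L n h f : form L h (n *: f) = n * form L h f.
Proof. by rewrite /form -scalemxAr mxE. Qed.
Lemma formNl L f h : form L (- f) h = - form L f h.
Proof. by rewrite -scaleN1r formZl mulN1r. Qed.
Lemma formNr L h f : form L h (- f) = - form L h f.
Proof. by rewrite -scaleN1r formZr mulN1r. Qed.
Lemma form0l L h : form L 0 h = 0.
Proof. by rewrite -(scale0r 0) formZl mul0r. Qed.
Lemma form0r L h : form L h 0 = 0.
Proof. by rewrite -(scale0r 0) formZr mul0r. Qed.
Definition formE := (formDl, formDr, formZl, formZr, formNl, formNr).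

Lemma form_congr L E f g : form (E^T *m L *m E) f g = form L (E *m f) (E *m g).
Proof. by rewrite /form trmx_mul !mulmxA. Qed.

Lemma form_skew L f g : L^T = - L -> form L f g = - form L g f.
Proof.
move=> sk; rewrite -formNl /form -[in LHS](trmxK (f^T *m L *m g)) mxE.
by rewrite !trmx_mul trmxK sk linearN /= !(mulNmx, mulmxN) mulmxA.
Qed.
Lemma form_alt L f : L^T = - L -> form L f f = 0.
Proof. by move=> /(form_skew f f); lia. Qed.

Lemma congr_skew L E : L^T = - L -> (E^T *m L *m E)^T = - (E^T *m L *m E).
Proof. by move=> sk; rewrite !trmx_mul trmxK sk !(mulNmx, mulmxN) mulmxA. Qed.

Definition pcol f : 'cV[int]_N := \col_i Num.max 0 (f i ord0).

Lemma co_pcol k f : co k (pcol f) = Num.max 0 (co k f).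
Proof. by rewrite /co mxE. Qed.

Lemma pcol_sub f : pcol f - pcol (- f) = f.
Proof. by apply: co_eqP => k; rewrite coD coN !co_pcol coN; lia. Qed.

(* The linear involution [e_k |-> g - e_k]; for [g = pcol (+- b_k)] it relates
   the forms of adjacent seeds. *)
Definition tropmap k g f : 'cV[int]_N := f + co k f *: (g - e_ k *+ 2).

Lemma tropmapD k g f h : tropmap k g (f + h) = tropmap k g f + tropmap k g h.
Proof. by apply: co_eqP => i; rewrite /tropmap !(coE, coMn); lia. Qed.
Lemma tropmapZ k g n f : tropmap k g (n *: f) = n *: tropmap k g f.
Proof. by apply: co_eqP => i; rewrite /tropmap !(coE, coMn); lia. Qed.
Lemma tropmapN k g f : tropmap k g (- f) = - tropmap k g f.
Proof. by apply: co_eqP => i; rewrite /tropmap !(coE, coMn); lia. Qed.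
Lemma tropmap0 k g f : co k f = 0 -> tropmap k g f = f.
Proof. by rewrite /tropmap => ->; rewrite scale0r addr0. Qed.
Lemma tropmap_ek k g : tropmap k g (e_ k) = - e_ k + g.
Proof. by apply: co_eqP => i; rewrite /tropmap coek !(coE, coMn); lia. Qed.

Lemma co_tropmap k g i f :
  co i (tropmap k g f) = co i f + co k f * (co i g - (i == k)%:R *+ 2).
Proof. by rewrite /tropmap !(coE, coMn); lia. Qed.

Lemma tropmapK k g f : co k g = 0 -> tropmap k g (tropmap k g f) = f.
Proof.
move=> g0; apply: co_eqP => i; rewrite !co_tropmap g0 eqxx.
by case: eqP => [->|_]; rewrite ?g0; lia.
Qed.
End Exponents.

(** * Subalgebras given as sets *)

Lemma is_subalgP (K : fieldType) (A : algType K) (S : set A) :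
  is_subalg S <->
  [/\ S 1, forall a x y, S x -> S y -> S (a *: x + y)
         & forall x y, S x -> S y -> S (x * y)].
Proof.
split=> [[s1 sl sm]|[s1 sl sm]]; split.
- by move: s1; rewrite in_setE.
- by move=> a x y Sx Sy; have := sl a x y; rewrite !in_setE; apply.
- by move=> x y Sx Sy; have := sm x y; rewrite !in_setE; apply.
- by rewrite in_setE.
- by move=> a x y; rewrite !in_setE; apply: sl.
- by move=> x y; rewrite !in_setE; apply: sm.
Qed.

Section SubalgTheory.
Variables (K : fieldType) (A : algType K) (S : set A) (subS : is_subalg S).

Lemma subalg1 : S 1. Proof. by have /is_subalgP[] := subS. Qed.
Lemma subalgM x y : S x -> S y -> S (x * y).
Proof. by have /is_subalgP[_ _] := subS; apply. Qed.
Lemma subalgD x y : S x -> S y -> S (x + y).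
Proof.
by have /is_subalgP[_ sl _] := subS; move=> /(sl 1 x y); rewrite scale1r; apply.
Qed.
Lemma subalg0 : S 0.
Proof.
have /is_subalgP[s1 sl _] := subS.
by have := sl (-1) _ _ s1 s1; rewrite scaleN1r addNr.
Qed.
Lemma subalgZ a x : S x -> S (a *: x).
Proof.
move=> Sx; have /is_subalgP[_ sl _] := subS.
by have := sl a _ _ Sx subalg0; rewrite addr0.
Qed.
Lemma subalgN x : S x -> S (- x).
Proof. by rewrite -scaleN1r; apply: subalgZ. Qed.
Lemma subalgB x y : S x -> S y -> S (x - y).
Proof. by move=> Sx Sy; apply/subalgD/subalgN. Qed.
Lemma subalgX x n : S x -> S (x ^+ n).
Proof.
by move=> Sx; elim: n => [|n IH]; rewrite ?expr0 ?exprS; [exact: subalg1|exact: subalgM].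
Qed.
Lemma subalgA a : S a%:A. Proof. exact/subalgZ/subalg1. Qed.
Lemma subalg_sum (I : Type) (s : seq I) (P : pred I) f :
  (forall i, P i -> S (f i)) -> S (\sum_(i <- s | P i) f i).
Proof.
move=> h; elim/big_ind: _ => //; [exact: subalg0|exact: subalgD].
Qed.
End SubalgTheory.

Section SmallestSubalg.
Variables (K : fieldType) (A : algType K).

Lemma alg_gen_subalg (G : set A) : is_subalg (alg_gen G).
Proof.
apply/is_subalgP; split=> [S [/is_subalgP[]]|a x y Sx Sy S hS|x y Sx Sy S hS] //.
  by have /is_subalgP[_ + _] := hS.1; apply; [apply: Sx|apply: Sy].
by have /is_subalgP[_ _] := hS.1; apply; [apply: Sx|apply: Sy].
Qed.

Lemma alg_gen_incl (G : set A) : G `<=` alg_gen G.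
Proof. exact: sub_gen_smallest. Qed.

Lemma alg_gen_min (G S : set A) : is_subalg S -> G `<=` S -> alg_gen G `<=` S.
Proof. exact: smallest_sub. Qed.
End SmallestSubalg.

(** * Spans with prescribed support over a central coefficient ring *)

Section Span.
Variables (K : fieldType) (F : algType K) (C0 : set F).
Hypotheses (C0s : is_subalg C0) (C0c : forall c x, C0 c -> c * x = x * c).
Variables (I : choiceType).
Implicit Types (M G : I -> F) (P Q : pred I) (x y : F).

(** The support predicate [P] carries gradings, nonnegativity and congruences alike. Repeated
    indices are allowed in [t], so sums and products need no normal form. *)
Definition tspan M P x : Prop := exists t : seq (F * I),
  (forall p, p \in t -> C0 p.1 /\ P p.2) /\ x = \sum_(p <- t) p.1 * M p.2.

Definition tfree M : Prop := forall (t : seq I) (c : I -> F),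
  uniq t -> (forall i, C0 (c i)) -> \sum_(i <- t) c i * M i = 0 ->
  forall i, i \in t -> c i = 0.

Lemma tspan_gen M P c i : C0 c -> P i -> tspan M P (c * M i).
Proof.
by exists [:: (c, i)]; rewrite big_seq1; split=> // p /[!inE]/eqP->.
Qed.
Lemma tspanM1 M (P : pred I) i : P i -> tspan M P (M i).
Proof. by move=> Pi; rewrite -(mul1r (M i)); apply: tspan_gen => //; apply: subalg1. Qed.
Lemma tspan0 M P : tspan M P 0.
Proof. by exists [::]; rewrite big_nil. Qed.
Lemma tspanD M P x y : tspan M P x -> tspan M P y -> tspan M P (x + y).
Proof.
move=> [t [ht ->]] [u [hu ->]]; exists (t ++ u); rewrite big_cat; split=> // p.
by rewrite mem_cat => /orP[/ht|/hu].
Qed.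
Lemma tspan_ind M P (Z : F -> Prop) : Z 0 ->
  (forall x y, Z x -> Z y -> Z (x + y)) ->
  (forall c i, C0 c -> P i -> Z (c * M i)) -> forall x, tspan M P x -> Z x.
Proof.
move=> Z0 ZD Zg x [t [ht ->]]; rewrite big_seq; elim/big_ind: _ => //.
by move=> p /ht[]; apply: Zg.
Qed.
Lemma tspanC M P c x : C0 c -> tspan M P x -> tspan M P (c * x).
Proof.
move=> hc; elim/tspan_ind: x / => [|x y IHx IHy|a i ha hi].
- by rewrite mulr0; apply: tspan0.
- by rewrite mulrDr; apply: tspanD.
by rewrite mulrA; apply: tspan_gen => //; apply: subalgM.
Qed.
Lemma tspanZ M P (a : K) x : tspan M P x -> tspan M P (a *: x).
Proof. by move=> ?; rewrite -mulr_algl; apply: tspanC => //; apply: subalgA. Qed.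
Lemma tspanN M P x : tspan M P x -> tspan M P (- x).
Proof. by rewrite -scaleN1r; apply: tspanZ. Qed.
Lemma tspanB M P x y : tspan M P x -> tspan M P y -> tspan M P (x - y).
Proof. by move=> ? ?; apply/tspanD/tspanN. Qed.
Lemma tspan_sum M P (J : Type) (s : seq J) (R : pred J) f :
  (forall j, R j -> tspan M P (f j)) -> tspan M P (\sum_(j <- s | R j) f j).
Proof.
by move=> h; elim/big_ind: _ => //; [exact: tspan0|exact: tspanD].
Qed.
Lemma tspanS M P Q x : {subset P <= Q} -> tspan M P x -> tspan M Q x.
Proof. by move=> PQ [t [ht ->]]; exists t; split=> // p /ht[? /PQ]. Qed.
Lemma tspanT M P x : tspan M P x -> tspan M predT x.
Proof. exact: tspanS. Qed.

(** Collecting equal indices gives a duplicate-free list, the only kind that [tfree] speaks about;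
    the grouped coefficients do not depend on [G]. *)
Lemma comb_group G (t : seq (F * I)) : \sum_(p <- t) p.1 * G p.2 =
  \sum_(i <- undup (map snd t)) (\sum_(p <- t | p.2 == i) p.1) * G i.
Proof.
under [RHS]eq_bigr do rewrite big_distrl /= big_mkcond.
rewrite exchange_big /=; apply: eq_big_seq => p pt.
rewrite (bigD1_seq p.2) ?undup_uniq ?mem_undup ?map_f //= eqxx big1 ?addr0 //.
by move=> i /negPf ip; rewrite eq_sym ip.
Qed.

Lemma tfree_comb M G (t : seq (F * I)) : tfree M ->
  (forall p, p \in t -> C0 p.1) -> \sum_(p <- t) p.1 * M p.2 = 0 ->
  \sum_(p <- t) p.1 * G p.2 = 0.
Proof.
move=> fM ht; pose u := undup (map snd t).
pose c i := \sum_(p <- t | p.2 == i) p.1.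
have hE H : \sum_(p <- t) p.1 * H p.2 = \sum_(i <- u) c i * H i by apply: comb_group.
rewrite !hE => h0; rewrite big_seq big1 // => i iu.
rewrite (fM u c _ _ h0) ?mul0r ?undup_uniq // => j.
rewrite /c big_seq_cond; apply: subalg_sum => // p /andP[/ht].
by [].
Qed.

(* The C0-linear map sending [M i] to [G i], when [M] is C0-free. *)
Definition text M G x : F := xget 0 [set y | exists t : seq (F * I),
  [/\ forall p, p \in t -> C0 p.1, x = \sum_(p <- t) p.1 * M p.2
    & y = \sum_(p <- t) p.1 * G p.2]].

Section Text.
Variables (M : I -> F) (fM : tfree M).

Lemma textE G (t : seq (F * I)) : (forall p, p \in t -> C0 p.1) ->
  text M G (\sum_(p <- t) p.1 * M p.2) = \sum_(p <- t) p.1 * G p.2.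
Proof.
move=> ht; rewrite /text; case: xgetP => [y _ [u [hu e ->]]|/(_ (\sum_(p <- t) p.1 * G p.2))]; last first.
  by case; exists t.
pose w := t ++ map (fun p => (- p.1, p.2)) u.
have := @tfree_comb M G w fM; rewrite /w !big_cat !big_map /=.
have sN H : \sum_(j <- u) - j.1 * H j.2 = - \sum_(j <- u) j.1 * H j.2.
  by rewrite -sumrN; apply: eq_bigr => j _; rewrite mulNr.
rewrite !sN e subrr => hw; apply/esym/eqP; rewrite -subr_eq0; apply/eqP/hw => //.
move=> p; rewrite mem_cat => /orP[/ht//|/mapP[q /hu hq ->]].
exact: subalgN.
Qed.

Lemma text0 G : text M G 0 = 0.
Proof. by have := @textE G [::] (fun p => ltac:(done)); rewrite !big_nil. Qed.
Lemma textC G c i : C0 c -> text M G (c * M i) = c * G i.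
Proof.
move=> hc; have := @textE G [:: (c, i)]; rewrite !big_seq1; apply.
by move=> p /[!inE]/eqP->.
Qed.
Lemma textM1 G i : text M G (M i) = G i.
Proof.
by rewrite -[in LHS](mul1r (M i)) textC ?mul1r //; apply: subalg1.
Qed.
Lemma textD G x y : tspan M predT x -> tspan M predT y ->
  text M G (x + y) = text M G x + text M G y.
Proof.
move=> [t [ht ->]] [u [hu ->]].
have t' p : p \in t -> C0 p.1 by case/ht.
have u' p : p \in u -> C0 p.1 by case/hu.
rewrite (textE G t') (textE G u') -!big_cat; apply: textE => p.
by rewrite mem_cat => /orP[/t'|/u'].
Qed.
Lemma textCl G c x : C0 c -> tspan M predT x -> text M G (c * x) = c * text M G x.
Proof.
move=> hc [t [ht ->]].
have t' p : p \in t -> C0 p.1 by case/ht.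
rewrite (textE G t'); pose u := map (fun p => (c * p.1, p.2)) t.
have uE H : c * \sum_(p <- t) p.1 * H p.2 = \sum_(p <- u) p.1 * H p.2.
  by rewrite big_map big_distrr; apply: eq_bigr => p _; rewrite /= mulrA.
rewrite !uE; apply: textE => p /mapP[q /t' hq ->]; exact: subalgM.
Qed.
Lemma textN G x : tspan M predT x -> text M G (- x) = - text M G x.
Proof.
by move=> Tx; rewrite -mulN1r textCl ?mulN1r //; apply: subalgN => //; apply: subalg1.
Qed.
Lemma textB G x y : tspan M predT x -> tspan M predT y ->
  text M G (x - y) = text M G x - text M G y.
Proof. by move=> Tx Ty; rewrite textD ?textN //; apply: tspanN. Qed.
Lemma text_sum G (J : Type) (s : seq J) (R : pred J) f :
  (forall j, R j -> tspan M predT (f j)) ->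
  text M G (\sum_(j <- s | R j) f j) = \sum_(j <- s | R j) text M G (f j).
Proof.
move=> h; elim: s => [|j s IH]; first by rewrite !big_nil text0.
rewrite !big_cons; case: ifP => // hj; rewrite textD ?IH //; first exact: h.
exact: tspan_sum.
Qed.
Lemma text_span G M' P x : (forall i, P i -> tspan M' predT (G i)) ->
  tspan M P x -> tspan M' predT (text M G x).
Proof.
move=> hG [t [ht ->]]; rewrite textE; last by move=> p /ht[].
by rewrite big_seq; apply: tspan_sum => p /ht[? ?]; apply: tspanC; auto.
Qed.

(** Truncation of the support to [P]; homogeneous components and the projection onto l Z^N are both
    of this form. *)
Definition proj P : F -> F := text M (fun i => if P i then M i else 0).

Lemma projD P x y : tspan M predT x -> tspan M predT y ->
  proj P (x + y) = proj P x + proj P y.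
Proof. exact: textD. Qed.
Lemma projB P x y : tspan M predT x -> tspan M predT y ->
  proj P (x - y) = proj P x - proj P y.
Proof. exact: textB. Qed.
Lemma proj0 P : proj P 0 = 0. Proof. exact: text0. Qed.
Lemma proj_gen P c i : C0 c -> proj P (c * M i) = if P i then c * M i else 0.
Proof. by move=> hc; rewrite /proj textC //; case: ifP => // _; rewrite mulr0. Qed.
Lemma projCl P c x : C0 c -> tspan M predT x -> proj P (c * x) = c * proj P x.
Proof. exact: textCl. Qed.
Lemma proj_sum P (J : Type) (s : seq J) (R : pred J) f :
  (forall j, R j -> tspan M predT (f j)) ->
  proj P (\sum_(j <- s | R j) f j) = \sum_(j <- s | R j) proj P (f j).
Proof. exact: text_sum. Qed.
Lemma proj_in P Q x : tspan M Q x -> tspan M (predI P Q) (proj P x).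
Proof.
suff: tspan M Q x -> tspan M Q x /\ tspan M (predI P Q) (proj P x) by move=> h /h[].
elim/tspan_ind: x / => [|x y [Qx IHx] [Qy IHy]|c i hc hi].
- by rewrite proj0; split; apply: tspan0.
- rewrite projD; [|exact: tspanT Qx|exact: tspanT Qy].
  by split; apply: tspanD.
split; first exact: tspan_gen.
by rewrite proj_gen //; case: ifP => hp; [apply: tspan_gen => //=; rewrite hp|apply: tspan0].
Qed.
Lemma proj_in1 P Q x : tspan M Q x -> tspan M Q (proj P x).
Proof. by move=> /(proj_in P); apply: tspanS => i /andP[]. Qed.
Lemma proj_in2 P Q x : tspan M Q x -> tspan M P (proj P x).
Proof. by move=> /(proj_in P); apply: tspanS => i /andP[]. Qed.
Lemma projT P x : tspan M predT x -> tspan M predT (proj P x).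
Proof. exact: proj_in1. Qed.
Lemma proj_ext P Q R x : tspan M R x -> {in R, P =1 Q} -> proj P x = proj Q x.
Proof.
move=> [t [ht ->]] PQ; have t' p : p \in t -> C0 p.1 by case/ht.
rewrite /proj !textE //.
by apply: eq_big_seq => p /ht[_ Rp]; rewrite PQ.
Qed.
Lemma proj_id P x : tspan M P x -> proj P x = x.
Proof.
move=> [t [ht ->]]; rewrite /proj textE; last by move=> p /ht[].
by apply: eq_big_seq => p /ht[_ ->].
Qed.
Lemma proj_eq0 P Q x : tspan M Q x -> {in Q, forall i, ~~ P i} -> proj P x = 0.
Proof.
move=> [t [ht ->]] PQ; rewrite /proj textE; last by move=> p /ht[].
by apply: big1_seq => p /andP[_ /ht[_ /PQ/negPf->]]; rewrite mulr0.
Qed.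
Lemma proj_proj P Q x : tspan M predT x -> proj P (proj Q x) = proj (predI P Q) x.
Proof.
suff: tspan M predT x -> tspan M predT x /\ proj P (proj Q x) = proj (predI P Q) x by move=> h /h[].
elim/tspan_ind: x / => [|x y [Tx IHx] [Ty IHy]|c i hc hi].
- by rewrite !proj0; split; first exact: tspan0.
- split; first exact: tspanD.
  by rewrite !projD ?IHx ?IHy //; apply: projT.
split; first exact: tspan_gen.
by rewrite !proj_gen //=; case: (Q i); rewrite ?andbF ?andbT ?proj0 ?proj_gen.
Qed.
Lemma proj_split P x : tspan M predT x -> x = proj P x + proj (predC P) x.
Proof.
suff: tspan M predT x -> tspan M predT x /\ x = proj P x + proj (predC P) x by move=> h /h[].
elim/tspan_ind: x / => [|x y [Tx IHx] [Ty IHy]|c i hc hi].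
- by rewrite !proj0 addr0; split; first exact: tspan0.
- split; first exact: tspanD.
  by rewrite !projD // addrACA -IHx -IHy.
split; first exact: tspan_gen.
by rewrite !proj_gen //=; case: (P i); rewrite ?addr0 ?add0r.
Qed.

Lemma tspan_inI P Q x : tspan M P x -> tspan M Q x -> tspan M (predI P Q) x.
Proof. by move=> hP /(proj_in P); rewrite proj_id. Qed.

(** After grouping, each coefficient of the part outside [P] is recovered by the projection onto a
    single index, so the whole part vanishes. *)
Lemma tspan_sup P x : tspan M predT x ->
  (forall i, ~~ P i -> proj (pred1 i) x = 0) -> tspan M P x.
Proof.
move=> Tx h; rewrite (proj_split P Tx) [X in _ + X](_ : _ = 0) ?addr0.
  exact: proj_in2 Tx.
have [t [ht e]] := proj_in (predC P) Tx.
pose u := undup (map snd t); pose c i := \sum_(p <- t | p.2 == i) p.1.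
have hE H : \sum_(p <- t) p.1 * H p.2 = \sum_(i <- u) c i * H i by apply: comb_group.
rewrite e hE big1_seq // => i /andP[_]; rewrite mem_undup => /mapP[p pt ->].
have /ht[_ /andP[/= nP _]] := pt.
have hc j : C0 (c j).
  rewrite /c big_seq_cond; apply: subalg_sum => // q /andP[/ht[]].
  by [].
have := h _ nP; have -> : proj (pred1 p.2) x = proj (pred1 p.2) (proj (predC P) x).
  rewrite proj_proj //; apply: proj_ext Tx _ => j _ /=.
  by case: eqP => // ->; rewrite nP.
rewrite e hE proj_sum; last by move=> j _; apply: tspan_gen.
under eq_bigr do rewrite proj_gen //=.
rewrite (bigD1_seq p.2) ?undup_uniq ?mem_undup ?map_f //= eqxx big1 ?addr0 //.
by move=> j /negPf ->.
Qed.

End Text.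
End Span.

(** * Frames of quantum tori *)

(** All that the cluster theory uses about the coefficients, whether [v] is a scalar or an
    indeterminate. *)
Record coef_base (K : fieldType) (F : unitAlgType K) (v : F) (C0 : set F) :
    Prop := CoefBase {
  cb_central : forall x, v * x = x * v;
  cb_unit : v \is a GRing.unit;
  cb_subalg : is_subalg C0;
  cb_comm : forall c x, C0 c -> c * x = x * c;
  cb_pow : forall z : int, C0 (v ^ z)
}.

Section Coef.
#[local] Set Default Proof Using "All".
Variables (K : fieldType) (F : unitAlgType K) (v : F) (C0 : set F).
Hypothesis (H : coef_base v C0).
Local Notation vC := (cb_central H).
Local Notation vU := (cb_unit H).
Local Notation C0s := (cb_subalg H).
Local Notation C0c := (cb_comm H).
Local Notation C0v := (cb_pow H).
#[local] Hint Extern 0 (is_subalg _) => exact: C0s : core.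
#[local] Hint Extern 0 (C0 (v ^ _)) => exact: C0v : core.
#[local] Hint Extern 0 (is_true (v \is a GRing.unit)) => exact: vU : core.
Implicit Types (x y : F) (z : int).

Lemma vzC z x : v ^ z * x = x * v ^ z.
Proof. by apply/esym/commrXz/esym/vC. Qed.
Lemma vzA z x y : x * (v ^ z * y) = v ^ z * (x * y).
Proof. by rewrite mulrA -vzC mulrA. Qed.
Lemma vzD z1 z2 : v ^ z1 * v ^ z2 = v ^ (z1 + z2).
Proof. by rewrite exprzDr. Qed.
Lemma vzK z1 z2 x : v ^ z1 * (v ^ z2 * x) = v ^ (z1 + z2) * x.
Proof. by rewrite mulrA vzD. Qed.
Lemma vzU z : v ^ z \is a GRing.unit.
Proof. exact: unitrXz. Qed.

End Coef.

Section Frame.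
#[local] Set Default Proof Using "All".
Variables (K : fieldType) (F : unitAlgType K) (v : F) (C0 : set F) (N : nat).
Hypothesis (H : coef_base v C0).
Local Notation vC := (cb_central H).
Local Notation vU := (cb_unit H).
Local Notation C0s := (cb_subalg H).
Local Notation C0c := (cb_comm H).
Local Notation C0v := (cb_pow H).
#[local] Hint Extern 0 (is_subalg _) => exact: C0s : core.
#[local] Hint Extern 0 (C0 (v ^ _)) => exact: C0v : core.
#[local] Hint Extern 0 (is_true (v \is a GRing.unit)) => exact: vU : core.
Implicit Types (L : 'M[int]_N) (f g : 'cV[int]_N) (M : 'cV[int]_N -> F).
Implicit Types (P Q R : pred 'cV[int]_N) (D : 'cV[int]_N -> int).
Implicit Types (x y : F) (z : int).

(** The product rule alone only makes [M 0] idempotent, hence the separate normalization. *)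
Record qframe L M : Prop := Qframe {
  qframe1 : M 0 = 1;
  qframeM : forall f g, M f * M g = v ^ form L f g * M (f + g)
}.

Section FrameTheory.
Variables (L : 'M[int]_N) (Lskew : L^T = - L).
Variables (M : 'cV[int]_N -> F) (frM : qframe L M).

Lemma qframeD f g : M (f + g) = v ^ (- form L f g) * (M f * M g).
Proof. by rewrite (qframeM frM) (vzK H) addNr expr0z mul1r. Qed.
Lemma qframe_mulN f : M f * M (- f) = 1.
Proof. by rewrite (qframeM frM) formNr form_alt // oppr0 expr0z mul1r subrr (qframe1 frM). Qed.
Lemma qframe_Nmul f : M (- f) * M f = 1.
Proof. by rewrite -[in M f](opprK f) qframe_mulN. Qed.
Lemma qframeU f : M f \is a GRing.unit.
Proof. by apply/unitrP; exists (M (- f)); rewrite qframe_mulN qframe_Nmul. Qed.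
Lemma qframeV f : (M f)^-1 = M (- f).
Proof. by apply: (mulrI (qframeU f)); rewrite divrr ?qframeU // qframe_mulN. Qed.
Lemma qframeC f g : M f * M g = v ^ (form L f g *+ 2) * (M g * M f).
Proof.
rewrite (qframeM frM f) (qframeM frM g) (vzK H) (addrC g f); congr (v ^ _ * _).
by rewrite [form L g f]form_skew //; lia.
Qed.
Lemma qframeX f n : M f ^+ n = M (f *+ n).
Proof.
elim: n => [|n IH]; first by rewrite expr0 mulr0n (qframe1 frM).
rewrite exprS IH mulrS (qframeM frM) -scaler_nat formZr form_alt //.
by rewrite mulr0 expr0z mul1r.
Qed.

Lemma tspanM P Q R x y : (forall f g, P f -> Q g -> R (f + g)) ->
  tspan C0 M P x -> tspan C0 M Q y -> tspan C0 M R (x * y).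
Proof.
move=> PQR; elim/tspan_ind: x / => [|x1 x2 IH1 IH2|c f hc hf Ty].
- by rewrite mul0r => _; apply: tspan0.
- by move=> Ty; rewrite mulrDl; apply: tspanD; auto.
elim/tspan_ind: y / Ty => [|y1 y2 IH1 IH2|b g hb hg].
- by rewrite mulr0; apply: tspan0.
- by rewrite mulrDr; apply: tspanD.
rewrite -mulrA [M f * _]mulrA -[M f * b](C0c _ hb) -[b * _ * _]mulrA (qframeM frM) !mulrA.
by apply: tspan_gen; [do !apply: subalgM => //|exact: PQR].
Qed.
Lemma tspanMT x y : tspan C0 M predT x -> tspan C0 M predT y ->
  tspan C0 M predT (x * y).
Proof. exact: tspanM. Qed.
Lemma tspan1 P : P 0 -> tspan C0 M P 1.
Proof. by move=> P0; rewrite -(qframe1 frM); apply: tspanM1. Qed.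
Lemma tspanX P x n : P 0 -> (forall f g, P f -> P g -> P (f + g)) ->
  tspan C0 M P x -> tspan C0 M P (x ^+ n).
Proof.
move=> P0 PD Px; elim: n => [|n IH]; first by rewrite expr0; apply: tspan1.
by rewrite exprS; apply: tspanM Px IH.
Qed.
Lemma tspan_subalg P : P 0 -> (forall f g, P f -> P g -> P (f + g)) ->
  is_subalg (tspan C0 M P).
Proof.
move=> P0 PD; apply/is_subalgP; split=> [|a x y Px Py|x y]; first exact: tspan1.
  by apply: tspanD => //; apply: tspanZ.
exact: tspanM.
Qed.

(** Degrees are arbitrary additive functions: both the coordinates [co i] and the functionals
    [form L f] are used as gradings. *)
Definition gr D z : pred 'cV[int]_N := [pred f | D f == z].
Definition is_degree D := forall f g, D (f + g) = D f + D g.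

Hypothesis (fM : tfree C0 M).
Section Graded.
Variables (D : 'cV[int]_N -> int) (DD : is_degree D).

Lemma tspan_grM a b c x y : c = a + b -> tspan C0 M (gr D a) x ->
  tspan C0 M (gr D b) y -> tspan C0 M (gr D c) (x * y).
Proof.
by move=> ->; apply: tspanM => f g /eqP fa /eqP gb; rewrite /gr /= DD fa gb.
Qed.

Lemma degree0 : D 0 = 0.
Proof. by have := DD 0 0; rewrite addr0; lia. Qed.

Lemma tspan_grX a x n : tspan C0 M (gr D a) x ->
  tspan C0 M (gr D (n%:Z * a)) (x ^+ n).
Proof.
move=> hx; elim: n => [|n IH].
  by rewrite expr0; apply: tspan1; rewrite /gr /= degree0 mul0r.
by rewrite exprS; apply: tspan_grM hx IH; lia.
Qed.

Lemma proj_grM a b c x y : c = a + b -> tspan C0 M predT x ->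
  tspan C0 M (gr D b) y ->
  proj C0 M (gr D c) (x * y) = proj C0 M (gr D a) x * y.
Proof.
move=> -> + hy; suff: tspan C0 M predT x -> tspan C0 M predT x /\
    proj C0 M (gr D (a + b)) (x * y) = proj C0 M (gr D a) x * y by move=> h /h[].
have Ty := tspanT hy.
elim/tspan_ind: x / => [|x1 x2 [T1 IH1] [T2 IH2]|e f he _].
- by rewrite mul0r !proj0 // mul0r; split; first exact: tspan0.
- split; first exact: tspanD.
  by rewrite mulrDl !projD ?IH1 ?IH2 ?mulrDl //; apply: tspanMT.
split; first exact: tspan_gen.
have hfy : tspan C0 M (gr D (D f + b)) (e * M f * y).
  by apply: tspan_grM (erefl _) _ hy; apply: tspan_gen => //; apply: eqxx.
rewrite proj_gen // /gr /=; case: eqP => [<-|ne]; first by rewrite proj_id.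
rewrite mul0r (proj_eq0 _ _ hfy) // => g /eqP /= gD.
by apply/eqP => g2; apply: ne; lia.
Qed.

Lemma gr_decomp x : tspan C0 M predT x -> exists s : seq int,
  [/\ uniq s, forall z, z \notin s -> proj C0 M (gr D z) x = 0
    & x = \sum_(z <- s) proj C0 M (gr D z) x].
Proof.
move=> [t [ht ->]]; pose s := undup (map (fun p => D p.2) t).
have t' p : p \in t -> C0 p.1 by case/ht.
have pE z : proj C0 M (gr D z) (\sum_(p <- t) p.1 * M p.2) =
    \sum_(p <- t) if D p.2 == z then p.1 * M p.2 else 0.
  rewrite /proj textE //; apply: eq_bigr => p _.
  by rewrite /gr /=; case: ifP; rewrite ?mulr0.
exists s; split; first exact: undup_uniq.
  move=> z zs; rewrite pE big1_seq // => p /andP[_ pt]; case: eqP => // e.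
  by move: zs; rewrite mem_undup -e (map_f (fun p => D p.2) pt).
under [RHS]eq_bigr do rewrite pE.
rewrite exchange_big /=; apply: eq_big_seq => p pt.
rewrite (bigD1_seq (D p.2)) ?undup_uniq ?mem_undup ?(map_f (fun p => D p.2)) //=.
by rewrite eqxx big1 ?addr0 // => z /negPf ne; rewrite eq_sym ne.
Qed.

Lemma gr_min x : tspan C0 M predT x -> exists m : int,
  forall z, z < m -> proj C0 M (gr D z) x = 0.
Proof.
move=> /gr_decomp[s [_ s0 _]].
have [m hm] : exists m : int, forall z, z \in s -> m <= z.
  elim: s {s0} => [|a s [m hm]]; first by exists 0.
  exists (Num.min a m) => z /[!inE]/orP[/eqP->|/hm]; lia.
by exists m => z zm; apply: s0; apply/negP => /hm; lia.
Qed.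

Lemma gr_max x : tspan C0 M predT x -> exists m : int,
  forall z, m < z -> proj C0 M (gr D z) x = 0.
Proof.
move=> /gr_decomp[s [_ s0 _]].
have [m hm] : exists m : int, forall z, z \in s -> z <= m.
  elim: s {s0} => [|a s [m hm]]; first by exists 0.
  exists (Num.max a m) => z /[!inE]/orP[/eqP->|/hm]; lia.
by exists m => z zm; apply: s0; apply/negP => /hm; lia.
Qed.

Lemma gr_ge m x : tspan C0 M predT x ->
  (forall z, z < m -> proj C0 M (gr D z) x = 0) ->
  tspan C0 M [pred f | m <= D f] x.
Proof.
move=> Tx h; apply: tspan_sup => // f /=; rewrite -ltNge => fm.
have /(congr1 (proj C0 M (pred1 f))) := h _ fm; rewrite proj0 // proj_proj //.
by move=> <-; apply: proj_ext Tx _ => // g _ /=; case: eqP => // ->; rewrite /gr /= eqxx.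
Qed.
End Graded.
End FrameTheory.
End Frame.

(** * Mutation of seeds *)

Section Seeds.
#[local] Set Default Proof Using "All".
Variables (K : fieldType) (F : unitAlgType K) (v : F) (C0 : set F) (N : nat).
Variables (ex : {set 'I_N}) (d : dir ex -> nat).
Hypothesis (H : coef_base v C0).
Local Notation vC := (cb_central H).
Local Notation vU := (cb_unit H).
Local Notation C0s := (cb_subalg H).
Local Notation C0c := (cb_comm H).
Local Notation C0v := (cb_pow H).
#[local] Hint Extern 0 (is_subalg _) => exact: C0s : core.
#[local] Hint Extern 0 (C0 (v ^ _)) => exact: C0v : core.
#[local] Hint Extern 0 (is_true (v \is a GRing.unit)) => exact: vU : core.
Hypothesis (Fdiv : forall x : F, x != 0 -> x \is a GRing.unit).
Implicit Types (s : seed F ex) (k j : dir ex) (B : exmatrix ex).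
Implicit Types (f g h : 'cV[int]_N).

Definition bcol B k : 'cV[int]_N := \col_i B i k.

Lemma co_bcol B k i : co i (bcol B k) = B i k.
Proof using. by rewrite /co mxE. Qed.

(** The invariants shared by all reachable seeds, with one and the same [d]. Compatibility is an
    equality of integers: only so do the functionals [form] give gradings that separate exchange
    monomials. *)
Record good s : Prop := Good {
  good_skew : (qform s)^T = - qform s;
  good_frame : qframe v (qform s) (frame s);
  good_pos : forall k, (0 < d k)%N;
  good_compat : forall k f,
    form (qform s) (bcol (exmat s) k) f = (d k)%:Z * co (val k) f;
  good_free : tfree C0 (frame s)
}.

(* The exponents of the two monomials of the exchange relation. *)
Definition exch_exp B k (b : bool) : 'cV[int]_N :=
  - e_ (val k) + pcol (if b then bcol B k else - bcol B k).
Definition exch s k : F :=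
  frame s (exch_exp (exmat s) k true) + frame s (exch_exp (exmat s) k false).
Definition rem k f : 'cV[int]_N := f - co (val k) f *: e_ (val k).
Definition mutqform k s : 'M[int]_N :=
  (mutation_mx k (exmat s))^T *m qform s *m mutation_mx k (exmat s).
Definition mutframe k s f : F :=
  v ^ (- (co (val k) f * form (mutqform k s) (rem k f) (e_ (val k)))) *
  (frame s (rem k f) * exch s k ^ co (val k) f).
(* [mutation] determines the new frame: it is normalized by
   [M'(f) = v^_ M(f - f_k e_k) exch^f_k]. *)
Definition mut k s : seed F ex :=
  Seed (mutframe k s) (mutate_exmatrix k (exmat s)) (mutqform k s).

Lemma co_rem k f : co (val k) (rem k f) = 0.
Proof using. by rewrite /rem coD coN coZ coek; lia. Qed.
Lemma co_rem_ne k f i : i != val k -> co i (rem k f) = co i f.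
Proof using. by move=> /negPf ik; rewrite /rem coD coN coZ coe ik; lia. Qed.
Lemma rem_id k f : co (val k) f = 0 -> rem k f = f.
Proof using. by rewrite /rem => ->; rewrite scale0r subr0. Qed.
Lemma rem_split k f : f = rem k f + co (val k) f *: e_ (val k).
Proof using. by rewrite /rem subrK. Qed.
Lemma remD k f g : rem k (f + g) = rem k f + rem k g.
Proof using. by apply: co_eqP => i; rewrite /rem !coE; lia. Qed.

Lemma latt_ind (P : 'cV[int]_N -> Prop) : P 0 -> (forall i, P (e_ i)) ->
  (forall f g, P f -> P g -> P (f + g)) -> (forall f, P f -> P (- f)) ->
  forall f, P f.
Proof using.
move=> P0 Pe PD PN f.
have -> : f = \sum_i f i ord0 *: e_ i.
  apply/colP => i; rewrite summxE (bigD1 i) //= big1 => [|j /negPf ji].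
    by rewrite !mxE !eqxx mulr1 addr0.
  by rewrite !mxE eq_sym ji mulr0.
elim/big_ind: _ => // i _.
have Pn n : P (n%:Z *: e_ i).
  elim: n => [|n IH]; first by rewrite scale0r.
  by rewrite intS scalerDl scale1r; apply: PD.
by case: (f i ord0) => n //; rewrite NegzE scaleNr; apply: PN.
Qed.

Lemma pcol_sum (b : 'I_N -> int) :
  \sum_i Num.max 0 (b i) *: e_ i = pcol (\col_i b i) :> 'cV[int]_N.
Proof using.
apply/colP => i; rewrite summxE (bigD1 i) //= big1 => [|j /negPf ji].
  by rewrite !mxE !eqxx mulr1 addr0.
by rewrite !mxE eq_sym ji mulr0.
Qed.

Lemma mutation_frame_eqE s s' k : mutation v k s s' ->
  frame s' (e_ (val k)) = exch s k.
Proof using.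
move=> /mutation_frame_eq ->; rewrite !pcol_sum /exch /exch_exp.
by congr (frame s (_ + pcol _) + frame s (_ + pcol _)); apply/colP => i; rewrite !mxE.
Qed.

(** The product rule writes [M (f + g)] and [M (- f)] through [M f] and [M g], so the values on the
    basis vectors generate all others. *)
Lemma frame_ext (L : 'M[int]_N) (M1 M2 : 'cV[int]_N -> F) : L^T = - L ->
  qframe v L M1 -> qframe v L M2 -> (forall i, M1 (e_ i) = M2 (e_ i)) ->
  M1 = M2.
Proof using H.
move=> sk f1 f2 e; apply/funext; apply: latt_ind => // [|f g e1 e2|f e1].
- by rewrite (qframe1 f1) (qframe1 f2).
- by rewrite (qframeD H sk f1) (qframeD H sk f2) e1 e2.
by rewrite -(qframeV H sk f1) -(qframeV H sk f2) e1.
Qed.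

Section Mutate.
Variables (s : seed F ex) (gs : good s) (k : dir ex).
Local Notation M := (frame s).
Local Notation B := (exmat s).
Local Notation L := (qform s).
Local Notation x := (exch s k).
Local Notation T := (tspan C0 M).
Local Notation sk := (good_skew gs).
Local Notation frM := (good_frame gs).
Local Notation fM := (good_free gs).
#[local] Hint Extern 0 (tfree _ _) => exact: fM : core.
#[local] Hint Extern 0 (_^T = - _) => exact: sk : core.

Lemma good_sym p q : (d p)%:Z * B (val p) q = - ((d q)%:Z * B (val q) p).
Proof.
by rewrite -!co_bcol -!(good_compat gs); apply: form_skew.
Qed.
Lemma good_dpos p : 0 < (d p)%:Z.
Proof. by have := good_pos gs p; lia. Qed.
Lemma good_diag p : B (val p) p = 0.
Proof. by have := good_sym p p; have := good_dpos p; nia. Qed.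
Lemma co_exch_exp b : co (val k) (exch_exp B k b) = -1.
Proof. by rewrite /exch_exp; case: b; rewrite coD coN coek co_pcol ?coN co_bcol good_diag. Qed.
Lemma exch_exp_sub : exch_exp B k true - exch_exp B k false = bcol B k.
Proof. by rewrite /exch_exp -[RHS]pcol_sub opprD addrACA subrr add0r. Qed.

Lemma mutation_mxE f :
  mutation_mx k B *m f = tropmap (val k) (pcol (- bcol B k)) f.
Proof.
apply: co_eqP => i; rewrite co_tropmap co_pcol coN co_bcol /co mxE.
rewrite (bigD1 (val k)) //= mxE eqxx /=.
have -> : \sum_(j | j != val k) mutation_mx k B i j * f j ord0 =
    if i == val k then 0 else f i ord0.
  case: (eqVneq i (val k)) => [->|ik].
    by rewrite big1 // => j jk; rewrite mxE jk eq_sym (negPf jk) mul0r.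
  rewrite (bigD1 i) //= mxE ik eqxx mul1r big1 ?addr0 // => j /andP[jk ji].
  by rewrite mxE jk eq_sym (negPf ji) mul0r.
by case: eqP => [->|_]; rewrite ?good_diag; lia.
Qed.

(** The maps for the two signs differ by [co (val k) f] times the column b_k. By compatibility the
    two cross terms of the form cancel, and the remaining term vanishes by skew-symmetry. Free
    choice of the sign is used throughout. *)
Lemma mutformE (b : bool) f g : form (mutqform k s) f g =
  form L (tropmap (val k) (pcol (if b then bcol B k else - bcol B k)) f)
         (tropmap (val k) (pcol (if b then bcol B k else - bcol B k)) g).
Proof.
rewrite /mutqform form_congr !mutation_mxE; case: b; last by [].
have e h : tropmap (val k) (pcol (bcol B k)) h =
    tropmap (val k) (pcol (- bcol B k)) h + co (val k) h *: bcol B k.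
  apply: co_eqP => i; rewrite coD coZ !co_tropmap !co_pcol coN !co_bcol.
  have -> : Num.max 0 (B i k) = Num.max 0 (- B i k) + B i k by lia.
  by ring.
have co_t h : co (val k) (tropmap (val k) (pcol (- bcol B k)) h) = - co (val k) h.
  by rewrite co_tropmap eqxx co_pcol coN co_bcol good_diag; lia.
rewrite !e; move: (tropmap _ _ f) (tropmap _ _ g) (co_t f) (co_t g) => a c ca cc.
have ab : form L a (bcol B k) = (d k)%:Z * co (val k) f.
  by rewrite (form_skew _ _ sk) (good_compat gs) ca; ring.
by rewrite !formE form_alt // ab (good_compat gs) cc; ring.
Qed.

Lemma mutqform_skew : (mutqform k s)^T = - mutqform k s.
Proof. exact: congr_skew. Qed.

Lemma mutform0 f g : co (val k) f = 0 -> co (val k) g = 0 ->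
  form (mutqform k s) f g = form L f g.
Proof. by move=> f0 g0; rewrite (mutformE true) !tropmap0. Qed.
Lemma mutform_ek b f : co (val k) f = 0 ->
  form (mutqform k s) f (e_ (val k)) = form L f (exch_exp B k b).
Proof. by move=> f0; rewrite (mutformE b) tropmap0 // tropmap_ek. Qed.

Lemma exch_gr : T (gr (co (val k)) (-1)) x.
Proof.
by apply: tspanD; apply: tspanM1 => //; rewrite /gr /= co_exch_exp.
Qed.
Lemma exch_T : T predT x. Proof. exact: tspanT exch_gr. Qed.

Lemma exch_exp_ne : exch_exp B k true != exch_exp B k false.
Proof.
apply/eqP => /eqP; rewrite -subr_eq0 exch_exp_sub => /eqP e.
have := good_compat gs k (e_ (val k)); rewrite e form0l coek.
by have := good_dpos k; lia.
Qed.

Lemma exch_neq0 : x != 0.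
Proof.
apply/eqP => x0.
have h := @fM [:: exch_exp B k true; exch_exp B k false] (fun=> 1).
have: (1 : F) = 0.
  apply: (h _ _ _ (exch_exp B k true)).
  - by rewrite /= inE exch_exp_ne.
  - by move=> _; apply: subalg1.
  - by rewrite big_cons big_seq1 !mul1r.
  - by rewrite inE eqxx.
by move/eqP; rewrite oner_eq0.
Qed.
Lemma exchU : x \is a GRing.unit.
Proof. exact/Fdiv/exch_neq0. Qed.

(** By [mutform_ek] both monomials of the exchange element commute with [M g] up to the same power
    of v, so their sum does too. *)
Lemma exch_comm g : co (val k) g = 0 ->
  M g * x = v ^ (form (mutqform k s) g (e_ (val k)) *+ 2) * (x * M g).
Proof.
move=> g0; rewrite /exch mulrDr mulrDl mulrDr.
congr (_ + _); first by rewrite (mutform_ek true) // (qframeC H sk frM).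
by rewrite (mutform_ek false) // (qframeC H sk frM).
Qed.

Lemma exch_commX g (n : nat) : co (val k) g = 0 ->
  M g * x ^+ n = v ^ (n%:Z * (form (mutqform k s) g (e_ (val k)) *+ 2)) * (x ^+ n * M g).
Proof.
move=> g0; elim: n => [|n IH]; first by rewrite mul0r expr0z !expr0 mul1r mulr1 mul1r.
rewrite exprS mulrA exch_comm // -!mulrA IH (vzA H _ x) (vzK H); congr (v ^ _ * _).
by rewrite intS; ring.
Qed.

Lemma exch_commz g (z : int) : co (val k) g = 0 ->
  M g * x ^ z = v ^ (z * (form (mutqform k s) g (e_ (val k)) *+ 2)) * (x ^ z * M g).
Proof.
move=> g0; case: z => n; first by rewrite -exprnP exch_commX.
rewrite NegzE -exprnN.
have xU : x ^+ n.+1 \is a GRing.unit by rewrite unitrX // exchU.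
apply: (mulrI xU); apply: (mulIr xU).
rewrite -!mulrA mulVr // mulr1 (vzA H) (mulrA (x ^+ _) _^-1) divrr // mul1r.
by rewrite exch_commX // (vzK H) mulNr addNr expr0z mul1r.
Qed.

Lemma mutframe_rem f : co (val k) f = 0 -> mutframe k s f = M f.
Proof.
by move=> f0; rewrite /mutframe f0 mul0r oppr0 !expr0z mul1r mulr1 rem_id.
Qed.
Lemma mutframe_ek : mutframe k s (e_ (val k)) = x.
Proof.
rewrite /mutframe coek /rem coek scale1r subrr form0l mulr0 oppr0 expr0z mul1r.
by rewrite (qframe1 frM) mul1r expr1z.
Qed.
Lemma mutframe_eknat (n : nat) : mutframe k s (n%:Z *: e_ (val k)) = x ^+ n.
Proof.
rewrite /mutframe coZ coek mulr1 /rem coZ coek mulr1 subrr form0l mulr0 oppr0.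
by rewrite expr0z mul1r (qframe1 frM) mul1r -exprnP.
Qed.

Lemma mut_qframe : qframe v (mutqform k s) (mutframe k s).
Proof.
split; first by rewrite mutframe_rem ?co0 // (qframe1 frM).
move=> f g; rewrite /mutframe remD.
rewrite !(coD (val k)); set a := co _ f; set b := co _ g.
set m := mutqform k s; set y := rem k f; set w := rem k g.
rewrite -!mulrA (vzA H) !(vzK H) (vzA H) (vzK H).
rewrite (mulrA (x ^ a)).
have h : x ^ a * M w = v ^ (- (a * (form m w (e_ (val k)) *+ 2))) * (M w * x ^ a).
  by rewrite exch_commz ?co_rem // (vzK H) addNr expr0z mul1r.
rewrite h -!mulrA (vzA H) (vzK H) (mulrA (M y)) (qframeM frM) -!mulrA (vzK H).
rewrite -exprzDr ?exchU //; congr (v ^ _ * _).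
have fE : form m f g = form L y w + b * form m y (e_ (val k)) - a * form m w (e_ (val k)).
  have y0 : co (val k) y = 0 by apply: co_rem.
  have w0 : co (val k) w = 0 by apply: co_rem.
  rewrite (rem_split k f) (rem_split k g) -/y -/w -/a -/b; clearbody y w a b.
  rewrite !formE -(mutform0 y0 w0) -/m (form_alt _ mutqform_skew).
  by rewrite (form_skew (e_ (val k)) w mutqform_skew); ring.
clearbody y w.
by rewrite fE !formE; ring.
Qed.

(** The sign of b_kj selects the monomial for which matrix mutation of column j is the linear map
    [tropmap]. *)
Definition tropg j : 'cV[int]_N :=
  pcol (if 0 <= B (val k) j then bcol B k else - bcol B k).

Lemma bcol_mut_eq : bcol (exmat (mut k s)) k = - bcol B k.
Proof.
by apply: co_eqP => i; rewrite coN !co_bcol /= /mutate_exmatrix eqxx orbT.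
Qed.
Lemma bcol_mut_ne j : j != k ->
  bcol (exmat (mut k s)) j = tropmap (val k) (tropg j) (bcol B j).
Proof.
move=> jk; apply: co_eqP => i; rewrite co_tropmap !co_bcol /= /mutate_exmatrix.
rewrite (negPf jk) orbF /tropg; case: eqP => [->|_].
  by case: ifP => _; rewrite co_pcol ?coN co_bcol good_diag ?oppr0 maxxx /= mulr2n; lia.
case: ifP => kj; rewrite co_pcol ?coN co_bcol !mulr0n.
  have -> : Num.max 0 (B (val k) j) = B (val k) j by lia.
  have -> : Num.max 0 (- B (val k) j) = 0 by lia.
  by ring.
have -> : Num.max 0 (B (val k) j) = 0 by lia.
have -> : Num.max 0 (- B (val k) j) = - B (val k) j by lia.
by ring.
Qed.

Lemma co_tropg_k j : co (val k) (tropg j) = 0.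
Proof. by rewrite /tropg; case: ifP => _; rewrite co_pcol ?coN co_bcol good_diag. Qed.
(** Skew-symmetrizability gives b_jk the sign opposite to b_kj, so the chosen positive part vanishes
    at j. *)
Lemma co_tropg_j j : co (val j) (tropg j) = 0.
Proof.
have := good_sym j k; have := good_dpos j; have := good_dpos k.
by rewrite /tropg; case: ifP => h; rewrite co_pcol ?coN co_bcol; nia.
Qed.

Lemma mutformgE j f g : form (mutqform k s) f g =
  form L (tropmap (val k) (tropg j) f) (tropmap (val k) (tropg j) g).
Proof. by rewrite (mutformE (0 <= B (val k) j)). Qed.

Lemma trop_bcol j : j != k ->
  tropmap (val k) (tropg j) (bcol (exmat (mut k s)) j) = bcol B j.
Proof. by move=> jk; rewrite bcol_mut_ne // tropmapK // co_tropg_k. Qed.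

(** With the sign adapted to j, the tropical map sends the new column j back to the old one and
    preserves the coordinate j, which reduces the claim to compatibility of [s]. *)
Lemma mut_compat j f :
  form (qform (mut k s)) (bcol (exmat (mut k s)) j) f = (d j)%:Z * co (val j) f.
Proof.
rewrite [qform _]/=; case: (eqVneq j k) => [->|jk].
  rewrite bcol_mut_eq formNl (mutformE true) tropmap0; last first.
    by rewrite co_bcol good_diag.
  by rewrite (good_compat gs) co_tropmap eqxx co_pcol co_bcol good_diag; lia.
rewrite (mutformgE j) trop_bcol // (good_compat gs) co_tropmap co_tropg_j.
have /negPf-> : val j != val k by [].
by rewrite !mulr0n subrr mulr0 addr0.
Qed.

(** After clearing denominators, the e_k-degree of a term of the relation records its power of the
    exchange element. Terms of one degree share that power; cancelling it leaves a relation between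
    old monomials. *)
Lemma mut_free : tfree C0 (mutframe k s).
Proof.
move=> t c ut hc e.
(* Multiplication by the n-th power of the exchange element will make all its exponents
   nonnegative. *)
have [n hn] : exists n : nat, forall f, f \in t -> 0 <= co (val k) f + n%:Z.
  elim: t {ut e} => [|f t [n hn]]; first by exists 0%N.
  exists (n + absz (co (val k) f))%N => g /[!inE]/orP[/eqP->|/hn]; lia.
pose a f := v ^ (- (co (val k) f * form (mutqform k s) (rem k f) (e_ (val k)))).
pose m f : nat := absz (co (val k) f + n%:Z).
have mE f : f \in t -> co (val k) f + n%:Z = (m f)%:Z by move=> /hn; rewrite /m; lia.
have e1 : \sum_(f <- t) c f * (a f * (M (rem k f) * x ^+ m f)) = 0.
  move/(congr1 (fun y => y * x ^+ n)): e; rewrite mul0r mulr_suml => e1.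
  rewrite -[RHS]e1; apply: eq_big_seq => f ft; rewrite /mutframe -!mulrA.
  by rewrite [x ^+ n]exprnP -exprzDr ?exchU // mE.
move=> f ft; pose t' := [seq g <- t | m g == m f].
have hgr g : T (gr (co (val k)) (- (m g)%:Z)) (c g * (a g * (M (rem k g) * x ^+ m g))).
  do 2! apply: tspanC => //; first by apply: C0v.
  apply: (tspan_grM H sk frM fM (@coD _ (val k)) (a := 0) (b := - (m g)%:Z)); first by rewrite add0r.
    by apply: tspanM1 => //; rewrite /gr /= co_rem.
  have := tspan_grX H sk frM fM (@coD _ (val k)) (m g) exch_gr.
  by rewrite mulrN1.
have e2 : (\sum_(g <- t') c g * (a g * M (rem k g))) = 0.
  have /(congr1 (proj C0 M (gr (co (val k)) (- (m f)%:Z)))) := e1.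
  rewrite proj0 // proj_sum //; last by move=> g _; apply: tspanT (hgr g).
  under eq_bigr => g _.
    rewrite (_ : proj _ _ _ _ = if m g == m f then c g * (a g * M (rem k g)) * x ^+ m f else 0); last first.
      case: eqP => [<-|ne]; first by rewrite proj_id // !mulrA.
      apply: proj_eq0 (hgr g) _ => // h /eqP; rewrite /gr /= => ->.
      by apply/eqP => h2; apply: ne; lia.
    over.
  rewrite -big_mkcond -big_filter -mulr_suml => /(congr1 (fun y => y * (x ^+ m f)^-1)).
  by rewrite mul0r mulrK // unitrX // exchU.
pose u := [seq rem k g | g <- t'].
have remI : {in t' &, injective (rem k)}.
  move=> g h; rewrite !mem_filter => /andP[/eqP mg gt] /andP[/eqP mh ht] gh.
  rewrite (rem_split k g) (rem_split k h) gh; congr (_ + _ *: _).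
  by have := mE _ gt; have := mE _ ht; lia.
have uu : uniq u by rewrite map_inj_in_uniq // filter_uniq.
have ft' : f \in t' by rewrite mem_filter eqxx.
(* Inverse of [rem k] on [t'], whose elements all have the same coordinate k as [f]. *)
pose sh g := g + co (val k) f *: e_ (val k).
have shE g : g \in t' -> sh (rem k g) = g.
  rewrite mem_filter => /andP[/eqP mg gt].
  have cfg : co (val k) f = co (val k) g.
    by have := mE _ gt; have := mE _ ft; lia.
  by rewrite /sh cfg -rem_split.
have := @fM u (fun g => c (sh g) * a (sh g)) uu _ _ (rem k f) (map_f _ ft').
rewrite shE // => h.
suff h0 : c f * a f = 0.
  by apply/(mulIr (vzU H (- (co (val k) f * form (mutqform k s) (rem k f) (e_ (val k)))))); rewrite mul0r.
apply: h => [g|]; first by apply: subalgM => //; apply: C0v.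
rewrite big_map -[RHS]e2; apply: eq_big_seq => g gt'.
by rewrite shE // mulrA.
Qed.

Lemma mut_good : good (mut k s).
Proof.
split; [exact: mutqform_skew|exact: mut_qframe|exact: good_pos gs|exact: mut_compat|].
exact: mut_free.
Qed.

(** The relation fixes the new frame on basis vectors and imposes the product rule, so [frame_ext]
    leaves one possibility. *)
Lemma mutationP s' : mutation v k s s' <-> s' = mut k s.
Proof.
split=> [h|->].
  have e1 : exmat s' = mutate_exmatrix k B.
    by apply/funext => i; apply/funext => j; apply: (mutation_exmat h).
  have e2 := mutation_qform h.
  have e3 := mutation_frame_eqE h.
  (* The value 1 at the exponent 0 is obtained by cancelling the unit [exch s k] in the product of
     the frames at e_k and 0. *)
  have fr' : qframe v (mutqform k s) (frame s').
    split; last by move=> f g; rewrite (mutation_frame_mul h) e2.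
    have := mutation_frame_mul h (e_ (val k)) 0.
    rewrite form0r expr0z mul1r addr0 e3 => e4.
    by apply: (mulrI exchU); rewrite e4 mulr1.
  have e5 : frame s' = mutframe k s.
    apply: frame_ext mutqform_skew fr' mut_qframe _ => i.
    case: (eqVneq i (val k)) => [->|ik]; first by rewrite e3 mutframe_ek.
    by rewrite mutframe_rem ?coe 1?eq_sym ?(negPf ik) // (mutation_frame_ne h).
  by case: s' e1 e2 e5 {h e3 fr'} => f b q /= -> -> ->.
split=> //=.
- by move=> i ik; rewrite mutframe_rem ?coe 1?eq_sym ?(negPf ik).
- rewrite mutframe_ek !pcol_sum /exch /exch_exp.
  by congr (frame s (_ + pcol _) + frame s (_ + pcol _)); apply/colP => i; rewrite !mxE.
- exact: (qframeM mut_qframe).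
Qed.
End Mutate.
End Seeds.

(** * Adjacent seeds *)

Section Adjacent.
#[local] Set Default Proof Using "All".
Variables (K : fieldType) (F : unitAlgType K) (v : F) (C0 : set F) (N : nat).
Variables (ex : {set 'I_N}) (d : dir ex -> nat).
Hypothesis (H : coef_base v C0).
Local Notation vC := (cb_central H).
Local Notation vU := (cb_unit H).
Local Notation C0s := (cb_subalg H).
Local Notation C0c := (cb_comm H).
Local Notation C0v := (cb_pow H).
#[local] Hint Extern 0 (is_subalg C0) => exact: C0s : core.
#[local] Hint Extern 0 (C0 (v ^ _)) => exact: C0v : core.
#[local] Hint Extern 0 (is_true (v \is a GRing.unit)) => exact: vU : core.
#[local] Hint Extern 0 (_ * _ = _ * _) => (apply: C0c; assumption) : core.
Hypothesis (Fdiv : forall x : F, x != 0 -> x \is a GRing.unit).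
Implicit Types (s : seed F ex) (j : dir ex).
Implicit Types (f g h : 'cV[int]_N) (P Q R : pred 'cV[int]_N).

Section Single.
Variables (s : seed F ex) (gs : good v C0 d s).
Local Notation T := (tspan C0 (frame s)).

Lemma seedM P Q R x y : (forall f g, P f -> Q g -> R (f + g)) ->
  T P x -> T Q y -> T R (x * y).
Proof. exact: (tspanM H (good_skew gs) (good_frame gs)). Qed.
Lemma seedMT x y : T predT x -> T predT y -> T predT (x * y).
Proof. exact: seedM. Qed.
Lemma seedX P x n : P 0 -> (forall f g, P f -> P g -> P (f + g)) ->
  T P x -> T P (x ^+ n).
Proof. exact: (tspanX H (good_skew gs) (good_frame gs)). Qed.
Lemma seedXT x n : T predT x -> T predT (x ^+ n).
Proof. exact: seedX. Qed.
Lemma seed_gr i f z : co i f = z -> T (gr (co i) z) (frame s f).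
Proof. by move=> fz; apply: tspanM1 => //; rewrite /gr /= fz. Qed.
Lemma seed_frT f : T predT (frame s f).
Proof. exact: tspanM1. Qed.
Lemma seedMgr (D : 'cV[int]_N -> int) a b c x y : is_degree D -> c = a + b ->
  T (gr D a) x -> T (gr D b) y -> T (gr D c) (x * y).
Proof. by move=> DD; apply: (tspan_grM H (good_skew gs) (good_frame gs) (good_free gs) DD). Qed.
Lemma seedXgr (D : 'cV[int]_N -> int) a x n : is_degree D ->
  T (gr D a) x -> T (gr D (n%:Z * a)) (x ^+ n).
Proof. by move=> DD; apply: (tspan_grX H (good_skew gs) (good_frame gs) (good_free gs) DD). Qed.
Lemma seed_projM (D : 'cV[int]_N -> int) a b c x y : is_degree D ->
  c = a + b -> T predT x -> T (gr D b) y ->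
  proj C0 (frame s) (gr D c) (x * y) = proj C0 (frame s) (gr D a) x * y.
Proof. by move=> DD; apply: (proj_grM H (good_skew gs) (good_frame gs) (good_free gs) DD). Qed.
Lemma seed_decomp (D : 'cV[int]_N -> int) x : is_degree D -> T predT x ->
  exists t : seq int, x = \sum_(z <- t) proj C0 (frame s) (gr D z) x.
Proof.
by move=> DD /(gr_decomp H (good_skew gs) (good_frame gs) (good_free gs) DD)[t [_ _ e]]; exists t.
Qed.
Lemma seed_min (D : 'cV[int]_N -> int) x : is_degree D -> T predT x ->
  exists n : nat, T [pred f | - n%:Z <= D f] x.
Proof.
move=> DD Tx.
have [m hm] := gr_min H (good_skew gs) (good_frame gs) (good_free gs) DD Tx.
exists (absz m); apply: (gr_ge H (good_skew gs) (good_frame gs) (good_free gs) DD Tx).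
by move=> z zm; apply: hm; lia.
Qed.
Lemma seed_max (D : 'cV[int]_N -> int) x : is_degree D -> T predT x ->
  exists m : int, forall z, m < z -> proj C0 (frame s) (gr D z) x = 0.
Proof. by move=> DD; apply: (gr_max H (good_skew gs) (good_frame gs) (good_free gs) DD). Qed.
Lemma seed_ge (D : 'cV[int]_N -> int) m x : is_degree D -> T predT x ->
  (forall z, z < m -> proj C0 (frame s) (gr D z) x = 0) ->
  T [pred f | m <= D f] x.
Proof. by move=> DD; apply: (gr_ge H (good_skew gs) (good_frame gs) (good_free gs) DD). Qed.
Lemma seed_proj P Q x : T Q x -> T (predI P Q) (proj C0 (frame s) P x).
Proof. by apply: proj_in => //; apply: good_free gs. Qed.
Lemma seed_projgr (D : 'cV[int]_N -> int) z x : T predT x ->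
  T (gr D z) (proj C0 (frame s) (gr D z) x).
Proof. by move=> /(seed_proj (gr D z)); apply: tspanS => f /andP[]. Qed.
Lemma seed_projT P x : T predT x -> T predT (proj C0 (frame s) P x).
Proof. by move=> /(seed_proj P); apply: tspanT. Qed.
Lemma seedU f : frame s f \is a GRing.unit.
Proof. exact: (qframeU H (good_skew gs) (good_frame gs) f). Qed.
Lemma seed_mulN f : frame s f * frame s (- f) = 1.
Proof. exact: (qframe_mulN H (good_skew gs) (good_frame gs) f). Qed.
Lemma seed_Nmul f : frame s (- f) * frame s f = 1.
Proof. exact: (qframe_Nmul H (good_skew gs) (good_frame gs) f). Qed.
Lemma seedC f g : frame s f * frame s g =
  v ^ (form (qform s) f g *+ 2) * (frame s g * frame s f).
Proof. exact: (qframeC H (good_skew gs) (good_frame gs) f g). Qed.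
Lemma seed_pow f n : frame s f ^+ n = frame s (f *+ n).
Proof. exact: (qframeX H (good_skew gs) (good_frame gs) f n). Qed.
End Single.

Lemma degree_co i : is_degree (@co N i).
Proof using. exact: coD. Qed.
Lemma degree_form (L : 'M[int]_N) f : is_degree (form L f).
Proof using. by move=> g h; rewrite formDr. Qed.
#[local] Hint Extern 0 (is_degree (co _)) => exact: degree_co : core.

Section Adj.
Variables (s : seed F ex) (gs : good v C0 d s) (k : dir ex).
Local Notation M := (frame s).
Local Notation s1 := (mut v k s).
Local Notation x := (exch s k).
Local Notation T := (tspan C0 M).
Local Notation T1 := (tspan C0 (frame s1)).
Let g1 := mut_good H Fdiv gs k.

Lemma mut_frame_k (n : nat) : frame s1 (n%:Z *: e_ (val k)) = x ^+ n.
Proof. exact: (mutframe_eknat H Fdiv gs k n). Qed.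
Lemma mut_frame0 f : co (val k) f = 0 -> frame s1 f = M f.
Proof. exact: (mutframe_rem H Fdiv gs). Qed.
Lemma mut_frame_Nk (n : nat) : frame s1 (- (n%:Z *: e_ (val k))) = (x ^+ n)^-1.
Proof.
rewrite -mut_frame_k; apply: (mulrI (seedU g1 (n%:Z *: e_ (val k)))).
by rewrite seed_mulN // divrr // seedU.
Qed.

Lemma tspan_mut0 P y : (forall f, P f -> co (val k) f = 0) -> T P y <-> T1 P y.
Proof.
move=> P0; split=> -[t [ht ->]]; exists t; split=> //.
  by apply: eq_big_seq => p /ht[_ /P0 pk]; rewrite mut_frame0.
by apply: eq_big_seq => p /ht[_ /P0 pk]; rewrite mut_frame0.
Qed.

Lemma mut_clear y : T1 predT y -> exists n : nat, forall m : nat, (n <= m)%N ->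
  T1 [pred f | 0 <= co (val k) f] (y * x ^+ m).
Proof.
move=> /(seed_min g1 (degree_co (val k)))[n hn]; exists n => m nm.
rewrite -mut_frame_k; apply: (seedM g1 _ hn (seed_gr (i := val k) g1 (erefl _))) => f g /=.
by rewrite /gr /= coD => fn /eqP ->; rewrite coZ coek; lia.
Qed.

(** Nonnegative powers of the new variable expand in the old torus. The exchange element has
    e_k-degree -1 there and degree 1 in the new torus, so the two gradings are opposite. *)
Lemma mut_poly y z : T1 [pred f | 0 <= co (val k) f] y ->
  T predT y /\ proj C0 M (gr (co (val k)) (- z)) y =
               proj C0 (frame s1) (gr (co (val k)) z) y.
Proof.
have f1 := good_free g1; have f0 := good_free gs.
suff: T1 [pred f | 0 <= co (val k) f] y -> T1 predT y /\ (T predT y /\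
    proj C0 M (gr (co (val k)) (- z)) y = proj C0 (frame s1) (gr (co (val k)) z) y).
  by move=> h /h[].
elim/tspan_ind: y / => [|y1 y2 [T1a [Ta e1]] [T1b [Tb e2]]|c f hc hf].
- by rewrite !proj0 //; split; [|split=> //]; exact: tspan0.
- by rewrite !projD // e1 e2; split; [|split=> //]; exact: tspanD.
split; first exact: tspan_gen.
have {}hf : 0 <= co (val k) f := hf.
have hy : T (gr (co (val k)) (- co (val k) f)) (c * frame s1 f).
  apply: tspanC => //; rewrite [frame s1 f]/(mutframe v k s f) /mutframe; apply: tspanC => //.
  have -> : co (val k) f = (absz (co (val k) f))%:Z by lia.
  rewrite -exprnP.
  have h0 := seed_gr gs (co_rem k f).
  have h1 := seedXgr gs (absz (co (val k) f)) (degree_co (val k)) (exch_gr H Fdiv gs k).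
  by apply: seedMgr (degree_co (val k)) _ h0 h1 => //; rewrite mulrN1 add0r.
split; first exact: tspanT hy.
rewrite [RHS]proj_gen // {2}/gr /=; case: eqP => [<-|ne]; first by rewrite proj_id.
apply: proj_eq0 hy _ => // h /eqP /= hh.
by apply/eqP => h2; apply: ne; lia.
Qed.

Lemma mut_polyT y : T1 [pred f | 0 <= co (val k) f] y -> T predT y.
Proof. by move=> /(mut_poly 0)[]. Qed.

Lemma exchXU n : x ^+ n \is a GRing.unit.
Proof. by rewrite unitrX // (exchU H Fdiv gs). Qed.

Lemma exch_s1 : T1 (gr (co (val k)) 1) x.
Proof.
by rewrite -[x]expr1 -mut_frame_k; apply: (seed_gr g1); rewrite scale1r coek.
Qed.

Lemma exchX_gr n : T (gr (co (val k)) (- n%:Z)) (x ^+ n).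
Proof.
have := seedXgr gs n (degree_co (val k)) (exch_gr H Fdiv gs k).
by rewrite mulrN1.
Qed.
Lemma exchX_gr1 n : T1 (gr (co (val k)) n%:Z) (x ^+ n).
Proof.
have := seedXgr g1 n (degree_co (val k)) exch_s1.
by rewrite mulr1.
Qed.

(** A power of the exchange element, homogeneous in both tori, reduces to the polynomial case and is
    cancelled afterwards. *)
Lemma proj_mut y z : T predT y -> T1 predT y ->
  proj C0 M (gr (co (val k)) (- z)) y = proj C0 (frame s1) (gr (co (val k)) z) y.
Proof.
move=> Ty T1y; have [n hn] := mut_clear T1y.
have /(mut_poly (z + n%:Z))[_] := hn n (leqnn n).
rewrite (seed_projM gs (a := - z) (b := - n%:Z)) //; first last.
- exact: exchX_gr.
- by rewrite opprD.
rewrite (seed_projM g1 (a := z) (b := n%:Z)) //; last exact: exchX_gr1.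
by move/(mulIr (exchXU n)).
Qed.

Lemma proj_mut_hom y n P : (forall f z, P (f + z *: e_ (val k)) = P f) ->
  T1 P y -> T1 (gr (co (val k)) n%:Z) y ->
  exists2 p, T [pred f | P f && (co (val k) f == 0)] p & y = p * x ^+ n.
Proof.
move=> Pk Py hy; exists (y * (x ^+ n)^-1); last by rewrite mulrVK // exchXU.
apply/tspan_mut0 => [f /andP[_ /eqP]//|].
rewrite -mut_frame_Nk.
have f1 := good_free g1.
apply: (seedM g1 _ (tspan_inI C0s f1 Py hy) (Q := pred1 (- (n%:Z *: e_ (val k))))).
  move=> f g /andP[/= Pf /eqP fn] /eqP ->.
  by rewrite -scaleNr Pk Pf coD coZ coek fn; apply/eqP; ring.
by apply: tspanM1 => //; rewrite /= eqxx.
Qed.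

(** The component of degree n in the new torus is a k-free element times the n-th power of the new
    variable. With the converse [in_mutT] this characterizes the adjacent torus by divisibility of
    negative components. *)
Lemma proj_mut_exch y n : T predT y -> T1 predT y ->
  exists2 p, T (gr (co (val k)) 0) p & proj C0 M (gr (co (val k)) (- n%:Z)) y = p * x ^+ n.
Proof.
move=> Ty T1y; rewrite proj_mut //.
have hw := seed_projgr g1 (co (val k)) n%:Z T1y.
have [p hp ->] := @proj_mut_hom _ n predT (fun _ _ => erefl) (tspanT hw) hw.
by exists p => //; apply: tspanS hp.
Qed.

Lemma gr0_s1 p : T (gr (co (val k)) 0) p -> T1 predT p.
Proof. by move=> hp; apply: tspanT; apply/(tspan_mut0 p (P := gr (co (val k)) 0)) => // f /eqP. Qed.

Lemma exch_T1 n : T1 predT (x ^+ n).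
Proof. exact: tspanT (exchX_gr1 n). Qed.

(** A component of nonnegative degree needs no condition: the inverse powers of the new variable
    absorb it. *)
Lemma in_mutT y : T predT y ->
  (forall n : nat, exists2 p, T (gr (co (val k)) 0) p &
     proj C0 M (gr (co (val k)) (- n.+1%:Z)) y = p * x ^+ n.+1) -> T1 predT y.
Proof.
move=> Ty h; have [t ->] := seed_decomp gs (degree_co (val k)) Ty.
apply: tspan_sum => z _; set w := proj _ _ _ _.
have hw : T (gr (co (val k)) z) w by apply: seed_projgr.
case: (leP 0 z) => z0.
  have -> : w = w * x ^+ absz z * frame s1 (- ((absz z)%:Z *: e_ (val k))).
    by rewrite mut_frame_Nk mulrK // exchXU.
  apply: (seedMT g1); last exact: (seed_frT g1).
  apply: gr0_s1; apply: (seedMgr gs _ _ hw (exchX_gr _)) => //; lia.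
have [p hp e] := h (absz z).-1; rewrite /w.
have -> : z = - ((absz z).-1.+1)%:Z by clear -z0; case: z z0 => // n _; rewrite NegzE.
rewrite e; apply: (seedMT g1); [exact: gr0_s1|exact: exch_T1].
Qed.

Lemma nonneg_mutT y : T [pred f | 0 <= co (val k) f] y -> T1 predT y.
Proof.
move=> hy; apply: in_mutT (tspanT hy) _ => n; exists 0; first exact: tspan0.
rewrite mul0r (proj_eq0 _ _ hy) //; first exact: good_free gs.
by move=> f f0; apply/negP => /eqP e; have : 0 <= co (val k) f := f0; rewrite e; lia.
Qed.

Lemma frame_mutT f : 0 <= co (val k) f -> T1 predT (M f).
Proof. by move=> f0; apply: nonneg_mutT; apply: tspanM1. Qed.

End Adj.

Section RankTwo.
Variables (s : seed F ex) (gs : good v C0 d s) (k j : dir ex) (jk : j != k).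
Local Notation M := (frame s).
Local Notation B := (exmat s).
Local Notation L := (qform s).
Local Notation s1 := (mut v k s).
Local Notation s2 := (mut v j s).
Local Notation s12 := (mut v j s1).
Local Notation x := (exch s k).
Local Notation y := (exch s j).
Local Notation T := (tspan C0 M).
Local Notation T1 := (tspan C0 (frame s1)).
Local Notation T2 := (tspan C0 (frame s2)).
Local Notation T12 := (tspan C0 (frame s12)).
Local Notation cj := (co (val j)).
Local Notation ck := (co (val k)).
Let g1 := mut_good H Fdiv gs k.
Let g2 := mut_good H Fdiv gs j.
Let g12 := mut_good H Fdiv g1 j.

Lemma val_jk : (val j == val k) = false.
Proof. by apply/negbTE. Qed.

Lemma exch_commN u (n : nat) : cj u = 0 ->
  exists z : int, y ^+ n * M u = v ^ z * (M u * y ^+ n).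
Proof.
move=> u0; have e := exch_commX H Fdiv gs n u0.
exists (- (n%:Z * (form (mutqform j s) u (e_ (val j)) *+ 2))).
by rewrite e (vzK H) addNr expr0z mul1r.
Qed.

(** * Two directions with b_kj = 0 *)

Section Independent.
Hypothesis (B0 : B (val k) j = 0).

Lemma B0' : B (val j) k = 0.
Proof.
have := good_sym H Fdiv gs k j k; have := good_dpos H Fdiv gs k j.
by rewrite B0 mulr0 oppr0; nia.
Qed.

Lemma ck_exch_exp b : ck (exch_exp B j b) = 0.
Proof.
rewrite /exch_exp coD coN coe eq_sym val_jk co_pcol.
by case: b; rewrite ?coN co_bcol B0.
Qed.
Lemma cj_exch_exp b : cj (exch_exp B k b) = 0.
Proof.
rewrite /exch_exp coD coN coe val_jk co_pcol.
by case: b; rewrite ?coN co_bcol B0'.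
Qed.

(** The exponents of the two monomials of y differ by b_j, which pairs to zero with the exponents of
    x because these have coordinate 0 at j. *)
Lemma exch_comm_indep : exists z : int, y * x = v ^ z * (x * y).
Proof.
pose z := form (mutqform k s) (exch_exp B j true) (e_ (val k)) *+ 2; exists z.
have e b : M (exch_exp B j b) * x = v ^ z * (x * M (exch_exp B j b)).
  rewrite (exch_comm H Fdiv gs (ck_exch_exp b)); congr (v ^ _ * _).
  case: b; first by [].
  congr (_ *+ 2); rewrite (mutform_ek H Fdiv gs true (ck_exch_exp _)).
  rewrite (mutform_ek H Fdiv gs true (ck_exch_exp _)).
  apply/eqP; rewrite -subr_eq0 -formNl -formDl -opprB (exch_exp_sub H Fdiv gs j).
  rewrite formNl (good_compat gs) /exch_exp coD coN coe val_jk co_pcol co_bcol B0'.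
  by rewrite mulr0.
have yE : y = M (exch_exp B j true) + M (exch_exp B j false) by [].
by rewrite {1}yE mulrDl !e -!mulrDr.
Qed.

Local Notation lam := (form L (e_ (val j))).

(** The functional [lam] is the grading behind coprimality: x is homogeneous since b_k pairs to zero
    with e_j, while the two monomials of y differ in degree by d_j. *)
Lemma x_lam : T (gr lam (lam (exch_exp B k true))) x.
Proof.
apply: tspanD; apply: tspanM1 => //; first exact: eqxx.
rewrite /gr inE.
rewrite -subr_eq0 -formNr -formDr -opprB (exch_exp_sub H Fdiv gs k).
rewrite formNr (form_skew _ _ (good_skew gs)) (good_compat gs) coe (eq_sym (val k)) val_jk.
by rewrite mulr0 !oppr0.
Qed.

Definition left_mul w : Prop := exists2 q, T predT q & w = q * x.

Lemma left_mulD w1 w2 : left_mul w1 -> left_mul w2 -> left_mul (w1 + w2).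
Proof.
by move=> [q1 h1 ->] [q2 h2 ->]; exists (q1 + q2); rewrite ?mulrDl //; apply: tspanD.
Qed.
Lemma left_mulB w1 w2 : left_mul w1 -> left_mul w2 -> left_mul (w1 - w2).
Proof.
by move=> [q1 h1 ->] [q2 h2 ->]; exists (q1 - q2); rewrite ?mulrBl //; apply: tspanB.
Qed.
Lemma left_mul_sum (t : seq int) (w : int -> F) :
  (forall z, left_mul (w z)) -> left_mul (\sum_(z <- t) w z).
Proof.
move=> h; elim/big_ind: _ => //; last exact: left_mulD.
by exists 0; rewrite ?mul0r //; apply: tspan0.
Qed.
Lemma left_mul_proj w z : T predT w -> left_mul w ->
  left_mul (proj C0 M (gr lam z) w).
Proof.
move=> Tw [q Tq ->]; exists (proj C0 M (gr lam (z - lam (exch_exp B k true))) q).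
  exact: seed_projT.
apply: (seed_projM gs (degree_form _ _) _ Tq x_lam); by rewrite subrK.
Qed.
Lemma left_mul_mon u w : ck u = 0 -> left_mul (w * M u) -> left_mul w.
Proof.
move=> u0 [q Tq e].
have Nu0 : ck (- u) = 0 by rewrite coN u0.
have e2 := exch_comm H Fdiv gs Nu0; set z := form _ _ _ *+ 2 in e2.
exists (v ^ (- z) * (q * M (- u))).
  by apply: tspanC => //; apply: (seedMT gs) => //; apply: (seed_frT gs).
rewrite -mulrA -[in RHS]mulrA e2 (vzA H _ q) (vzK H) addNr expr0z mul1r mulrA -e.
by rewrite -mulrA (seed_mulN gs) mulr1.
Qed.
Lemma left_mul_mon2 u w : ck u = 0 -> left_mul w -> left_mul (w * M u).
Proof.
move=> u0 h; apply: (@left_mul_mon (- u)); first by rewrite coN u0.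
by rewrite -mulrA (seed_mulN gs) mulr1.
Qed.

(** As x is [lam]-homogeneous, divisibility by x can be tested on components. Since [lam C] exceeds
    [lam A] by d_j, a component of [w * y] involves one component of w times [M C] and another,
    higher by d_j, times [M A]. Descending induction from the top degree of w then applies. *)
Lemma coprime1 w : T predT w -> left_mul (w * y) -> left_mul w.
Proof.
move=> Tw hwy; set A := exch_exp B j true; set C := exch_exp B j false.
have lamC : lam C = lam A + (d j)%:Z.
  have : lam A - lam C = - (d j)%:Z; last by lia.
  rewrite -formNr -formDr (exch_exp_sub H Fdiv gs j).
  by rewrite (form_skew _ _ (good_skew gs)) (good_compat gs) coek mulr1.
have dp := good_dpos H Fdiv gs k j.
have Ty := exch_T H Fdiv gs j.
have Twy : T predT (w * y) by apply: (seedMT gs).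
pose p z := proj C0 M (gr lam z) w.
have step z : left_mul (p (z + (d j)%:Z)) -> left_mul (p z).
  move=> hz; apply: (@left_mul_mon C); first exact: ck_exch_exp.
  have e : proj C0 M (gr lam (z + lam C)) (w * y) = p (z + (d j)%:Z) * M A + p z * M C.
    rewrite [y]/exch mulrDr projD; last first.
    - by apply: (seedMT gs) => //; apply: (seed_frT gs).
    - by apply: (seedMT gs) => //; apply: (seed_frT gs).
    - exact: good_free gs.
    - by [].
    congr (_ + _).
      apply: (seed_projM gs (degree_form _ _) (a := z + (d j)%:Z) (b := lam A)) => //.
        by rewrite lamC; ring.
      by apply: tspanM1 => //; rewrite /gr /= eqxx.
    apply: (seed_projM gs (degree_form _ _) (a := z) (b := lam C)) => //.
    by apply: tspanM1 => //; rewrite /gr /= eqxx.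
  have -> : p z * M C = proj C0 M (gr lam (z + lam C)) (w * y) - p (z + (d j)%:Z) * M A.
    by rewrite e addrC addKr.
  apply: left_mulB; first exact: left_mul_proj.
  by apply: left_mul_mon2 => //; apply: ck_exch_exp.
have [m hm] := seed_max gs (degree_form L (e_ (val j))) Tw.
have all_p : forall n z, m - n%:Z < z -> left_mul (p z).
  elim=> [|n IH] z hz.
    rewrite /p hm; last by lia.
    by exists 0; rewrite ?mul0r //; apply: tspan0.
  by apply: step; apply: IH; lia.
have [t ->] := seed_decomp gs (degree_form L (e_ (val j))) Tw.
by apply: left_mul_sum => z; apply: (all_p (absz (m - z)).+1); lia.
Qed.

Lemma coprimeX1 n w : T predT w -> left_mul (w * y ^+ n) -> left_mul w.
Proof.
elim: n w => [|n IH] w Tw; first by rewrite expr0 mulr1.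
rewrite exprSr mulrA => h; apply: IH => //; apply: coprime1 => //.
by apply: (seedMT gs) => //; apply: (seedXT gs); apply: (exch_T H Fdiv gs j).
Qed.

Lemma coprimeX n m w p : T predT w -> T predT p -> w * y ^+ n = p * x ^+ m ->
  exists2 q, T predT q & w = q * x ^+ m.
Proof.
elim: m w p => [|m IH] w p Tw Tp e; first by exists w; rewrite // expr0 mulr1.
have [q Tq wE] : left_mul w.
  apply: (@coprimeX1 n) => //; exists (p * x ^+ m); last by rewrite e exprSr mulrA.
  by apply: (seedMT gs) => //; apply: (seedXT gs); apply: (exch_T H Fdiv gs k).
have [z0 cz0] := exch_comm_indep.
have cz1 : x * y = v ^ (- z0) * (y * x) by rewrite cz0 (vzK H) addNr expr0z mul1r.
have cX r : exists z : int, x * y ^+ r = v ^ z * (y ^+ r * x).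
  elim: r => [|r [z cz]]; first by exists 0; rewrite expr0 expr0z mul1r mulr1 mul1r.
  exists (z - z0); rewrite exprSr mulrA cz -!mulrA cz1.
  by rewrite (vzA H _ (y ^+ r)) (vzK H).
have [z cz] := cX n.
have e2 : q * y ^+ n = v ^ (- z) * p * x ^+ m.
  apply: (mulIr (exchU H Fdiv gs k)); rewrite -!mulrA -exprSr -e wE -!mulrA cz.
  by rewrite (vzA H _ q) (vzK H) addNr expr0z mul1r.
have Tvp : T predT (v ^ (- z) * p) by apply: tspanC.
have [q' Tq' qE] := IH q _ Tq Tvp e2.
by exists q' => //; rewrite wE qE exprSr mulrA.
Qed.

(** As b_jk = 0, x has e_j-degree 0; the e_j-grading is therefore common to both tori. *)
Lemma mut_frame_gr f : 0 <= ck f -> T (gr cj (cj f)) (frame s1 f).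
Proof.
move=> f0; rewrite [frame s1 f]/(mutframe v k s f) /mutframe; apply: tspanC => //.
have -> : ck f = (absz (ck f))%:Z by lia.
rewrite -exprnP.
have h0 : T (gr cj (cj f)) (M (rem k f)).
  by apply: (seed_gr gs); rewrite co_rem_ne // val_jk.
have hx : T (gr cj 0) x.
  by apply: tspanD; apply: (seed_gr gs); apply: cj_exch_exp.
have h1 := seedXgr gs (absz (ck f)) (degree_co (val j)) hx.
by apply: seedMgr (degree_co (val j)) _ h0 h1 => //; rewrite mulr0 addr0.
Qed.

Lemma mut_poly_gr w z : T1 [pred f | 0 <= ck f] w ->
  proj C0 M (gr cj z) w = proj C0 (frame s1) (gr cj z) w.
Proof.
have f1 := good_free g1; have f0 := good_free gs.
suff: T1 [pred f | 0 <= ck f] w -> [/\ T1 predT w, T predT w &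
    proj C0 M (gr cj z) w = proj C0 (frame s1) (gr cj z) w].
  by move=> h /h[].
elim/tspan_ind: w / => [|w1 w2 [T1a Ta e1] [T1b Tb e2]|c f hc hf].
- by rewrite !proj0 //; split=> //; exact: tspan0.
- by rewrite !projD // e1 e2; split=> //; exact: tspanD.
have hy : T (gr cj (cj f)) (c * frame s1 f).
  by apply: tspanC => //; apply: mut_frame_gr.
split; [exact: tspan_gen|exact: tspanT hy|].
rewrite [RHS]proj_gen // {2}/gr inE; case: eqP => [<-|ne]; first by rewrite proj_id.
apply: proj_eq0 hy _ => // h /eqP hh.
by apply/negP => /eqP h2; apply: ne; rewrite -hh -h2.
Qed.

Lemma proj_mut_gr w z : T predT w -> T1 predT w ->
  proj C0 M (gr cj z) w = proj C0 (frame s1) (gr cj z) w.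
Proof.
move=> Tw T1w; have [n hn] := mut_clear gs T1w.
have := mut_poly_gr z (hn n (leqnn n)).
have hx : T (gr cj 0) (x ^+ n).
  rewrite -(mut_frame_k gs); have <- : cj (n%:Z *: e_ (val k)) = 0.
    by rewrite coZ coe val_jk mulr0.
  by apply: mut_frame_gr; rewrite coZ coek; lia.
rewrite (seed_projM gs (a := z) (b := 0)) ?addr0 //.
rewrite (seed_projM g1 (a := z) (b := 0)) ?addr0 //.
  by move/(mulIr (exchXU gs k n)).
rewrite -(mut_frame_k gs); apply: (seed_gr g1).
by rewrite coZ coe val_jk mulr0.
Qed.

Lemma exch_mut_indep : exch s1 j = y.
Proof.
have e : bcol (exmat s1) j = bcol B j.
  by rewrite (bcol_mut_ne H Fdiv gs jk) tropmap0 // co_bcol.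
have ee b : exch_exp (exmat s1) j b = exch_exp B j b by rewrite /exch_exp e.
by rewrite /exch !ee !(mut_frame0 gs (ck_exch_exp _)).
Qed.

(** A negative e_j-component of w is dl times a power of y, and y is also the exchange element of
    the mutated seed. Only [T1 predT dl] is missing: the e_k-components of the product are divisible
    by powers of x, and coprimality passes this on to dl. *)
Lemma rank2_indep w : T predT w -> T1 predT w -> T2 predT w -> T12 predT w.
Proof.
move=> Tw T1w T2w; apply: (in_mutT g1) => // n.
have [dl hdl e] := proj_mut_exch gs n.+1 Tw T2w.
rewrite -(proj_mut_gr (- n.+1%:Z) Tw T1w) e exch_mut_indep; exists dl; last by [].
have Tdl := tspanT hdl.
have Ta : T predT (dl * y ^+ n.+1) by rewrite -e; apply: seed_projT.
have T1a : T1 predT (dl * y ^+ n.+1).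
  by rewrite -e (proj_mut_gr _ Tw T1w); apply: (seed_projT g1).
have T1dl : T1 predT dl.
  apply: (in_mutT gs) => // m.
  have [p hp ep] := proj_mut_exch gs m.+1 Ta T1a.
  move: ep; rewrite (seed_projM gs (a := - m.+1%:Z) (b := 0)) ?addr0 //; last first.
    have hy : T (gr ck 0) y.
      by apply: tspanD; apply: (seed_gr gs); apply: ck_exch_exp.
    by have := seedXgr gs n.+1 (degree_co (val k)) hy; rewrite mulr0.
  move=> ep; have Tp := tspanT hp.
  have Tpr : T predT (proj C0 M (gr ck (- m.+1%:Z)) dl) by apply: seed_projT.
  have [q Tq qE] := coprimeX Tpr Tp ep.
  exists (proj C0 M (gr ck 0) q); first exact: seed_projgr.
  rewrite -(seed_projM gs (c := - m.+1%:Z) _ _ Tq (exchX_gr gs k m.+1)) ?add0r //.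
  rewrite -qE [RHS](proj_id C0s (good_free gs)) //; exact: seed_projgr.
rewrite -(proj_id C0s (good_free gs) hdl) (proj_mut_gr _ Tdl T1dl).
exact: seed_projgr.
Qed.
End Independent.
End RankTwo.
End Adjacent.

(** * Laurent phenomenon *)

Section Laurent.
#[local] Set Default Proof Using "All".
Variables (K : fieldType) (F : unitAlgType K) (v : F) (C0 : set F) (N : nat).
Variables (ex : {set 'I_N}) (d : dir ex -> nat).
Hypothesis (H : coef_base v C0).
Local Notation vC := (cb_central H).
Local Notation vU := (cb_unit H).
Local Notation C0s := (cb_subalg H).
Local Notation C0c := (cb_comm H).
Local Notation C0v := (cb_pow H).
#[local] Hint Extern 0 (is_subalg C0) => exact: C0s : core.
#[local] Hint Extern 0 (C0 (v ^ _)) => exact: C0v : core.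
#[local] Hint Extern 0 (is_true (v \is a GRing.unit)) => exact: vU : core.
#[local] Hint Extern 0 (_ * _ = _ * _) => (apply: C0c; assumption) : core.
Hypothesis (Fdiv : forall x : F, x != 0 -> x \is a GRing.unit).
Implicit Types (s : seed F ex) (j : dir ex).
Implicit Types (f g h : 'cV[int]_N) (P Q R : pred 'cV[int]_N).
#[local] Hint Extern 0 (is_degree (co _)) => exact: degree_co : core.
Local Notation seedM := (seedM H Fdiv).
Local Notation seedMT := (seedMT H Fdiv).
Local Notation seedX := (seedX H Fdiv).
Local Notation seedXT := (seedXT H Fdiv).
Local Notation seed_gr := (seed_gr H Fdiv).
Local Notation seed_frT := (seed_frT H Fdiv).
Local Notation seedMgr := (seedMgr H Fdiv).
Local Notation seed_projM := (seed_projM H Fdiv).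
Local Notation seed_decomp := (seed_decomp H Fdiv).
Local Notation seed_min := (seed_min H Fdiv).
Local Notation seed_ge := (seed_ge H Fdiv).
Local Notation seed_proj := (seed_proj H Fdiv).
Local Notation seed_projgr := (seed_projgr H Fdiv).
Local Notation seed_projT := (seed_projT H Fdiv).
Local Notation seedU := (seedU H Fdiv).
Local Notation seed_mulN := (seed_mulN H Fdiv).
Local Notation seed_Nmul := (seed_Nmul H Fdiv).
Local Notation seedC := (seedC H Fdiv).
Local Notation seed_pow := (seed_pow H Fdiv).
Local Notation mut_good := (mut_good H Fdiv).
Local Notation mut_frame_k := (mut_frame_k H Fdiv).
Local Notation mut_frame0 := (mut_frame0 H Fdiv).
Local Notation mut_frame_Nk := (mut_frame_Nk H Fdiv).
Local Notation tspan_mut0 := (tspan_mut0 H Fdiv).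
Local Notation mut_clear := (mut_clear H Fdiv).
Local Notation mut_polyT := (mut_polyT H Fdiv).
Local Notation exchXU := (exchXU H Fdiv).
Local Notation exchX_gr := (exchX_gr H Fdiv).
Local Notation proj_mut := (proj_mut H Fdiv).
Local Notation proj_mut_hom := (proj_mut_hom H Fdiv).
Local Notation proj_mut_exch := (proj_mut_exch H Fdiv).
Local Notation gr0_s1 := (gr0_s1 H Fdiv).
Local Notation exch_T1 := (exch_T1 H Fdiv).
Local Notation nonneg_mutT := (nonneg_mutT H Fdiv).
Local Notation frame_mutT := (frame_mutT H Fdiv).

(** * Two directions with b_kj nonzero *)

Section Dependent.
Variables (s : seed F ex) (gs : good v C0 d s) (k j : dir ex) (jk : j != k).
Local Notation M := (frame s).
Local Notation B := (exmat s).
Local Notation L := (qform s).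
Local Notation s1 := (mut v k s).
Local Notation s2 := (mut v j s).
Local Notation s12 := (mut v j s1).
Local Notation M1 := (frame s1).
Local Notation x := (exch s k).
Local Notation y := (exch s j).
Local Notation y1 := (exch s1 j).
Local Notation T := (tspan C0 M).
Local Notation T1 := (tspan C0 M1).
Local Notation T2 := (tspan C0 (frame s2)).
Local Notation T12 := (tspan C0 (frame s12)).
Local Notation cj := (co (val j)).
Local Notation ck := (co (val k)).
Let g1 := mut_good gs k.
Let g2 := mut_good gs j.
Let g12 := mut_good g1 j.
Hypothesis (B1 : B (val k) j != 0).
Local Notation phi := (tropmap (val k) (tropg s k j)).
Local Notation f0 := (good_free gs).
Local Notation f1 := (good_free g1).
#[local] Hint Extern 0 (tfree C0 M) => exact: f0 : core.
#[local] Hint Extern 0 (tfree C0 M1) => exact: f1 : core.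
Let vjk := val_jk H Fdiv gs jk.

Lemma phiK f : phi (phi f) = f.
Proof. by rewrite tropmapK // (co_tropg_k H Fdiv gs). Qed.
Lemma cj_phi f : cj (phi f) = cj f.
Proof. by rewrite co_tropmap (co_tropg_j H Fdiv gs k j) vjk !mulr0n subrr mulr0 addr0. Qed.
Lemma phi_rem f : phi f = rem k f + ck f *: phi (e_ (val k)).
Proof. by rewrite {1}(rem_split k f) tropmapD tropmapZ tropmap0 // co_rem. Qed.

(** Since b_jk is nonzero, exactly one monomial of x involves the variable j; the sign in [tropg]
    makes the other one the image of e_k under [phi]. *)
Lemma exch_lead : exists u, x = M (phi (e_ (val k))) + M u /\ 0 < cj u.
Proof.
rewrite tropmap_ek /tropg /exch /exch_exp.
have := good_sym H Fdiv gs k j k; have := good_dpos H Fdiv gs k j.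
have := good_dpos H Fdiv gs k k; case: ifP => kj dk dj e.
  exists (- e_ (val k) + pcol (- bcol B k)); split; first by [].
  by rewrite coD coN coe vjk co_pcol coN co_bcol; nia.
exists (- e_ (val k) + pcol (bcol B k)); split; first by rewrite addrC.
by rewrite coD coN coe vjk co_pcol co_bcol; nia.
Qed.

Lemma exchX_lead (n : nat) :
  T [pred f | 0 < cj f] (x ^+ n - M (n%:Z *: phi (e_ (val k)))).
Proof.
have [u [xE u0]] := exch_lead; set a := phi _ in xE *.
have a0 : cj a = 0 by rewrite /a cj_phi coe vjk.
have aX r : M (r%:Z *: a) = M a ^+ r by rewrite (seed_pow gs) -scaler_nat natz.
elim: n => [|n IH].
  by rewrite aX !expr0 subrr; apply: tspan0.
have -> : x ^+ n.+1 - M (n.+1%:Z *: a) =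
    x * (x ^+ n - M (n%:Z *: a)) + M u * M (n%:Z *: a).
  have xa : x * M a ^+ n = M a * M a ^+ n + M u * M a ^+ n by rewrite {1}xE mulrDl.
  by rewrite !aX !exprS mulrBr xa opprD addrA addrNK.
have hx : T [pred f | 0 <= cj f] x.
  by rewrite xE; apply: tspanD; apply: tspanM1 => //=; rewrite ?a0 // ltW.
apply: tspanD.
  by apply: (seedM gs _ hx IH) => f g /= hf hg; rewrite coD; apply: ltr_wpDl.
have hu : T [pred f | 0 < cj f] (M u) by apply: tspanM1.
apply: (seedM gs _ hu (seed_gr gs (i := val j) (erefl _))) => f g /= hf /eqP hg.
by rewrite coD hg coZ a0 mulr0 addr0.
Qed.

Lemma mut_frame_lead f : 0 <= ck f ->
  T [pred h | cj f < cj h] (M1 f - M (phi f)).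
Proof.
move=> fk; rewrite [M1 f]/(mutframe v k s f) /mutframe.
have [n nE] : exists n : nat, ck f = n%:Z by exists (absz (ck f)); lia.
have -> : M (phi f) = v ^ (- (ck f * form (mutqform k s) (rem k f) (e_ (val k)))) *
    (M (rem k f) * M (n%:Z *: phi (e_ (val k)))).
  rewrite (qframeM (good_frame gs)) (vzK H) -nE -phi_rem formZr.
  rewrite (mutformgE H Fdiv gs k j) (tropmap0 _ (co_rem k f)).
  by rewrite addNr expr0z mul1r.
rewrite nE -exprnP -mulrBr -mulrBr; apply: tspanC => //.
have hr : T (gr cj (cj f)) (M (rem k f)).
  by apply: (seed_gr gs); rewrite co_rem_ne // vjk.
apply: (seedM gs _ hr (exchX_lead n)) => g h /eqP hg /= hh.
by rewrite coD hg ltrDl.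
Qed.

(* Lowest e_j-degree part in the torus of [s] of an element of the torus of
   [mut v k s]. *)
Definition bar : F -> F := text C0 M1 (fun f => M (phi f)).

Lemma barD a b : T1 predT a -> T1 predT b -> bar (a + b) = bar a + bar b.
Proof. exact: textD. Qed.
Lemma bar_gen c f : C0 c -> bar (c * M1 f) = c * M (phi f).
Proof. by move=> hc; rewrite /bar textC. Qed.
Lemma barM1 f : bar (M1 f) = M (phi f).
Proof. by rewrite /bar textM1. Qed.
Lemma bar0 : bar 0 = 0. Proof. exact: text0. Qed.
Lemma bar_T a : T1 predT a -> T predT (bar a).
Proof. by apply: text_span => // f _; apply: tspanM1. Qed.

Lemma barM a b : T1 predT a -> T1 predT b -> bar (a * b) = bar a * bar b.
Proof.
move=> + T1b; suff: T1 predT a -> T1 predT a /\ bar (a * b) = bar a * bar b.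
  by move=> h /h[].
elim/tspan_ind: a / => [|a1 a2 [Ta1 e1] [Ta2 e2]|c f hc _].
- by rewrite !(mul0r, bar0); split => //; apply: tspan0.
- split; first exact: tspanD.
  by rewrite mulrDl !barD ?e1 ?e2 ?mulrDl //; apply: (seedMT g1).
split; first exact: tspan_gen.
rewrite bar_gen //; suff: T1 predT b /\ bar (c * M1 f * b) = c * M (phi f) * bar b.
  by case.
elim/tspan_ind: b / T1b => [|b1 b2 [Tb1 e1] [Tb2 e2]|e g he _].
- by rewrite !(mulr0, bar0); split => //; apply: tspan0.
- split; first exact: tspanD.
  rewrite mulrDr !barD ?e1 ?e2 ?mulrDr //; apply: (seedMT g1) => //; exact: tspan_gen.
split; first exact: tspan_gen.
have cA (h : 'cV[int]_N) (M' : 'cV[int]_N -> F) : c * M' f * (e * M' h) = c * (e * (M' f * M' h)).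
  by rewrite -!mulrA; congr (c * _); rewrite !mulrA (C0c _ he).
rewrite bar_gen // cA (qframeM (good_frame g1)).
have -> : c * M (phi f) * (e * M (phi g)) = c * (e * (M (phi f) * M (phi g))).
  by rewrite -!mulrA; congr (c * _); rewrite !mulrA (C0c _ he).
rewrite (qframeM (good_frame gs)) -tropmapD.
have a4 (p q r w : F) : p * (q * (r * w)) = p * q * r * w by rewrite !mulrA.
rewrite [X in bar X](a4 c e) bar_gen; last by do !apply: subalgM => //.
rewrite [RHS](a4 c e).
by rewrite [qform _]/(mutqform k s) (mutformgE H Fdiv gs k j).
Qed.

Lemma barX a n : T1 predT a -> bar (a ^+ n) = bar a ^+ n.
Proof.
move=> T1a; elim: n => [|n IH].
  rewrite !expr0 -{1}(qframe1 (good_frame g1)) barM1 tropmap0 ?co0 //.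
  exact: (qframe1 (good_frame gs)).
by rewrite !exprS barM ?IH //; apply: (seedXT g1).
Qed.

Lemma bar_surj P a : T P a ->
  exists2 b, T1 [pred f | P (phi f)] b & bar b = a.
Proof.
suff: T P a -> exists2 b, T1 [pred f | P (phi f)] b & bar b = a by [].
elim/tspan_ind: a / => [|a1 a2 [b1 h1 e1] [b2 h2 e2]|c f hc hf].
- by exists 0; rewrite ?bar0 //; apply: tspan0.
- exists (b1 + b2); first exact: tspanD.
  by rewrite barD ?e1 ?e2 //; [exact: tspanT h1|exact: tspanT h2].
exists (c * M1 (phi f)); last by rewrite bar_gen // phiK.
by apply: tspan_gen => //=; rewrite phiK.
Qed.

Lemma bar_inj a b : T1 predT a -> T1 predT b -> bar a = bar b -> a = b.
Proof.
pose rab := text C0 M (fun f => M1 (phi f)).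
have rabK c : T1 predT c -> rab (bar c) = c.
  suff: T1 predT c -> T1 predT c /\ rab (bar c) = c by move=> h /h[].
  elim/tspan_ind: c / => [|a1 a2 [T1a e1] [T1b e2]|c f hc _].
  - by rewrite bar0 /rab text0 //; split => //; apply: tspan0.
  - split; first exact: tspanD.
    by rewrite barD // /rab textD ?[text _ _ _ _]e1 ?[text _ _ _ _]e2 //; apply: bar_T.
  split; first exact: tspan_gen.
  by rewrite bar_gen // /rab textC // phiK.
by move=> T1a T1b e; rewrite -(rabK a) // e rabK.
Qed.

(** For a nonnegative exponent at k, [M1 f] equals [M (phi f)] up to terms of larger e_j-degree, and
    [phi] preserves that degree; hence no cancellation occurs in lowest degree. *)
Lemma bar_lead z w : T1 [pred f | 0 <= ck f] w -> T1 [pred f | z <= cj f] w ->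
  T [pred f | z <= cj f] w /\ proj C0 M (gr cj z) w = bar (proj C0 M1 (gr cj z) w).
Proof.
move=> hk hj; have := tspan_inI C0s f1 hk hj; clear hk hj.
suff: T1 (predI [pred f | 0 <= ck f] [pred f | z <= cj f]) w ->
  T1 predT w /\ (T [pred f | z <= cj f] w /\
    proj C0 M (gr cj z) w = bar (proj C0 M1 (gr cj z) w)) by move=> h /h[].
elim/tspan_ind: w / => [|a1 a2 [T1a [Ta e1]] [T1b [Tb e2]]|c f hc hf].
- by rewrite !proj0 // bar0; split; [|split=> //]; apply: tspan0.
- split; first exact: tspanD.
  split; first exact: tspanD.
  rewrite projD ?e1 ?e2 // ?projD // ?barD //.
  + exact: (seed_projT g1).
  + exact: (seed_projT g1).
  + exact: (tspanT Ta).
  + exact: tspanT Tb.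
have /andP[fk fj] := hf.
have {}fk : 0 <= ck f := fk.
have {}fj : z <= cj f := fj.
have hl := mut_frame_lead fk.
have hM : T (gr cj (cj f)) (M (phi f)) by apply: (seed_gr gs); rewrite cj_phi.
have fE : M1 f = M (phi f) + (M1 f - M (phi f)) by rewrite addrC subrK.
split; first exact: tspan_gen.
split.
  apply: tspanC => //; rewrite fE; apply: tspanD.
    by apply: tspanS hM => h /eqP hE; rewrite inE hE.
  by apply: tspanS hl => h hh; rewrite inE; apply: le_trans fj (ltW hh).
rewrite projCl //; last first.
  by apply: (mut_polyT gs (k := k)); apply: tspanM1.
rewrite proj_gen // {1}fE projD //; [|exact: tspanT hM|exact: tspanT hl].
rewrite [X in _ + X](proj_eq0 _ _ hl) //; last first.
  move=> h hh; apply/negP => /eqP hz; have : cj f < cj h := hh.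
  by rewrite hz; lia.
rewrite addr0; case: ifP => [/eqP fz|fz].
  by rewrite bar_gen // proj_id // -fz.
rewrite bar0 (proj_eq0 _ _ hM) ?mulr0 // => h /eqP hh.
by apply/negP => /eqP hz; move/eqP: fz; apply; rewrite -hh.
Qed.

Lemma y1_span : T1 [pred f | 0 <= ck f] y1 /\ T1 (gr cj (-1)) y1.
Proof.
split; last exact: (exch_gr H Fdiv g1 j).
apply: tspanD; apply: tspanM1 => //; rewrite inE /exch_exp coD coN coe eq_sym vjk.
  by rewrite co_pcol mulr0n oppr0 add0r le_max lexx.
by rewrite co_pcol mulr0n oppr0 add0r le_max lexx.
Qed.

(** The image under [phi] of the new column j is the old one, so both exponents of y1 are sent to
    those of y shifted by a common w. Compatibility makes the two powers of v equal. *)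
Lemma bar_y1 : exists (a : int) w, cj w = 0 /\ bar y1 = v ^ a * (M w * y).
Proof.
pose E1 := exch_exp (exmat s1) j; pose E := exch_exp B j.
pose w := phi (E1 true) - E true.
have wE : phi (E1 false) = E false + w.
  have : phi (E1 true) - phi (E1 false) = E true - E false.
    rewrite -tropmapN -tropmapD (exch_exp_sub H Fdiv g1 j) (exch_exp_sub H Fdiv gs j).
    exact: (trop_bcol H Fdiv gs).
  by move=> e; rewrite -(subKr (phi (E1 true)) (phi (E1 false))) e /w opprB addrCA.
have w0 : cj w = 0.
  by rewrite /w coD coN cj_phi (co_exch_exp H Fdiv g1) (co_exch_exp H Fdiv gs) subrr.
have fw : form L w (E true) = form L w (E false).
  apply/eqP; rewrite -subr_eq0 -formNr -formDr (exch_exp_sub H Fdiv gs j).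
  by rewrite (form_skew _ _ (good_skew gs)) (good_compat gs) w0 mulr0 oppr0.
exists (- form L w (E true)), w; split=> //.
rewrite [y1]/exch [y]/exch mulrDr barD; [|exact: (seed_frT g1)|exact: (seed_frT g1)].
rewrite !barM1 !(qframeM (good_frame gs)) -/E -/E1 -fw -mulrDr (vzK H) addNr expr0z mul1r.
congr (M _ + M _); first by rewrite /w subrK.
by rewrite wE addrC.
Qed.

(** The factor [v ^ a * M w] commutes with y up to powers of v, so it can be collected into the left
    coefficient. *)
Lemma twist_pow (a : int) w n dl : cj w = 0 -> T (gr cj 0) dl ->
  exists2 dl2, T (gr cj 0) dl2 & dl * y ^+ n = dl2 * (v ^ a * (M w * y)) ^+ n.
Proof.
move=> w0; elim: n dl => [|n IH] dl hdl; first by exists dl; rewrite ?expr0.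
have [dl2 h2 e] := IH _ hdl; set X := v ^ a * (M w * y) in e *.
have Nw0 : cj (- w) = 0 by rewrite coN w0.
have yE : y = v ^ (- a) * (M (- w) * X).
  rewrite /X (vzA H _ (M (- w))) (vzK H) addNr expr0z mul1r mulrA (seed_Nmul gs).
  by rewrite mul1r.
have [z cz] : exists z : int, X * M (- w) = v ^ z * (M (- w) * X).
  have [z0 cz0] := exch_commN H Fdiv gs jk 1 Nw0.
  rewrite !expr1 in cz0.
  exists (form L w (- w) *+ 2 + z0); rewrite /X -!mulrA cz0 (vzA H _ (M w)).
  rewrite (vzA H _ (M (- w))) !(vzK H) (mulrA (M w)) (seedC gs w).
  by rewrite -!mulrA (vzK H); congr (v ^ _ * _); ring.
clearbody X.
have [z' cz'] : exists z : int, X ^+ n * M (- w) = v ^ z * (M (- w) * X ^+ n).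
  elim: n {IH e} => [|n [z' cz']]; first by exists 0; rewrite expr0 expr0z mul1r mulr1 mul1r.
  exists (z + z'); rewrite [X ^+ n.+1]exprSr -!mulrA cz (vzA H _ (X ^+ n)) (mulrA (X ^+ n)) cz'.
  by rewrite -!mulrA (vzK H).
exists (v ^ (- a + z') * (dl2 * M (- w))).
  have h0 := seed_gr gs Nw0.
  have h3 := seedMgr gs (degree_co (val j)) (esym (addr0 0)) h2 h0.
  by apply: tspanC.
rewrite exprSr mulrA e yE -!mulrA (vzA H _ (X ^+ n)) (vzA H _ dl2) (mulrA (X ^+ n)) cz'.
by rewrite -!mulrA (vzA H _ dl2) (vzK H) -exprSr.
Qed.

Local Notation D w := (T predT w /\ T2 predT w).

(** The only negative e_j-component of y1 is its lowest one, of degree -1, and this is a monomial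
    times y by [bar_y1]. *)
Lemma y1_D : D y1.
Proof.
have [y1k y1j] := y1_span.
have y1j' : T1 [pred f | -1 <= cj f] y1.
  by apply: tspanS y1j => f /eqP fj; rewrite inE fj.
have [Ty e] := bar_lead y1k y1j'; split; first exact: tspanT Ty.
have [a [w [w0 ey]]] := bar_y1.
have hproj : proj C0 M (gr cj (-1)) y1 = v ^ a * (M w * y).
  by rewrite e (proj_id C0s f1 y1j) ey.
have -> : y1 = (y1 - proj C0 M (gr cj (-1)) y1) + proj C0 M (gr cj (-1)) y1.
  by rewrite subrK.
have TTy := tspanT Ty.
apply: tspanD; last first.
  rewrite hproj; apply: tspanC; [exact: C0s|exact: C0v|apply: (seedMT g2)].
    by apply: (frame_mutT gs); rewrite w0.
  by have := exch_T1 gs j 1; rewrite expr1.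
apply: (nonneg_mutT gs); apply: (seed_ge gs (degree_co (val j))).
  by apply: tspanB => //; apply: (seed_projT gs).
move=> z z0; rewrite projB //; last exact: (seed_projT gs).
rewrite proj_proj //; case: (ltP z (-1)) => z1.
  rewrite (proj_eq0 _ _ Ty) ?(proj_eq0 _ _ Ty) ?subrr // => f fj.
    by apply/negP => /andP[/eqP /= fz _]; have : -1 <= cj f := fj; rewrite fz; lia.
  by apply/negP => /eqP /= fz; have : -1 <= cj f := fj; rewrite fz; lia.
have -> : z = -1 by lia.
rewrite (@proj_ext _ _ _ C0s _ _ f0 (predI (gr cj (-1)) (gr cj (-1))) (gr cj (-1)) predT) ?subrr //.
by move=> f _ /=; rewrite andbb.
Qed.

Lemma D_mul a b : D a -> D b -> D (a * b).
Proof. by move=> [? ?] [? ?]; split; [apply: (seedMT gs)|apply: (seedMT g2)]. Qed.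
Lemma D_exp a n : D a -> D (a ^+ n).
Proof. by move=> [? ?]; split; [apply: (seedXT gs)|apply: (seedXT g2)]. Qed.
Lemma D_nonneg a : T [pred f | 0 <= cj f] a -> D a.
Proof. by move=> h; split; [exact: tspanT h|exact: (nonneg_mutT gs)]. Qed.
Lemma x_D : D x.
Proof.
apply: D_nonneg; apply: tspanD; apply: tspanM1 => //; rewrite inE /exch_exp coD coN coe vjk.
  by rewrite co_pcol mulr0n oppr0 add0r le_max lexx.
by rewrite co_pcol mulr0n oppr0 add0r le_max lexx.
Qed.

Lemma x_s1 n : T1 (gr cj 0) (x ^+ n).
Proof.
by rewrite -(mut_frame_k gs); apply: (seed_gr g1); rewrite coZ coe vjk mulr0.
Qed.

(** Multiplied by a power of x, the lowest part of w is seen in the torus of [s] through [bar],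
    where membership in the torus of [s2] makes it divisible by the m-th power of y. Up to a
    monomial y is [bar y1]; injectivity and surjectivity of [bar] pull the divisibility back. *)
Lemma rank2_lead (m : nat) w n : T1 [pred f | - m%:Z <= cj f] w ->
  D (w * x ^+ n) ->
  exists2 g, T1 (gr cj 0) g & proj C0 M1 (gr cj (- m%:Z)) w = g * y1 ^+ m.
Proof.
move=> hw hD; have T1w := tspanT hw.
have [n1 hn1] := mut_clear gs T1w.
(* Large enough both to clear the denominators of w in direction k and to keep the hypothesis on
   D. *)
pose r := (n1 + n)%N.
have hk : T1 [pred f | 0 <= ck f] (w * x ^+ r) by apply: hn1; apply: leq_addr.
have hj : T1 [pred f | - m%:Z <= cj f] (w * x ^+ r).
  apply: (seedM g1 _ hw (x_s1 r)) => f g /= hf /eqP hg.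
  by rewrite coD hg addr0.
have [Dw1 Dw2] : D (w * x ^+ r).
  by rewrite /r addnC exprD mulrA; apply: (D_mul hD); apply: D_exp; apply: x_D.
have [_ e] := bar_lead hk hj.
set a := proj C0 M1 (gr cj (- m%:Z)) w.
have T1a : T1 predT a by apply: (seed_projT g1).
have T1x : T1 predT (x ^+ r) := tspanT (x_s1 r).
have e1 : bar (a * x ^+ r) = proj C0 M (gr cj (- m%:Z)) (w * x ^+ r).
  by rewrite e (seed_projM g1 (degree_co (val j)) (esym (addr0 (- m%:Z))) T1w (x_s1 r)).
have [dl hdl e2] := proj_mut_exch gs m Dw1 Dw2.
(* [M u] inverts [bar (x ^+ r)], which is a single monomial. *)
pose u := - (r%:Z *: phi (e_ (val k))).
have u0 : cj u = 0 by rewrite coN coZ cj_phi coe vjk mulr0 oppr0.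
have [z ez] := exch_commN H Fdiv gs jk m u0.
have barx : bar (x ^+ r) * M u = 1.
  by rewrite -(mut_frame_k gs) barM1 tropmapZ /u (seed_mulN gs).
have e3 : bar a = (v ^ z * (dl * M u)) * y ^+ m.
  rewrite -[LHS]mulr1 -barx mulrA -(barM T1a T1x) e1 e2 -[LHS]mulrA ez.
  by rewrite (vzA H _ dl) -!mulrA.
have hdl2 : T (gr cj 0) (v ^ z * (dl * M u)).
  apply: tspanC => //.
  by apply: (seedMgr gs (degree_co (val j)) (esym (addr0 0)) hdl (seed_gr gs u0)).
have [b [w' [w'0 ey1]]] := bar_y1.
have [dl3 hdl3 e4] := twist_pow b m w'0 hdl2.
have [g hg eg] := bar_surj hdl3.
have hg' : T1 (gr cj 0) g.
  by apply: tspanS hg => f /eqP hf; apply/eqP; rewrite -hf cj_phi.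
exists g => //.
have Ty1 : T1 predT y1 := tspanT y1_span.2.
have T1y : T1 predT (y1 ^+ m) by apply: (seedXT g1).
have T1g := tspanT hg'.
apply: (bar_inj T1a (seedMT g1 T1g T1y)); rewrite (barM T1g T1y) (barX m Ty1).
by rewrite eg ey1 e3 e4.
Qed.

(** Subtracting the lowest component lowers m. That component need not lie in the torus of [s], but
    does so after multiplication by a power of x; this is why the induction hypothesis allows such a
    power. *)
Lemma rank2_dep_ind (m : nat) w : T1 [pred f | - m%:Z <= cj f] w ->
  (exists n, D (w * x ^+ n)) -> T12 predT w.
Proof.
elim: m w => [|m IH] w hw [n hD]; first by apply: (nonneg_mutT g1); rewrite -oppr0.
have T1w := tspanT hw.
have [g hg eg] := rank2_lead hw hD.
set a := proj _ _ _ _ in eg.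
have T1a : T1 predT a by apply: (seed_projT g1).
have T12a : T12 predT a.
  rewrite eg; apply: (seedMT g12); last exact: (exch_T1 g1).
  exact: (gr0_s1 g1).
rewrite -(subrK a w); apply: tspanD => //; apply: IH.
  apply: (seed_ge g1 (degree_co (val j))); first exact: tspanB.
  move=> z zm; rewrite projB // /a proj_proj //.
  case: (ltP z (- m.+1%:Z)) => z1.
    rewrite (proj_eq0 _ _ hw) ?(proj_eq0 _ _ hw) ?subrr // => f fj.
      by apply/negP => /andP[/eqP /= fz _]; have : - m.+1%:Z <= cj f := fj; rewrite fz; lia.
    by apply/negP => /eqP /= fz; have : - m.+1%:Z <= cj f := fj; rewrite fz; lia.
  have -> : z = - m.+1%:Z by lia.
  rewrite (@proj_ext _ _ _ C0s _ _ f1 (predI (gr cj (- m.+1%:Z)) (gr cj (- m.+1%:Z))) (gr cj (- m.+1%:Z)) predT) ?subrr //.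
  by move=> f _ /=; rewrite andbb.
have [r hr] := mut_clear gs (tspanT hg).
exists (n + r)%N; rewrite mulrBl.
have D1 : D (w * x ^+ (n + r)).
  by rewrite exprD mulrA; apply: (D_mul hD); apply: D_exp; apply: x_D.
have D2 : D (a * x ^+ (n + r)).
  have ej0 : cj ((n + r)%:Z *: e_ (val k)) = 0 by rewrite coZ coe vjk mulr0.
  have [z ez] := exch_commN H Fdiv g1 jk m.+1 ej0.
  rewrite (mut_frame_k gs) in ez.
  rewrite eg -mulrA ez (vzA H _ g) (mulrA g).
  have hgx : T1 [pred f | 0 <= ck f] (g * x ^+ (n + r)) by apply: hr; apply: leq_addl.
  have hgx2 : T1 [pred f | 0 <= cj f] (g * x ^+ (n + r)).
    apply: (seedM g1 _ hg (x_s1 _)) => f h /eqP hf /eqP hh.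
    by rewrite inE coD hf hh.
  have [hgxT _] := bar_lead hgx hgx2.
  have [Da Db] := D_mul (D_nonneg hgxT) (D_exp m.+1 y1_D).
  by split; apply: tspanC; [exact: C0s|exact: C0v|exact: Da|exact: C0s|exact: C0v|exact: Db].
by case: D1 D2 => [a1 a2] [b1 b2]; split; apply: tspanB.
Qed.

Lemma rank2_dep w : T predT w -> T1 predT w -> T2 predT w -> T12 predT w.
Proof.
move=> Tw T1w T2w; have [m hm] := seed_min g1 (degree_co (val j)) T1w.
by apply: (rank2_dep_ind hm); exists 0%N; rewrite expr0 mulr1.
Qed.
End Dependent.

Lemma rank2 s (gs : good v C0 d s) k j : j != k -> forall w,
  tspan C0 (frame s) predT w -> tspan C0 (frame (mut v k s)) predT w ->
  tspan C0 (frame (mut v j s)) predT w ->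
  tspan C0 (frame (mut v j (mut v k s))) predT w.
Proof.
move=> jk w Tw T1w T2w; case: (eqVneq (exmat s (val k) j) 0) => [B0|B1].
  exact: (rank2_indep H Fdiv gs jk B0).
exact: (rank2_dep gs jk B1).
Qed.

Lemma seed_eq s s' : frame s = frame s' -> exmat s = exmat s' ->
  qform s = qform s' -> s = s'.
Proof using. by case: s s' => [M B L] [M' B' L'] /= -> -> ->. Qed.

(** For the frame, each monomial of the second exchange element times x is [frame s (e_ (val k))]
    times a monomial of x, the two monomials being interchanged; then x cancels. *)
Lemma mutK s (gs : good v C0 d s) k : mut v k (mut v k s) = s.
Proof.
have g1 := mut_good gs k; have g2 := mut_good g1 k.
have eB : exmat (mut v k (mut v k s)) = exmat s.
  apply/funext => i; apply/funext => j; rewrite -[LHS]co_bcol -[RHS]co_bcol.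
  congr (co i _); case: (eqVneq j k) => [->|jk].
    by rewrite (bcol_mut_eq H Fdiv g1) (bcol_mut_eq H Fdiv gs) opprK.
  rewrite (bcol_mut_ne H Fdiv g1 jk) (bcol_mut_ne H Fdiv gs jk).
  have e1 : exmat (mut v k s) (val k) j = - exmat s (val k) j.
    by rewrite -co_bcol (bcol_mut_ne H Fdiv gs jk) co_tropmap
       (co_tropg_k H Fdiv gs k j) eqxx mulr1n co_bcol; ring.
  case: (eqVneq (exmat s (val k) j) 0) => [z|nz].
    by rewrite !tropmap0 ?co_bcol // tropmap0 ?co_bcol ?e1 ?z ?oppr0.
  have -> : tropg (mut v k s) k j = tropg s k j.
    rewrite /tropg e1 (bcol_mut_eq H Fdiv gs) opprK.
    by case: (leP 0 (exmat s (val k) j)) => c1; case: ifP => c2 //; move: nz; lia.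
  by rewrite tropmapK // (co_tropg_k H Fdiv gs).
have eL : qform (mut v k (mut v k s)) = qform s.
  have ef (f g : 'cV[int]_N) : form (qform (mut v k (mut v k s))) f g = form (qform s) f g.
    rewrite [qform _]/(mutqform k (mut v k s)) (mutformE H Fdiv g1 k true).
    rewrite [qform _]/(mutqform k s) (mutformE H Fdiv gs k false).
    have b1 : co (val k) (pcol (- bcol (exmat s) k)) = 0.
      by rewrite co_pcol coN co_bcol (good_diag H Fdiv gs k).
    by rewrite (bcol_mut_eq H Fdiv gs) !tropmapK.
  have fe (L : 'M[int]_N) (i j : 'I_N) : form L (e_ i) (e_ j) = L i j.
    rewrite /form /e_ -mulmxA -[X in _ *m X]colE trmx_delta -rowE !mxE.
    by [].
  by apply/matrixP => i j; rewrite -!fe ef.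
have eM : frame (mut v k (mut v k s)) = frame s.
  apply: (frame_ext H (good_skew gs)); last 1 first.
  - move=> i; case: (eqVneq i (val k)) => [->|ik]; last first.
      have ei : co (val k) (e_ i) = 0 by rewrite coe eq_sym (negPf ik).
      by rewrite (mut_frame0 g1 ei) (mut_frame0 gs ei).
    rewrite [LHS](mutframe_ek H Fdiv g1 k).
    apply: (mulIr (exchU H Fdiv gs k)).
    have ce b : co (val k) (pcol (if b then bcol (exmat s) k else - bcol (exmat s) k)) = 0.
      by case: b; rewrite co_pcol ?coN co_bcol (good_diag H Fdiv gs k).
    have e1 b : frame (mut v k s) (- e_ (val k) + pcol (if b then bcol (exmat s) k else - bcol (exmat s) k)) * exch s k =
        frame s (e_ (val k)) * frame s (exch_exp (exmat s) k b).
      set g := pcol _; have cg : co (val k) g = 0 by apply: ce.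
      rewrite (qframeM (good_frame gs)) /exch_exp -/g addrA subrr add0r formDr formNr form_alt //; last exact: good_skew gs.
      have -> : exch s k = frame (mut v k s) (e_ (val k)).
        exact: (esym (mutframe_ek H Fdiv gs k)).
      rewrite (qframeM (good_frame g1)) formDl formNl form_alt; last exact: good_skew g1.
      have ge : - e_ (val k) + g + e_ (val k) = g by rewrite addrAC addNr add0r.
      rewrite ge (mut_frame0 gs cg) [qform _]/(mutqform k s).
      rewrite (mutform_ek H Fdiv gs b cg) /exch_exp -/g formDr formNr form_alt; last exact: good_skew gs.
      by rewrite (form_skew g _ (good_skew gs)) opprK oppr0 !add0r addr0.
    rewrite [exch (mut v k s) k]/exch /exch_exp (bcol_mut_eq H Fdiv gs) opprK mulrDl.
    by rewrite [X in X + _](e1 false) [X in _ + X](e1 true) addrC -mulrDr.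
  - by have := good_frame g2; rewrite eL.
  - exact: good_frame gs.
by apply: seed_eq.
Qed.

Definition muts (p : seq (dir ex)) s : seed F ex := foldl (fun s k => mut v k s) s p.

Lemma muts_good p s : good v C0 d s -> good v C0 d (muts p s).
Proof. by elim: p s => //= k p IH s gs; apply/IH/mut_good. Qed.

Lemma muts_rcons p k s : muts (rcons p k) s = mut v k (muts p s).
Proof using. by rewrite /muts -cats1 foldl_cat. Qed.

Lemma muts_cat p q s : muts (p ++ q) s = muts q (muts p s).
Proof using. exact: foldl_cat. Qed.

Lemma muts_rev p s : good v C0 d s -> muts (rev p) (muts p s) = s.
Proof.
elim: p s => [|k p IH] s gs; first by [].
rewrite [muts (k :: p) s]/(muts p (mut v k s)) rev_cons muts_rcons IH ?mutK //.
exact: mut_good.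
Qed.

(* The Berenstein-Fomin-Zelevinsky upper bound. *)
Definition upper_bound s w : Prop :=
  tspan C0 (frame s) predT w /\ forall k, tspan C0 (frame (mut v k s)) predT w.

(** The neighbour in direction k is the original seed by involutivity; every other one is covered by
    [rank2]. *)
Lemma upper_bound_mut s k w : good v C0 d s -> upper_bound s w ->
  upper_bound (mut v k s) w.
Proof.
move=> gs [Tw T1w]; split=> // j; case: (eqVneq j k) => [->|jk]; first by rewrite mutK.
exact: (rank2 gs jk Tw (T1w k) (T1w j)).
Qed.
Lemma upper_bound_muts s p w : good v C0 d s -> upper_bound s w ->
  upper_bound (muts p s) w.
Proof.
elim: p s => [//|k p IH] s gs h; apply: IH; [exact: mut_good|exact: upper_bound_mut].
Qed.

(** A variable lies in the upper bound of its own seed. Going back along p and then along q carries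
    it to the target seed. *)
Lemma laurent s p q i : good v C0 d s ->
  tspan C0 (frame (muts q s)) predT (frame (muts p s) (e_ i)).
Proof.
move=> gs; have gp := muts_good p gs.
have ub : upper_bound (muts p s) (frame (muts p s) (e_ i)).
  split=> [|k]; first exact: (seed_frT gp).
  by apply: (frame_mutT gp); rewrite coe.
have := upper_bound_muts (rev p ++ q) gp ub.
by rewrite muts_cat muts_rev // => -[].
Qed.

Definition frozen_nneg : pred 'cV[int]_N :=
  [pred f | [forall i : 'I_N, (i \in ex) || (0 <= co i f)]].

Lemma frozen_nnegP f :
  reflect (forall i, i \notin ex -> 0 <= co i f) (frozen_nneg f).
Proof using.
apply: (iffP forallP) => h i; first by move=> ie; have := h i; rewrite (negPf ie).
by case: (boolP (i \in ex)) => //= /h.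
Qed.
Lemma frozen_nnegD f g : frozen_nneg f -> frozen_nneg g -> frozen_nneg (f + g).
Proof using.
move=> /frozen_nnegP hf /frozen_nnegP hg; apply/frozen_nnegP => i ie.
by rewrite coD addr_ge0 ?hf ?hg.
Qed.
Lemma frozen_nneg0 : frozen_nneg 0.
Proof using. by apply/frozen_nnegP => i _; rewrite co0. Qed.
Lemma frozen_ne i (k : dir ex) : i \notin ex -> (i == val k) = false.
Proof using. by move=> ie; apply/negbTE/eqP => e; move: ie; rewrite e (valP k). Qed.
Lemma frozen_nneg_shift (k : dir ex) f z :
  frozen_nneg (f + z *: e_ (val k)) = frozen_nneg f.
Proof using.
apply/frozen_nnegP/frozen_nnegP => h i ie; have := h i ie;
by rewrite coD coZ coe (frozen_ne _ ie) mulr0 addr0.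
Qed.
Lemma frozen_nneg_ek (k : dir ex) z : frozen_nneg (z *: e_ (val k)).
Proof using. by rewrite -[_ *: _]add0r frozen_nneg_shift frozen_nneg0. Qed.

Lemma exch_exp_nneg s k b : frozen_nneg (exch_exp (exmat s) k b).
Proof using.
apply/frozen_nnegP => i ie; rewrite /exch_exp coD coN coe (frozen_ne _ ie) co_pcol.
by rewrite mulr0n oppr0 add0r le_max lexx.
Qed.

(** * Nonnegativity of frozen exponents *)

Section Positivity.
Variables (s : seed F ex) (gs : good v C0 d s) (k : dir ex).
Local Notation M := (frame s).
Local Notation s1 := (mut v k s).
Local Notation x := (exch s k).
Local Notation T := (tspan C0 M).
Local Notation T1 := (tspan C0 (frame s1)).
Let g1 := mut_good gs k.

Lemma exch_frozen i : i \notin ex -> exists a c,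
  [/\ x = M a + M c, co i a = 0 & 0 <= co i c].
Proof.
move=> ie; have c b : co i (exch_exp (exmat s) k b) =
    Num.max 0 (if b then exmat s i k else - exmat s i k).
  rewrite /exch_exp coD coN coe (frozen_ne _ ie) co_pcol mulr0n oppr0 add0r.
  by case: b; rewrite ?coN co_bcol.
case: (leP 0 (exmat s i k)) => b0.
  exists (exch_exp (exmat s) k false), (exch_exp (exmat s) k true).
  by rewrite /exch addrC !c; split => //; lia.
exists (exch_exp (exmat s) k true), (exch_exp (exmat s) k false).
by rewrite /exch !c; split => //; lia.
Qed.

Lemma peel_frozen i p : i \notin ex -> T predT p ->
  T [pred f | 0 <= co i f] (p * x) -> T [pred f | 0 <= co i f] p.
Proof.
move=> ie Tp hpx; have [a [c [xE a0 c0]]] := exch_frozen ie.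
have [n hn] := seed_min gs (degree_co i) Tp.
have fM := good_free gs.
pose pr z := proj C0 M (gr (co i) z).
have Tx : T predT x := exch_T H Fdiv gs k.
have e z : z < 0 -> pr z p * M a + pr (z - co i c) p * M c = 0.
  move=> z0; have := proj_eq0 C0s fM hpx (P := gr (co i) z).
  rewrite xE mulrDr projD //; [|exact: (seedMT gs Tp (seed_frT gs _))|exact: (seedMT gs Tp (seed_frT gs _))].
  rewrite (seed_projM gs (degree_co i) (esym (addr0 z)) Tp (seed_gr gs a0)).
  rewrite (seed_projM gs (degree_co i) (esym (subrK (co i c) z)) Tp (seed_gr gs (erefl (co i c)))).
  apply=> f f0; apply/negP => /eqP fz; have : 0 <= co i f := f0.
  by rewrite fz; lia.
have all r : forall z, z < 0 -> z < - n%:Z + r%:Z -> pr z p = 0.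
  elim: r => [|r IH] z z0 zr.
    apply: (proj_eq0 C0s fM hn) => f f0; apply/negP => /eqP fz.
    by have : - n%:Z <= co i f := f0; rewrite fz; lia.
  have := e z z0; case: (eqVneq (co i c) 0) => [cc|cc].
    rewrite cc subr0 -mulrDr -xE => h.
    by apply: (mulIr (exchU H Fdiv gs k)); rewrite h mul0r.
  rewrite [pr (z - _) p]IH; [|lia|lia].
  rewrite mul0r addr0 => h.
  by apply: (mulIr (seedU gs a)); rewrite h mul0r.
apply: (seed_ge gs (degree_co i) Tp) => z z0.
by apply: (all n) => //; lia.
Qed.

Lemma peel p : T predT p -> T frozen_nneg (p * x) -> T frozen_nneg p.
Proof.
move=> Tp hpx; apply: tspan_sup => //; first exact: good_free gs.
move=> f nf; have [i [ie fi]] : exists i, i \notin ex /\ ~~ (0 <= co i f).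
  apply: contrapT => h; case/negP: nf; apply/frozen_nnegP => i ie.
  by apply: contraT => fi; case: h; exists i.
have hi : T [pred f | 0 <= co i f] (p * x).
  by apply: tspanS hpx => g /frozen_nnegP /(_ i ie).
apply: (proj_eq0 C0s (good_free gs) (peel_frozen ie Tp hi)) => g g0.
apply/negP => /eqP gf; move: fi; rewrite -gf.
by have : 0 <= co i g := g0 => ->.
Qed.

Lemma peelX p n : T predT p -> T frozen_nneg (p * x ^+ n) -> T frozen_nneg p.
Proof.
elim: n p => [|n IH] p Tp; first by rewrite expr0 mulr1.
rewrite exprSr mulrA => h; apply: IH => //; apply: peel => //.
by apply: (seedMT gs) => //; apply: (seedXT gs); apply: (exch_T H Fdiv gs k).
Qed.

(** Each e_k-component is a k-free element times a power of the new variable. For a nonnegative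
    power the k-free factor is obtained by peeling off x, for a negative one by multiplying by x;
    k-free elements have the same support in both tori. *)
Lemma mixed_mut w : T frozen_nneg w -> T1 predT w -> T1 frozen_nneg w.
Proof.
move=> hw T1w; have Tw := tspanT hw.
have [t ->] := seed_decomp g1 (degree_co (val k)) T1w.
apply: tspan_sum => z _.
have hz : T (predI (gr (co (val k)) (- z)) frozen_nneg)
    (proj C0 (frame s1) (gr (co (val k)) z) w).
  by rewrite -(proj_mut gs) //; apply: (seed_proj gs).
have hz1 := seed_projgr g1 (co (val k)) z T1w.
set u := proj _ _ _ _ in hz hz1 *.
have fz (m : int) : T1 frozen_nneg (frame s1 (m *: e_ (val k))).
  by apply: tspanM1 => //; apply: frozen_nneg_ek.
case: (leP 0 z) => z0.
  have zE : z = (absz z)%:Z by lia.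
  rewrite zE in hz1.
  have [p hp pE] := proj_mut_hom gs (P := predT) (fun _ _ => erefl) (tspanT hz1) hz1.
  have pp : T frozen_nneg p.
    apply: (@peelX _ (absz z)); first exact: tspanT hp.
    by rewrite -pE; apply: tspanS hz => f /andP[].
  have hp0 : T [pred f | co (val k) f == 0] p.
    by apply: tspanS hp => f /andP[].
  have := tspan_inI C0s (good_free gs) hp0 pp.
  move/(tspan_mut0 gs (k := k)); rewrite pE -(mut_frame_k gs) => hp1.
  apply: (seedM g1 frozen_nnegD _ (fz _)).
  by apply: tspanS (hp1 _) => [f /andP[]//|f /andP[/eqP]].
have zE : - z = (absz z)%:Z by lia.
have -> : u = u * x ^+ absz z * frame s1 (- ((absz z)%:Z *: e_ (val k))).
  by rewrite (mut_frame_Nk gs) (mulrK (exchXU gs k _)).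
rewrite -scaleNr; apply: (seedM g1 frozen_nnegD _ (fz _)).
have hx : T (predI (gr (co (val k)) (- (absz z)%:Z)) frozen_nneg) (x ^+ absz z).
  apply: tspan_inI => //; [exact: good_free gs|exact: (exchX_gr gs)|].
  apply: (seedX gs _ frozen_nneg0 frozen_nnegD); apply: tspanD; apply: tspanM1 => //; exact: exch_exp_nneg.
have h2 : T (predI (gr (co (val k)) 0) frozen_nneg) (u * x ^+ absz z).
  apply: (seedM gs _ hz hx) => f g /andP[/eqP f0 fn] /andP[/eqP g0' gn].
  apply/andP; split; last exact: frozen_nnegD.
  by apply/eqP; rewrite coD f0 g0' zE subrr.
have P0 f : predI (gr (co (val k)) 0) frozen_nneg f -> co (val k) f = 0.
  by move=> /andP[/eqP].
by apply: tspanS ((tspan_mut0 gs _ P0).1 h2) => f /andP[].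
Qed.
End Positivity.

Lemma mixed_laurent s p q i : good v C0 d s ->
  tspan C0 (frame (muts q s)) frozen_nneg (frame (muts p s) (e_ i)).
Proof.
move=> gs; have gp := muts_good p gs.
suff h r : tspan C0 (frame (muts r (muts p s))) frozen_nneg (frame (muts p s) (e_ i)).
  by have := h (rev p ++ q); rewrite muts_cat muts_rev.
elim/last_ind: r => [|r k IH].
  by apply: tspanM1 => //; apply/frozen_nnegP => j _; rewrite coe.
rewrite muts_rcons; apply: mixed_mut => //; first exact: muts_good.
by rewrite -muts_rcons -muts_cat; apply: laurent.
Qed.
End Laurent.

(** * Mixed quantum tori of reachable seeds *)

Definition lcoef (K : fieldType) (F : unitAlgType K) (v : F) : set F :=
  alg_gen [set v; v^-1].

Section LaurentCoefficients.
Variables (K : fieldType) (F : unitAlgType K) (v : F).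
Hypotheses (vC : forall x, v * x = x * v) (vU : v \is a GRing.unit).

Lemma lcoef_pow (z : int) : lcoef v (v ^ z).
Proof.
have hs := alg_gen_subalg [set v; v^-1].
case: z => n; first by apply: (subalgX hs); apply: (alg_gen_incl (or_introl erefl)).
rewrite NegzE -exprnN -exprVn; apply: (subalgX hs).
exact: (alg_gen_incl (or_intror erefl)).
Qed.

Lemma lcoef_base : coef_base v (lcoef v).
Proof.
split=> //; [exact: alg_gen_subalg| |exact: lcoef_pow].
move=> c x hc; move: c hc x; apply: alg_gen_min.
  apply/is_subalgP; split=> [x|a y z hy hz x|y z hy hz x]; first by rewrite mul1r mulr1.
    by rewrite mulrDl mulrDr -scalerAl -scalerAr hy hz.
  by rewrite -mulrA hz mulrA hy mulrA.
move=> y [->|->] x //.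
by apply: (mulrI vU); apply: (mulIr vU); rewrite -!mulrA mulVr // mulr1 !mulrA divrr // mul1r vC.
Qed.

Lemma lcoefP c : lcoef v c ->
  exists t : seq (K * int), c = \sum_(p <- t) p.1 *: v ^ p.2.
Proof.
move: c; apply: alg_gen_min; last first.
  move=> y [->|->]; first by exists [:: (1, 1)]; rewrite big_seq1 scale1r.
  by exists [:: (1, -1)]; rewrite big_seq1 scale1r.
apply/is_subalgP; split=> [|a x y [t ->] [u ->]|x y [t ->] [u ->]].
- by exists [:: (1, 0)]; rewrite big_seq1 scale1r.
- exists (map (fun p => (a * p.1, p.2)) t ++ u); rewrite big_cat big_map; congr (_ + _).
  by rewrite scaler_sumr; apply: eq_bigr => p _; rewrite scalerA.
exists [seq (p.1 * q.1, p.2 + q.2) | p <- t, q <- u].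
rewrite big_allpairs_dep /= mulr_suml; apply: eq_bigr => p _.
rewrite mulr_sumr; apply: eq_bigr => q _.
by rewrite -scalerAl -scalerAr scalerA exprzDr.
Qed.
End LaurentCoefficients.

Lemma scale_group (K : fieldType) (A : algType K) (I : choiceType)
    (b : I -> A) (t : seq (K * I)) : \sum_(p <- t) p.1 *: b p.2 =
  \sum_(i <- undup (map snd t)) (\sum_(p <- t | p.2 == i) p.1) *: b i.
Proof.
under [RHS]eq_bigr do rewrite scaler_suml big_mkcond.
rewrite exchange_big /=; apply: eq_big_seq => p pt.
rewrite (bigD1_seq p.2) ?undup_uniq ?mem_undup ?map_f //= eqxx big1 ?addr0 //.
by move=> j /negPf jp; rewrite eq_sym jp.
Qed.

Lemma lin_indep_comb (K : fieldType) (A : algType K) (I : choiceType)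
    (b : I -> A) (t : seq (K * I)) : lin_indep b ->
  \sum_(p <- t) p.1 *: b p.2 = 0 ->
  forall i, \sum_(p <- t | p.2 == i) p.1 = 0.
Proof.
move=> hb h0 i; case: (boolP (i \in undup (map snd t))) => it; last first.
  rewrite big1_seq // => p /andP[/eqP pi pt]; move: it.
  by rewrite mem_undup -pi map_f.
apply: (hb _ (fun i => \sum_(p <- t | p.2 == i) p.1) (undup_uniq _) _ _ it).
by rewrite -[RHS]h0 [RHS]scale_group.
Qed.

Lemma lcoef_scalar (K : fieldType) (F : unitAlgType K) (e : K) c :
  lcoef (e%:A : F) c -> exists a : K, c = a%:A.
Proof.
move: c; apply: alg_gen_min => [|y [->|->]].
- apply/is_subalgP; split=> [|a x y [b ->] [c ->]|x y [b ->] [c ->]].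
  + by exists 1; rewrite scale1r.
  + by exists (a * b + c); rewrite scalerDl scalerA.
  + by exists (b * c); rewrite -scalerAl mul1r scalerA.
- by exists e.
case: (eqVneq e 0) => [->|e0]; first by exists 0; rewrite !scale0r invr0.
by exists e^-1; rewrite invrZ ?unitfE ?unitr1 // invr1.
Qed.

Lemma scalar_tfree (K : fieldType) (F : unitAlgType K) (e : K)
    (I : choiceType) (b : I -> F) : lin_indep b -> tfree (lcoef e%:A) b.
Proof.
move=> hb t c ut hc h0 i it.
have [a aE] : exists a : I -> K, forall i, c i = (a i)%:A.
  exists (fun i => projT1 (cid (lcoef_scalar (hc i)))) => j.
  by case: (cid _).
rewrite aE (hb t a ut _ i it) ?scale0r //.
by rewrite -[RHS]h0; apply: eq_bigr => j _; rewrite aE mulr_algl.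
Qed.

(** Expanding the coefficients in powers of v turns a relation over them into a K-linear relation
    between the monomials v^m X^f. *)
Lemma generic_tfree (K : fieldType) (F : unitAlgType K) (v : F) N
    (X : 'cV[int]_N -> F) : v \is a GRing.unit ->
  lin_indep (laurent_monomial v X) -> tfree (lcoef v) X.
Proof.
move=> vU hb t c ut hc h0 i it.
have [r rE] : exists r : 'cV[int]_N -> seq (K * int),
    forall i, c i = \sum_(p <- r i) p.1 *: v ^ p.2.
  exists (fun i => projT1 (cid (lcoefP vU (hc i)))) => j.
  by case: (cid _).
pose w := [seq (q.1, (q.2, j)) | j <- t, q <- r j].
have hw : \sum_(p <- w) p.1 *: laurent_monomial v X p.2 = 0.
  rewrite -[RHS]h0 big_allpairs_dep /=; apply: eq_bigr => j _.
  rewrite rE mulr_suml; apply: eq_bigr => q _.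
  by rewrite /laurent_monomial /= scalerAl.
have hz (z : int) : \sum_(q <- r i | q.2 == z) q.1 = 0.
  rewrite -[RHS](lin_indep_comb hb hw (z, i)) big_mkcond [RHS]big_mkcond big_allpairs_dep /=.
  rewrite (bigD1_seq i) //= [X in _ + X]big1 ?addr0 => [|j /negPf ji].
    by apply: eq_bigr => q _; rewrite xpair_eqE eqxx andbT.
  by apply: big1 => q _; rewrite xpair_eqE ji andbF.
rewrite rE (scale_group (fun z : int => v ^ z)) big1 // => z _.
by rewrite hz scale0r.
Qed.

Section Reachable.
#[local] Set Default Proof Using "All".
Variables (K : fieldType) (F : unitAlgType K) (v : F) (N : nat).
Variables (ex : {set 'I_N}) (d : dir ex -> nat).
Hypothesis (vC : forall x, v * x = x * v).
Hypothesis (vU : v \is a GRing.unit).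
Hypothesis (Fdiv : forall x : F, x != 0 -> x \is a GRing.unit).
Local Notation C0 := (lcoef v).
Local Notation H := (lcoef_base vC vU).
Implicit Types (s : seed F ex) (k : dir ex) (p : seq (dir ex)).

(* Seeds whose forms are not equal but define the same powers of [v]: [Om] and
   its integer lift at the root of unity. *)
Definition twin s s' : Prop := [/\ frame s = frame s', exmat s = exmat s'
  & forall f g, v ^ form (qform s) f g = v ^ form (qform s') f g].

Lemma twin_mutation s t s' k : good v C0 d t -> twin s t -> mutation v k s s' ->
  twin s' (mut v k t).
Proof.
move=> gt [eM eB eL] m.
have m' : mutation v k t (Seed (frame s') (exmat s') (mutqform k t)).
  split=> //=.
  - by rewrite -eB; apply: mutation_exmat m.
  - by rewrite -eM; apply: mutation_frame_ne m.
  - by rewrite -eM -eB; apply: mutation_frame_eq m.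
  by move=> f g; rewrite (mutation_frame_mul m) (mutation_qform m) form_congr eL
    -form_congr eB.
have /(mutationP H Fdiv gt) e := m'.
rewrite -e; split=> //= f g.
by rewrite (mutation_qform m) form_congr eL -form_congr eB.
Qed.

Lemma twin_mut s t k : good v C0 d t -> twin s t ->
  exists2 s', mutation v k s s' & twin s' (mut v k t).
Proof.
move=> gt [eM eB eL].
have m : mutation v k t (mut v k t) by apply/(mutationP H Fdiv gt).
exists (Seed (frame (mut v k t)) (exmat (mut v k t)) (mutqform k s)).
  split=> //.
  - by rewrite eB; apply: mutation_exmat m.
  - by rewrite eM; apply: mutation_frame_ne m.
  - by rewrite eM eB; apply: mutation_frame_eq m.
  by move=> f g; rewrite (mutation_frame_mul m) (mutation_qform m) /mutqform /= !form_congr -eB eL.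
by split=> //= f g; rewrite /mutqform !form_congr eL eB.
Qed.

Lemma reach_muts s t s' : good v C0 d t -> twin s t -> mutation_equiv v s s' ->
  exists p, twin s' (muts v p t).
Proof.
move=> gt st; elim=> [|k s1 s2 _ [p hp] m]; first by exists [::].
exists (rcons p k); rewrite muts_rcons; apply: twin_mutation hp m.
exact: (muts_good H Fdiv).
Qed.

Lemma muts_reach s t p : good v C0 d t -> twin s t ->
  exists2 s', mutation_equiv v s s' & twin s' (muts v p t).
Proof.
move=> gt st; elim/last_ind: p => [|p k [s1 h1 t1]].
  by exists s => //; apply: mutation_equiv_refl.
have [s2 m2 t2] := twin_mut k (muts_good H Fdiv p gt) t1.
by exists s2; rewrite ?muts_rcons //; apply: mutation_equiv_step h1 m2.
Qed.

(** The exponents of [mixed_torus] with parameter n: n = 1 gives the mixed torus, n = l the central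
    subalgebra. *)
Definition latt (n : nat) : pred 'cV[int]_N :=
  [pred f | frozen_nneg ex f && [forall i, (n %| co i f)%Z]].

Lemma latt0 n : latt n 0.
Proof using.
by rewrite /latt /= frozen_nneg0; apply/forallP => i; rewrite co0 dvdz0.
Qed.
Lemma lattD n f g : latt n f -> latt n g -> latt n (f + g).
Proof using.
move=> /andP[f0 /forallP hf] /andP[g0 /forallP hg]; apply/andP; split.
  exact: frozen_nnegD.
by apply/forallP => i; rewrite coD rpredD.
Qed.

Lemma latt1 : latt 1 =1 frozen_nneg ex.
Proof using.
move=> f; rewrite /latt /=; case: (frozen_nneg ex f) => //=.
by apply/forallP => i; rewrite dvd1z.
Qed.

Lemma mixed_torusE n s : (0 < n)%N -> good v C0 d s ->
  mixed_torus v n s = tspan C0 (frame s) (latt n) :> set F.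
Proof.
move=> n0 gs; rewrite eqEsubset; split.
  apply: alg_gen_min.
    apply: (tspan_subalg H (good_skew gs) (good_frame gs)); [exact: latt0|exact: lattD].
  have hS := tspan_subalg H (good_skew gs) (good_frame gs) (latt0 n) (@lattD n).
  have hc (z : int) : tspan C0 (frame s) (latt n) (v ^ z).
    rewrite -[v ^ z]mulr1 -(qframe1 (good_frame gs)); apply: tspan_gen; last exact: latt0.
    exact: lcoef_pow.
  have hk (k : dir ex) (z : int) : latt n ((n%:Z * z) *: e_ (val k)).
    apply/andP; split; first exact: frozen_nneg_ek.
    by apply/forallP => i; rewrite coZ -mulrA dvdz_mulr.
  move=> y [[[i ->]|[k ->]]|[->|->]].
  - rewrite (qframeX H (good_skew gs) (good_frame gs)); apply: tspanM1; first exact: alg_gen_subalg.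
    apply/andP; split; first by apply/frozen_nnegP => j _; rewrite coMn coe; lia.
    by apply/forallP => j; rewrite coMn dvdz_mulr.
  - rewrite (qframeX H (good_skew gs) (good_frame gs)) (qframeV H (good_skew gs) (good_frame gs)).
    apply: tspanM1; first exact: alg_gen_subalg.
    have -> : - (e_ (val k) *+ n) = (n%:Z * (-1)) *: e_ (val k) :> 'cV[int]_N.
      by rewrite mulrN1 scaleNr -natz scaler_nat.
    exact: hk.
  - exact: (hc 1).
  exact: (hc (-1)).
have hS : is_subalg (mixed_torus v n s) by apply: alg_gen_subalg.
have hc c : C0 c -> mixed_torus v n s c.
  by apply: alg_gen_min => // y hy; apply: alg_gen_incl; right.
have hcz (z : int) : mixed_torus v n s (v ^ z) by apply: hc; apply: lcoef_pow.
pose Z f := mixed_torus v n s (frame s f).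
have ZD f g : Z f -> Z g -> Z (f + g).
  move=> hf hg; rewrite /Z (qframeD H (good_skew gs) (good_frame gs)).
  by apply: (subalgM hS) => //; apply: (subalgM hS).
have Z0 : Z 0 by rewrite /Z (qframe1 (good_frame gs)); apply: subalg1.
have Zi (i : 'I_N) (m : nat) : Z ((n * m)%:Z *: e_ i).
  rewrite /Z -natz scaler_nat -(qframeX H (good_skew gs) (good_frame gs)) exprM.
  by apply: (subalgX hS); apply: alg_gen_incl; left; left; exists i.
have Zk (k : dir ex) (m : nat) : Z (- ((n * m)%:Z *: e_ (val k))).
  rewrite /Z -(qframeV H (good_skew gs) (good_frame gs)) -natz scaler_nat.
  rewrite -(qframeX H (good_skew gs) (good_frame gs)) exprM -exprVn.
  by apply: (subalgX hS); apply: alg_gen_incl; left; right; exists k.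
move=> x; elim/tspan_ind => [|a b ha hb|c f hcc /andP[f0 /forallP fn]].
- exact: (subalg0 hS).
- exact: (subalgD hS).
apply: (subalgM hS); first exact: hc.
rewrite -/(Z f); have -> : f = \sum_i co i f *: e_ i.
  apply: co_eqP => j; rewrite /co summxE (bigD1 j) //= big1 => [|i /negPf ij].
    by rewrite !mxE !eqxx mulr1 addr0.
  by rewrite !mxE eq_sym ij mulr0.
elim/big_ind: _ => // i _; have /dvdzP[m mE] := fn i.
have {}mE : co i f = n%:Z * m by rewrite mE mulrC.
case: (boolP (i \in ex)) => ie.
  case: m mE => m ->; first by rewrite -PoszM.
  rewrite NegzE mulrN -PoszM scaleNr.
  exact: (Zk (exist _ i ie)).
have fi := (elimT (frozen_nnegP _ _) f0) i ie.
have -> : co i f = (n * absz m)%:Z by rewrite PoszM mE; move: n0 fi; rewrite mE; nia.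
exact: Zi.
Qed.
End Reachable.

(** * Newton identities *)

Section NewtonIdentities.
Variables (R : comNzRingType) (n : nat) (A : 'M[R]_n).

Lemma deriv_bigprod (I : finType) (g : I -> {poly R}) :
  (\prod_i g i)^`() = \sum_i (g i)^`() * \prod_(j | i != j) g j.
Proof.
have h (t : seq I) : uniq t -> (\prod_(i <- t) g i)^`() =
    \sum_(i <- t) (g i)^`() * \prod_(j <- t | i != j) g j.
  elim: t => [|i t IH] /=; first by rewrite !big_nil -polyC1 derivC.
  move=> /andP[it ut]; rewrite !big_cons derivM IH // eqxx /=; congr (_ + _).
    congr (_ * _); rewrite [RHS]big_seq_cond [LHS]big_seq_cond; apply: eq_bigl => j.
    by case: (boolP (j \in t)) => //= jt; case: eqP => // e; move: it; rewrite e jt.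
  rewrite mulr_sumr; apply: eq_big_seq => j jt.
  have ji : j != i by apply/eqP => e; move: it; rewrite -e jt.
  by rewrite big_cons ji mulrCA.
by have := h _ (index_enum_uniq I).
Qed.

(** Jacobi's formula, read off from the Leibniz expansion by grouping permutations according to the
    entry that is differentiated. *)
Lemma deriv_det (M : 'M[{poly R}]_n) :
  (\det M)^`() = \sum_i \sum_j (M i j)^`() * cofactor M i j.
Proof.
have dsign (s : {perm 'I_n}) (p : {poly R}) : ((-1) ^+ s * p)^`() = (-1) ^+ s * p^`().
  by case: (odd_perm s); rewrite ?expr1 ?expr0 ?mul1r // !mulN1r derivN.
rewrite /determinant raddf_sum /=.
under eq_bigr do rewrite dsign deriv_bigprod mulr_sumr.
rewrite exchange_big /=; apply: eq_bigr => i _.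
under [RHS]eq_bigr do rewrite expand_cofactor mulr_sumr.
rewrite (partition_big (fun s : {perm 'I_n} => s i) predT) //=.
apply: eq_bigr => j _; apply: eq_bigr => s /eqP <-.
by rewrite mulrCA.
Qed.

Local Notation chi := (char_poly A).
Let Adj := \adj (char_poly_mx A).
Let B m : 'M[R]_n := \matrix_(i, j) (Adj i j)`_m.

(** The Faddeev-LeVerrier recursion: compare coefficients in the product of X - A with its
    adjugate. *)
Lemma adj_coef m : B m = A *m B m.+1 + (chi`_m.+1)%:M.
Proof.
apply/matrixP => i j; have /matrixP/(_ i j)/(congr1 (fun p : {poly R} => p`_m.+1)) := mul_mx_adj (char_poly_mx A).
rewrite -/(char_poly A) -/Adj /B; move: Adj => D; rewrite !mxE coef_sum coefMn.
under eq_bigr do rewrite !mxE mulrBl coefB mulrnAl coefMn coefXM /= coefCM.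
rewrite sumrB (bigD1 i) //= eqxx mulr1n big1 ?addr0 => [|k /negPf ki]; last first.
  by rewrite eq_sym ki mulr0n.
move=> /eqP; rewrite subr_eq => /eqP ->; rewrite addrC; congr (_ + _).
by apply: eq_bigr => k _; rewrite mxE.
Qed.
Lemma adj_coef0 : A *m B 0 + (chi`_0)%:M = 0.
Proof.
apply/matrixP => i j; have /matrixP/(_ i j)/(congr1 (fun p : {poly R} => p`_0)) := mul_mx_adj (char_poly_mx A).
rewrite -/(char_poly A) -/Adj /B; move: Adj => D; rewrite !mxE coef_sum coefMn.
under eq_bigr do rewrite !mxE mulrBl coefB mulrnAl coefMn coefXM /= mul0rn sub0r coefCM.
rewrite sumrN => <-; rewrite [X in X - _](_ : _ = \sum_k A i k * (D k j)`_0) ?subrr //.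
by apply: eq_bigr => k _; rewrite mxE.
Qed.

(** Sufficiently high coefficients vanish, and the recursion propagates this down as long as the
    coefficients of [chi] are zero. *)
Lemma adj_coef_large m : (n <= m)%N -> B m = 0.
Proof.
have [M hM] : exists M, forall m, (M <= m)%N -> B m = 0.
  rewrite /B; move: Adj => D.
  exists (\max_i \max_j size (D i j)) => r hr; apply/matrixP => i j; rewrite !mxE.
  apply: nth_default; apply: leq_trans hr.
  apply: leq_trans (leq_bigmax (F := fun i => \max_j size (D i j)) i).
  exact: (leq_bigmax (F := fun j => size (D i j)) j).
have chi0 r : (n < r)%N -> chi`_r = 0 by move=> h; apply: nth_default; rewrite size_char_poly.
have h r : forall m, (n <= m)%N -> (M <= m + r)%N -> B m = 0.
  elim: r => [|r IH] p np Mp; first by apply: hM; rewrite -(addn0 p).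
  rewrite adj_coef chi0 // IH ?mulmx0 ?add0r ?raddf0 //; first exact: leqW.
  by rewrite addSnnS.
by move=> nm; apply: (h M) => //; apply: leq_addl.
Qed.

(** The derivative of det (X - A) is the trace of the adjugate. *)
Lemma adj_coef_trace m : \tr (B m) = chi`_m.+1 *+ m.+1.
Proof.
have <- := coef_deriv chi m; rewrite /char_poly deriv_det coef_sum.
apply: eq_bigr => i _; rewrite coef_sum (bigD1 i) //= big1 ?addr0 => [|j /negPf ij].
  by rewrite !mxE eqxx mulr1n derivB derivX derivC subr0 mul1r.
by rewrite !mxE eq_sym ij mulr0n derivB deriv0 derivC subr0 mul0r coef0.
Qed.

Variable S : R -> Prop.
Hypotheses (S0 : S 0) (S1 : S 1) (SD : forall x y, S x -> S y -> S (x + y)).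
Hypotheses (SN : forall x, S x -> S (- x)) (SM : forall x y, S x -> S y -> S (x * y)).
Hypothesis (Sdiv : forall m x, S (x *+ m.+1) -> S x).
Hypothesis (Str : forall k, S (\tr (iter k (mulmx A) 1%:M))).

(** Newton's identities in recursive form, for a subset [S] closed under division by positive
    integers. The entries of A need not lie in S, only the traces of its powers; the traces of
    powers of A times [B m] are therefore carried along the descent. *)
Lemma char_poly_coef_trace i : S chi`_i.
Proof.
pose Ai k := iter k (mulmx A) 1%:M.
have AiC k : A *m Ai k = Ai k *m A.
  elim: k => [|k IH]; first by rewrite /Ai /= mulmx1 mul1mx.
  by rewrite /Ai /= -/(Ai k) {1}IH mulmxA.
have St x m : S x -> S (x *+ m).
  by move=> Sx; elim: m => [|m IH]; rewrite ?mulr0n // mulrS; apply: SD.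
pose Q m := S chi`_m.+1 /\ forall k, S (\tr (Ai k *m B m)).
have step m : Q m.+1 -> Q m.
  move=> [_ hB]; have h : S chi`_m.+1.
    (* Taking traces in [adj_coef] gives tr (A B_{m+1}) = - (n - m - 1) chi_{m+1}, which determines
       the coefficient below the top; the top one is 1. *)
    case: (ltngtP m.+1 n) => mn.
    - have := adj_coef_trace m; rewrite adj_coef mxtraceD mxtrace_scalar.
      move=> e; have := hB 1%N; rewrite /Ai /= mulmx1.
      have -> : \tr (A *m B m.+1) = - (chi`_m.+1 *+ (n - m.+1)).
        by rewrite mulrnBr ?(ltnW mn) // opprB -e addrK.
      move/SN; rewrite opprK -(prednK (_ : 0 < n - m.+1)%N) ?subn_gt0 //.
      exact: Sdiv.
    - by rewrite nth_default // size_char_poly.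
    have /monicP := char_poly_monic A; rewrite /lead_coef size_char_poly /= => h.
    by rewrite [chi`_m.+1](_ : _ = 1) // [in LHS]mn.
  split=> // k; rewrite adj_coef mulmxDr mxtraceD mulmxA -AiC.
  apply: SD; first exact: (hB k.+1).
  by rewrite mul_mx_scalar mxtraceZ; apply: SM h _; apply: Str.
have Qn r m : (n <= m + r)%N -> Q m.
  elim: r m => [|r IH] m nm; last by apply: step; apply: IH; rewrite addSnnS.
  rewrite addn0 in nm; split=> [|k]; last by rewrite adj_coef_large // mulmx0 mxtrace0.
  by rewrite nth_default // size_char_poly.
case: i => [|i]; last by have [] := @Qn n i (leq_addl _ _).
have [_ h0] := @Qn n 0%N (leq_addl _ _).
case: (posnP n) => [n0|n0].
  have /monicP := char_poly_monic A; rewrite /lead_coef size_char_poly /= => h.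
  by rewrite -[X in chi`_X]n0 h.
have /(congr1 mxtrace) := adj_coef0; rewrite mxtraceD mxtrace_scalar mxtrace0 => e.
apply: (Sdiv (m := n.-1)); rewrite prednK // -[X in S X]opprK; apply: SN.
have := h0 1%N; rewrite /Ai /= mulmx1.
by move/eqP: e; rewrite addr_eq0 => /eqP ->.
Qed.
End NewtonIdentities.

(** * The Nagata-Higman theorem *)

Section NagataHigman.
Variable A : nzRingType.
Implicit Types (S N : A -> Prop) (x y z : A).

(** N is an ideal of the non-unital ring S with torsion-free quotient, the latter replacing
    characteristic zero. Predicates avoid quotient rings, as the induction replaces N by a larger
    ideal. *)
Record nh_ideal S N : Prop := NhIdeal {
  nhS0 : S 0;
  nhSD : forall x y, S x -> S y -> S (x + y);
  nhSM : forall x y, S x -> S y -> S (x * y);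
  nhND : forall x y, N x -> N y -> N (x + y);
  nhSN : forall x, S x -> S (- x);
  nhNN : forall x, N x -> N (- x);
  nhN0 : N 0;
  nhNS : forall x, N x -> S x;
  nhML : forall x y, S x -> N y -> N (x * y);
  nhMR : forall x y, N x -> S y -> N (x * y);
  nhdiv : forall m x, S x -> N (x *+ m.+1) -> N x
}.

Section Theory.
Variables (S N : A -> Prop) (SN : nh_ideal S N).

Lemma nh_sumN (I : Type) (t : seq I) (P : pred I) (g : I -> A) :
  (forall i, P i -> N (g i)) -> N (\sum_(i <- t | P i) g i).
Proof. by move=> h; elim/big_ind: _ => //; [exact: nhN0 SN|exact: nhND SN]. Qed.
Lemma nh_mulnS x m : S x -> S (x *+ m).
Proof.
by move=> Sx; elim: m => [|m IH]; [exact: nhS0 SN|rewrite mulrS; exact: (nhSD SN)].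
Qed.
Lemma nh_mulnN x m : N x -> N (x *+ m).
Proof.
by move=> Nx; elim: m => [|m IH]; [exact: nhN0 SN|rewrite mulrS; exact: (nhND SN)].
Qed.
Lemma nh_exp x m : S x -> S (x ^+ m.+1).
Proof.
by move=> Sx; elim: m => [|m IH]; rewrite ?expr1 // exprS; apply: (nhSM SN).
Qed.

(* Comparing values at t and 2t eliminates the top coefficient. *)
Lemma nh_interp d (a : nat -> A) : (forall k, (k <= d)%N -> S (a k)) ->
  (forall t : nat, N (\sum_(k < d.+1) a k *+ t ^ k)) ->
  forall k, (k <= d)%N -> N (a k).
Proof.
elim: d a => [|d IH] a Sa hN k kd.
  have := hN 0%N; rewrite big_ord1 /= mulr1n.
  by move: kd; rewrite leqn0 => /eqP ->.
have low j : (j <= d)%N -> N (a j).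
  move=> jd; have Sj : S (a j) by apply: Sa; apply: leqW.
  suff: N (a j *+ (2 ^ d.+1 - 2 ^ j)).
    have h : (0 < 2 ^ d.+1 - 2 ^ j)%N by rewrite subn_gt0 ltn_exp2l.
    by rewrite -(prednK h); apply: (nhdiv SN).
  apply: (IH (fun j => a j *+ (2 ^ d.+1 - 2 ^ j))) => // [i id|t].
    by apply: nh_mulnS; apply: Sa; apply: leqW.
  have := nhND SN (nh_mulnN (2 ^ d.+1) (hN t)) (nhNN SN (hN (2 * t)%N)).
  rewrite -sumrMnl -sumrB big_ord_recr /= -!mulrnA -expnMn mulnC subrr addr0.
  rewrite (eq_bigr (fun i : 'I_d.+1 => a i *+ (2 ^ d.+1 - 2 ^ i) *+ t ^ i)) // => i _.
  have le2 : (2 ^ i * t ^ i <= 2 ^ d.+1 * t ^ i)%N.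
    by rewrite leq_mul2r leq_exp2l // ltnW ?orbT.
  by rewrite expnMn -!mulrnA mulnBl (mulrnBr _ le2) ![(t ^ i * _)%N]mulnC.
move: kd; rewrite leq_eqVlt => /orP[/eqP ->|]; last by rewrite ltnS; apply: low.
have hs : N (\sum_(i < d.+1) a i *+ 1 ^ i).
  by apply: nh_sumN => i _; rewrite exp1n; apply: low; rewrite -ltnS.
have := hN 1%N; rewrite big_ord_recr /= exp1n mulr1n => h.
have := nhND SN h (nhNN SN hs); by rewrite addrC addrK.
Qed.

(** Sum of the words with k letters y and m - k letters x, that is, the coefficient of t^k in (x + t
    y)^m. *)
Fixpoint nh_pol x y (m k : nat) : A :=
  match m with
  | 0 => (k == 0)%:R
  | m'.+1 => x * nh_pol x y m' k + (if k is k'.+1 then y * nh_pol x y m' k' else 0)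
  end.

Lemma nh_pol_gt x y m k : (m < k)%N -> nh_pol x y m k = 0.
Proof.
elim: m k => [|m IH] [|k] //= mk; rewrite !IH ?mulr0 ?addr0 //.
exact: ltnW.
Qed.
Lemma nh_polE x y m t : (x + y *+ t) ^+ m = \sum_(k < m.+1) nh_pol x y m k *+ t ^ k.
Proof.
elim: m => [|m IH]; first by rewrite expr0 big_ord1.
rewrite exprS IH [RHS]big_ord_recl /= expn0 mulr1n addr0.
have -> : \sum_(i < m.+1) (x * nh_pol x y m (bump 0 i) + y * nh_pol x y m i) *+ t ^ bump 0 i =
    x * (\sum_(i < m.+1) nh_pol x y m i.+1 *+ t ^ i.+1) + (y *+ t) * (\sum_(i < m.+1) nh_pol x y m i *+ t ^ i).
  rewrite !mulr_sumr -big_split; apply: eq_bigr => i _.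
  rewrite /bump /= add1n mulrnDl !mulrnAr mulrnAl -mulrnA -expnS.
  by rewrite expnS.
rewrite mulrDl addrA; congr (_ + _); rewrite -mulrDr; congr (_ * _).
rewrite big_ord_recl /= expn0 mulr1n; congr (_ + _).
rewrite [RHS]big_ord_recr /= nh_pol_gt // mul0rn addr0.
by apply: eq_bigr => i _; rewrite /bump /= add1n.
Qed.
Lemma nh_pol0 x y m : nh_pol x y m 0 = x ^+ m.
Proof. by elim: m => [|m IH]; rewrite ?expr0 // exprS /= IH addr0. Qed.
Lemma nh_pol1 x y m : nh_pol x y m 1 = \sum_(i < m) x ^+ i * y * x ^+ (m.-1 - i).
Proof.
elim: m => [|m IH]; first by rewrite big_ord0.
rewrite big_ord_recl /= expr0 mul1r subn0 nh_pol0 addrC; congr (_ + _).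
rewrite IH mulr_sumr; apply: eq_bigr => i _.
rewrite /bump /= add1n exprS !mulrA; congr (_ * _ ^+ _).
by rewrite -subn1 -subnDA add1n.
Qed.
Lemma nh_polS x y m k : S x -> S y -> S (nh_pol x y m.+1 k).
Proof.
move=> Sx Sy; elim: m k => [|m IH] k.
  case: k => [|[|k]] /=; rewrite ?mulr0 ?mulr1 ?addr0 ?add0r //; exact: nhS0 SN.
have e : nh_pol x y m.+2 k = x * nh_pol x y m.+1 k +
   (if k is k'.+1 then y * nh_pol x y m.+1 k' else 0) by [].
rewrite e; apply: (nhSD SN); first exact: (nhSM SN).
by case: k {e} => [|k]; [exact: nhS0 SN|exact: (nhSM SN)].
Qed.

Variable n : nat.
Hypothesis nilS : forall x, S x -> N (x ^+ n.+2).

(** Partial linearization: the coefficient of t in the power of x + t y, isolated by interpolation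
    at natural numbers t. *)
Lemma nh_linear x y : S x -> S y ->
  N (\sum_(i < n.+2) x ^+ i * y * x ^+ (n.+1 - i)).
Proof.
move=> Sx Sy; rewrite -[n.+1 in X in N X]/(n.+2.-1) -nh_pol1.
apply: (@nh_interp n.+2 (nh_pol x y n.+2)) => // [k _|t]; first exact: nh_polS.
by rewrite -nh_polE; apply: nilS; apply: (nhSD SN) => //; apply: nh_mulnS.
Qed.

(** Sum x^i z y^j x^(n+1-i) y^(n+1-j) over i and j. For fixed j the sum over i is a linearized
    power; for fixed i different from n+1 so is the sum over j. What remains is (n+2) x^(n+1) z
    y^(n+1). *)
Lemma nh_sandwich x y z : S x -> S y -> S z -> N (x ^+ n.+1 * z * y ^+ n.+1).
Proof.
move=> Sx Sy Sz.
have Szy j : S (z * y ^+ j) by case: j => [|j]; rewrite ?expr0 ?mulr1 //; apply: (nhSM SN) => //; apply: nh_exp.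
have Sxz i : S (x ^+ i * z) by case: i => [|i]; rewrite ?expr0 ?mul1r //; apply: (nhSM SN) => //; apply: nh_exp.
have h1 : N (\sum_(j < n.+2) (\sum_(i < n.+2) x ^+ i * (z * y ^+ j) * x ^+ (n.+1 - i)) * y ^+ (n.+1 - j)).
  apply: nh_sumN => j _; have hl := nh_linear Sx (Szy j).
  case: (n.+1 - j)%N => [|r]; first by rewrite expr0 mulr1.
  by apply: (nhMR SN) => //; apply: nh_exp.
have e1 : \sum_(j < n.+2) (\sum_(i < n.+2) x ^+ i * (z * y ^+ j) * x ^+ (n.+1 - i)) * y ^+ (n.+1 - j) =
    \sum_(i < n.+2) x ^+ i * z * (\sum_(j < n.+2) y ^+ j * x ^+ (n.+1 - i) * y ^+ (n.+1 - j)).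
  under eq_bigr do rewrite mulr_suml.
  rewrite exchange_big /=; apply: eq_bigr => i _; rewrite mulr_sumr.
  by apply: eq_bigr => j _; rewrite !mulrA.
move: h1; rewrite e1 big_ord_recr /= => h1.
have h2 : N (\sum_(i < n.+1) x ^+ i * z * (\sum_(j < n.+2) y ^+ j * x ^+ (n.+1 - i) * y ^+ (n.+1 - j))).
  apply: nh_sumN => i _; apply: (nhML SN) => //; apply: nh_linear => //.
  by have := ltn_ord i; rewrite ltnS => hi; rewrite subSn //; apply: nh_exp.
have := nhND SN h1 (nhNN SN h2); rewrite [X in X - _]addrC addrK subnn.
under eq_bigr => j _.
  rewrite expr0 mulr1 -exprD subnKC; last by rewrite -ltnS.
  over.
rewrite sumr_const card_ord mulrnAr; apply: (nhdiv SN).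
by apply: (nhSM SN) => //; apply: nh_exp.
Qed.
End Theory.

(* The ideal generated by [N] and the powers [x ^+ n.+1], closed under division
   by positive integers. *)
Inductive nh_clos S N n : A -> Prop :=
| nh_clos_base x : N x -> nh_clos S N n x
| nh_clos_gen a x b : (a = 1 \/ S a) -> S x -> (b = 1 \/ S b) ->
    nh_clos S N n (a * x ^+ n.+1 * b)
| nh_clos_add x y : nh_clos S N n x -> nh_clos S N n y -> nh_clos S N n (x + y)
| nh_clos_opp x : nh_clos S N n x -> nh_clos S N n (- x)
| nh_clos_div m x : S x -> nh_clos S N n (x *+ m.+1) -> nh_clos S N n x.

(** Let N' be the larger ideal [nh_clos]. By induction products of r = 2^(n+1) - 1 factors lie in
    N', and [nh_sandwich] gives N' S N' inside N; hence 2 r + 1 factors suffice for the next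
    exponent, which is where the power of two comes from. *)
Lemma nagata_higman n S N : nh_ideal S N -> (forall x, S x -> N (x ^+ n.+1)) ->
  forall t : seq A, size t = (2 ^ n.+1 - 1)%N -> (forall x, x \in t -> S x) ->
  N (\prod_(x <- t) x).
Proof.
elim: n S N => [|n IH] S N SN nil t st ht.
  case: t st ht => [|x [|y t]] // _ ht; rewrite big_seq1 -[x]expr1.
  by apply: nil; apply: ht; rewrite inE.
pose N' := nh_clos S N n.
have one x y : (x = 1 \/ S x) -> S y -> S (x * y) /\ S (y * x).
  by move=> [->|Sx] Sy; rewrite ?mul1r ?mulr1 //; split; apply: (nhSM SN).
have N'S x : N' x -> S x.
  elim=> {x} [x /(nhNS SN)//|a x b ha Sx hb|x y _ Sx _ Sy|x _ Sx|m x Sx _ _] //.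
  - have [h1 _] := one _ _ ha (nh_exp SN n Sx).
    by have [] := one _ _ hb h1.
  - exact: (nhSD SN).
  exact: (nhSN SN).
have SN' : nh_ideal S N'.
  split=> //.
  - exact: (nhS0 SN).
  - exact: (nhSD SN).
  - exact: (nhSM SN).
  - exact: nh_clos_add.
  - exact: (nhSN SN).
  - exact: nh_clos_opp.
  - exact/nh_clos_base/(nhN0 SN).
  - move=> x y Sx; elim=> {y} [y Ny|a y b ha Sy hb|y z _ h1 _ h2|y _ h|m y Sy _ h].
    + by apply: nh_clos_base; apply: (nhML SN).
    + by rewrite !mulrA; apply: nh_clos_gen => //; right; have [] := one _ _ ha Sx.
    + by rewrite mulrDr; apply: nh_clos_add.
    + by rewrite mulrN; apply: nh_clos_opp.
    by apply: (nh_clos_div (m := m)); rewrite -?mulrnAr //; apply: (nhSM SN).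
  - move=> x y + Sy; elim=> {x} [x Nx|a x b ha Sx hb|x z _ h1 _ h2|x _ h|m x Sx _ h].
    + by apply: nh_clos_base; apply: (nhMR SN).
    + by rewrite -mulrA; apply: nh_clos_gen => //; right; have [] := one _ _ hb Sy.
    + by rewrite mulrDl; apply: nh_clos_add.
    + by rewrite mulNr; apply: nh_clos_opp.
    by apply: (nh_clos_div (m := m)); rewrite -?mulrnAl //; apply: (nhSM SN).
  exact: nh_clos_div.
have sand x z y : N' x -> S z -> N' y -> N (x * z * y).
  move=> + Sz N'y; have Sy := N'S _ N'y.
  elim=> {x} [x Nx|a x b ha Sx hb|x1 x2 _ h1 _ h2|x _ h|m x Sx _ h].
  - by apply: (nhMR SN) => //; apply: (nhMR SN).
  - have [_ Sbz] := one _ _ hb Sz; have {}Sbz : S (b * z) by have [] := one _ _ hb Sz.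
    rewrite -(mulrA _ b) ; move: (b * z) Sbz => w Sw.
    suff h : N (x ^+ n.+1 * w * y).
      case: ha => [->|Sa]; first by rewrite mul1r.
      by rewrite -(mulrA a (x ^+ n.+1)) -(mulrA a); apply: (nhML SN).
    elim: N'y {Sy} => {y} [y Ny|a' y b' ha' Sy hb'|y1 y2 _ h1 _ h2|y _ h|m y Sy _ h].
    + by apply: (nhML SN) => //; apply: (nhSM SN) => //; apply: (nh_exp SN).
    + have Swa : S (w * a') by have [] := one _ _ ha' Sw.
      have hs : N (x ^+ n.+1 * (w * a') * y ^+ n.+1).
        exact: (nh_sandwich SN nil Sx Sy Swa).
      have -> : x ^+ n.+1 * w * (a' * y ^+ n.+1 * b') = x ^+ n.+1 * (w * a') * y ^+ n.+1 * b'.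
        by rewrite !mulrA.
      by case: hb' => [->|Sb]; [rewrite mulr1|apply: (nhMR SN)].
    + by rewrite mulrDr; apply: (nhND SN).
    + by rewrite mulrN; apply: (nhNN SN).
    apply: (nhdiv SN (m := m)); last by rewrite -mulrnAr.
    by apply: (nhSM SN) => //; apply: (nhSM SN) => //; apply: (nh_exp SN).
  - by rewrite !mulrDl; apply: (nhND SN).
  - by rewrite !mulNr; apply: (nhNN SN).
  apply: (nhdiv SN (m := m)); last by rewrite -!mulrnAl.
  by apply: (nhSM SN) => //; apply: (nhSM SN).
have nil' x : S x -> N' (x ^+ n.+1).
  by move=> Sx; rewrite -[_ ^+ _]mul1r -[X in N' X]mulr1; apply: nh_clos_gen; auto.
set r := (2 ^ n.+1 - 1)%N.
have r2 : (2 ^ n.+2 - 1 = r + 1 + r)%N.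
  have : (0 < 2 ^ n.+1)%N by rewrite expn_gt0.
  by rewrite /r [(2 ^ n.+2)%N]expnS; lia.
rewrite r2 in st.
have tE : t = take r t ++ nth 0 t r :: drop r.+1 t.
  by rewrite -drop_nth ?cat_take_drop // st; lia.
rewrite tE big_cat big_cons /= mulrA.
apply: sand.
- apply: (IH S N') => //; first by rewrite size_takel // st; lia.
  by move=> x /mem_take; apply: ht.
- by apply: ht; apply: mem_nth; rewrite st; lia.
apply: (IH S N') => //; first by rewrite size_drop st; lia.
by move=> x /mem_drop; apply: ht.
Qed.
End NagataHigman.
(** * Finiteness over a central subalgebra *)

Section CenterType.
Variable F : nzRingType.
(** Characteristic polynomials need a commutative ring type, while the central subalgebras are only
    sets; the full center of F serves as that type. *)
Definition center_pred : {pred F} := [pred x | `[< forall y, x * y = y * x >]].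
Fact center_subring : GRing.subring_closed center_pred.
Proof.
split=> [|x y /asboolP hx /asboolP hy|x y /asboolP hx /asboolP hy]; apply/asboolP=> z.
- by rewrite mul1r mulr1.
- by rewrite mulrBl mulrBr hx hy.
by rewrite -mulrA hy mulrA hx mulrA.
Qed.
HB.instance Definition _ := GRing.isSubringClosed.Build F center_pred center_subring.
Definition ring_center := {x : F | x \in center_pred}.
HB.instance Definition _ := [isSub for (@sval F _ : ring_center -> F)].
HB.instance Definition _ := [Choice of ring_center by <:].
HB.instance Definition _ := [SubChoice_isSubNzRing of ring_center by <:].
Fact ring_center_mulC : @commutative ring_center ring_center *%R.
Proof.
by move=> x y; apply: val_inj; rewrite !rmorphM /=; have /asboolP -> := valP x.
Qed.
HB.instance Definition _ := GRing.PzRing_hasCommutativeMul.Build ring_center ring_center_mulC.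
Definition center_val (x : ring_center) : F := val x.
Fact center_val_zmod : zmod_morphism center_val.
Proof. by move=> x y; apply: rmorphB. Qed.
Fact center_val_monoid : monoid_morphism center_val.
Proof. by split=> [|x y]; [apply: rmorph1|apply: rmorphM]. Qed.
HB.instance Definition _ := GRing.isZmodMorphism.Build _ _ center_val center_val_zmod.
HB.instance Definition _ := GRing.isMonoidMorphism.Build _ _ center_val center_val_monoid.
End CenterType.

Section PolyCayleyHamilton.
Variables (K : fieldType) (F : algType K) (U C Z : set F) (n : nat).
Variables (b : 'I_n.+1 -> F) (e : F -> 'M[F]_n.+1) (j0 : 'I_n.+1).
Hypotheses (Usub : is_subalg U) (Csub : is_subalg C) (Zsub : is_subalg Z).
Hypothesis Zc : forall z x, Z z -> z * x = x * z.
Hypothesis char0 : forall m, m.+1%:R != 0 :> K.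
Hypothesis eZ : forall x i j, U x -> Z (e x i j).
Hypothesis eE : forall x j, U x -> x * b j = \sum_i e x i j * b i.
Hypothesis bfree : forall a : 'I_n.+1 -> F, (forall i, Z (a i)) ->
  \sum_i a i * b i = 0 -> forall i, a i = 0.
Hypothesis eC : forall x, U x -> C (\tr (e x)).
Hypothesis b1 : b j0 = 1.
Local Notation zt := (ring_center F).
Local Notation phi := (map_poly (@center_val F : zt -> F)).

Let toz (x : F) : zt := insubd 0 x.
Lemma tozE x : Z x -> center_val (toz x) = x.
Proof.
move=> Zx; apply: (insubdK (sT := ring_center F)).
by apply/asboolP => y; apply: Zc.
Qed.

Lemma phi_central (q : {poly zt}) (Y : {poly F}) : phi q * Y = Y * phi q.
Proof.
apply/polyP => p; rewrite coefM coefMr; apply: eq_bigr => i _.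
rewrite coef_map; by have /asboolP := valP q`_i; apply.
Qed.

Variable X : {poly F}.
Hypothesis UX : forall p, U X`_p.

Lemma UXk k p : U (X ^+ k)`_p.
Proof.
elim: k p => [|k IH] p.
  by rewrite expr0 coef1; case: eqP => _; [exact: subalg1 Usub|exact: subalg0 Usub].
rewrite exprS coefM; apply: (subalg_sum Usub) => i _.
by apply: (subalgM Usub).
Qed.

Let A : 'M[{poly zt}]_n.+1 := \matrix_(i, j) \poly_(p < size X) toz (e X`_p i j).

Lemma AZ k i j p : Z (phi ((A ^+ k) i j))`_p.
Proof.
elim: k i j p => [|k IH] i j p.
  rewrite expr0 mxE; case: eqP => _; rewrite ?rmorph1 ?rmorph0 ?coef1 ?coef0.
    by case: eqP => _; [exact: subalg1 Zsub|exact: subalg0 Zsub].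
  exact: subalg0 Zsub.
rewrite exprS mxE rmorph_sum coef_sum; apply: (subalg_sum Zsub) => h _.
rewrite rmorphM coefM; apply: (subalg_sum Zsub) => q _; apply: (subalgM Zsub); last exact: IH.
rewrite coef_map mxE coef_poly; case: ifP => _; last exact: subalg0 Zsub.
by have h1 := eZ i h (UX q); rewrite [X in Z X](tozE h1).
Qed.

Lemma A_act k j : X ^+ k * (b j)%:P = \sum_i phi ((A ^+ k) i j) * (b i)%:P.
Proof.
have act1 h : X * (b h)%:P = \sum_i phi (A i h) * (b i)%:P.
  apply/polyP => p; rewrite coefMC coef_sum eE //; apply: eq_bigr => i _.
  rewrite coefMC coef_map mxE coef_poly; case: ltnP => hp.
    by rewrite -[in LHS](tozE (eZ i h (UX p))).
  rewrite nth_default // raddf0 mul0r.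
  have e0 := eE h (subalg0 Usub); rewrite mul0r in e0.
  by rewrite (bfree _ (esym e0)) ?mul0r // => q; apply: eZ; exact: subalg0 Usub.
elim: k => [|k IH].
  rewrite !expr0 mul1r (bigD1 j) //= mxE eqxx rmorph1 mul1r big1 ?addr0 // => i ij.
  by rewrite mxE (negPf ij) rmorph0 mul0r.
rewrite exprS -mulrA IH mulr_sumr.
under eq_bigr do rewrite mulrA -phi_central -mulrA act1 mulr_sumr.
rewrite exchange_big; apply: eq_bigr => i _ /=.
rewrite exprS mxE rmorph_sum mulr_suml; apply: eq_bigr => h _.
by rewrite rmorphM mulrA phi_central.
Qed.

(** The p-th coefficient of the k-th power of A and the matrix of the p-th coefficient of X^k
    describe the same left multiplication on b; freeness identifies them, and [eC] puts the trace
    into C. *)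
Lemma A_trace k p : C (center_val (\tr (A ^+ k))`_p).
Proof.
suff h i : center_val ((A ^+ k) i i)`_p = e (X ^+ k)`_p i i.
  rewrite /mxtrace coef_sum rmorph_sum /=; under eq_bigr do rewrite h.
  exact: eC (UXk k p).
apply/eqP; rewrite -subr_eq0; apply/eqP.
apply: (bfree (a := fun j => center_val ((A ^+ k) j i)`_p - e (X ^+ k)`_p j i)) => [j|].
  by apply: (subalgB Zsub); [have := AZ k j i p; rewrite coef_map|apply: eZ; apply: UXk].
under eq_bigr do rewrite mulrBl; rewrite sumrB -eE; last exact: UXk.
have := congr1 (fun q : {poly F} => q`_p) (A_act k i).
rewrite /= coefMC => ->; rewrite coef_sum; apply/eqP; rewrite subr_eq0; apply/eqP.
by apply: eq_bigr => j _; rewrite coefMC coef_map.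
Qed.

(** The entries of the matrix lie in Z only, but Newton's identities put the coefficients over C.
    Applying the matrix identity to the basis vector 1 gives the equation for X. *)
Lemma poly_cayley_hamilton : exists chi : nat -> {poly F},
  (forall k p, C (chi k)`_p) /\
  X ^+ n.+1 = - \sum_(k < n.+1) chi k * X ^+ k.
Proof.
pose chi := char_poly A; exists (fun k => phi chi`_k); split=> [k p|].
  rewrite coef_map; apply: (char_poly_coef_trace (S := fun q : {poly zt} => forall p, C (center_val q`_p))) => {k p}.
  - by move=> p; rewrite coef0; exact: subalg0 Csub.
  - move=> p; rewrite coef1 rmorph_nat.
    by case: eqP => _; [exact: subalg1 Csub|exact: subalg0 Csub].
  - by move=> x y hx hy p; rewrite coefD rmorphD; exact: (subalgD Csub (hx p) (hy p)).
  - by move=> x hx p; rewrite coefN rmorphN; exact: (subalgN Csub (hx p)).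
  - move=> x y hx hy p; rewrite coefM rmorph_sum; apply: (subalg_sum Csub) => i _.
    by rewrite rmorphM; exact: (subalgM Csub (hx _) (hy _)).
  - move=> m x hx p; have := hx p; rewrite coefMn rmorphMn -scaler_nat.
    by move/(subalgZ Csub (m.+1%:R)^-1); rewrite scalerA mulVf // scale1r.
  move=> k p; have -> : iter k (mulmx A) 1%:M = A ^+ k.
    by elim: k => [|k IH] //=; rewrite IH exprS.
  exact: A_trace.
have h : \sum_(k < n.+2) phi chi`_k * X ^+ k = 0.
  have e0 : horner_mx A chi = \sum_(k < n.+2) chi`_k *: A ^+ k.
    rewrite -[X in horner_mx A X](coefK chi) size_char_poly poly_def rmorph_sum.
    apply: eq_bigr => k _; rewrite -mul_polyC rmorphM rmorphXn /= horner_mx_C horner_mx_X.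
    exact: mul_scalar_mx.
  rewrite Cayley_Hamilton in e0.
  have -> : \sum_(k < n.+2) phi chi`_k * X ^+ k = \sum_(k < n.+2) phi chi`_k * (X ^+ k * (b j0)%:P).
    by apply: eq_bigr => k _; rewrite b1 polyC1 mulr1.
  under eq_bigr do rewrite A_act mulr_sumr.
  rewrite exchange_big big1 // => i _ /=.
  under eq_bigr do rewrite mulrA -rmorphM.
  rewrite -mulr_suml -rmorph_sum.
  have e2 : \sum_(k < n.+2) chi`_k * (A ^+ k) i j0 = 0.
    have /matrixP/(_ i j0) := e0; rewrite mxE summxE => e1; rewrite [RHS]e1.
    by apply: eq_bigr => k _; rewrite mxE.
  by rewrite e2 raddf0 mul0r.
move: h; rewrite big_ord_recr /= addrC => /eqP; rewrite addr_eq0 => /eqP <-.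
have /monicP := char_poly_monic A; rewrite /lead_coef size_char_poly /= -/chi => ->.
by rewrite rmorph1 mul1r.
Qed.
End PolyCayleyHamilton.

(** * Finite generation from the filtration by word length *)

Section FiniteModule.
Variables (K : fieldType) (F : algType K) (U C : set F) (n : nat) (s : seq F).
Hypotheses (Csub : is_subalg C) (CU : C `<=` U).
Hypothesis Cc : forall c x, C c -> c * x = x * c.
Hypothesis char0 : forall m, m.+1%:R != 0 :> K.
Hypothesis hCH : forall X : {poly F}, (forall p, U X`_p) -> exists chi : nat -> {poly F},
  (forall k p, C (chi k)`_p) /\ X ^+ n.+1 = - \sum_(k < n.+1) chi k * X ^+ k.
Hypothesis Ugen : U = alg_gen [set x | x \in s].

(** Words of length at most p; earlier lists are kept, so that the filtration increases by
    construction. *)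
Fixpoint words p : seq F :=
  if p is p'.+1 then words p' ++ [seq g * w | g <- s, w <- words p'] else [:: 1].
Lemma wordsS p : words p.+1 = words p ++ [seq g * w | g <- s, w <- words p].
Proof. by []. Qed.
Let V p : F -> Prop := tspan C id [pred w | w \in words p].

Lemma words_leq p q : (p <= q)%N -> {subset words p <= words q}.
Proof.
move=> /subnKC <-; elim: (q - p)%N => [|r IH] x; first by rewrite addn0.
by move=> /IH; rewrite addnS wordsS mem_cat => ->.
Qed.

Lemma words_mul p q x y : x \in words p -> y \in words q -> x * y \in words (p + q).
Proof.
elim: p x => [|p IH] x; first by rewrite inE => /eqP ->; rewrite mul1r.
rewrite addSn !wordsS !mem_cat => /orP[/IH h /h ->//|]. move=> /flatten_mapP[g gs /mapP[w ww ->]] hy.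
rewrite -mulrA; apply/orP; right; apply/flatten_mapP.
by exists g => //; apply: map_f; apply: IH.
Qed.

Lemma V_leq p q x : (p <= q)%N -> V p x -> V q x.
Proof. by move=> pq; apply: tspanS; apply: words_leq. Qed.

Lemma V_mul p q x y : V p x -> V q y -> V (p + q) (x * y).
Proof.
move=> + Vy; elim/(tspan_ind (C0 := C)): x / => [|x1 x2 h1 h2|c w hc hw].
- by rewrite mul0r; apply: tspan0.
- by rewrite mulrDl; apply: tspanD.
rewrite -mulrA; apply: tspanC => //.
elim/(tspan_ind (C0 := C)): y / Vy => [|y1 y2 h1 h2|a z ha hz].
- by rewrite mulr0; apply: tspan0.
- by rewrite mulrDr; apply: tspanD.
rewrite mulrA -(Cc w ha) -mulrA; apply: tspan_gen => //.
exact: words_mul.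
Qed.

Lemma Usub : is_subalg U. Proof. by rewrite Ugen; apply: alg_gen_subalg. Qed.

Lemma V1 : V 0 1.
Proof. by apply: (tspanM1 Csub id)  => //; rewrite !inE. Qed.

Lemma V_gen g : g \in s -> V 1 g.
Proof.
move=> gs; apply: (tspanM1 Csub id) => //; change (g \in words 1); rewrite wordsS mem_cat; apply/orP; right; apply/flatten_mapP; by exists g => //=; rewrite inE mulr1 eqxx.
Qed.

Lemma V_U p x : V p x -> U x.
Proof.
have wU q w : w \in words q -> U w.
  elim: q w => [|q IH] w; first by rewrite inE => /eqP ->; apply: (subalg1 Usub).
  rewrite wordsS mem_cat => /orP[/IH//|/flatten_mapP[g gs /mapP[w' /IH ww ->]]].
  by apply: (subalgM Usub) => //; rewrite Ugen; apply: alg_gen_incl.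
elim/(tspan_ind (C0 := C)) => [|x1 x2|c w hc hw].
- exact: (subalg0 Usub).
- exact: (subalgD Usub).
by apply: (subalgM Usub); [exact: CU|exact: wU hw].
Qed.

(* The Rees algebra of the filtration [V], and its ideal defining the associated
   graded algebra. *)
Let S (f : {poly F}) : Prop := f`_0 = 0 /\ forall p, V p f`_p.
Let N (f : {poly F}) : Prop := f`_0 = 0 /\ forall p, V p f`_p.+1.

Lemma rees_ideal : nh_ideal S N.
Proof.
have V0 p : V p 0 by exact: tspan0.
have VD p x y : V p x -> V p y -> V p (x + y) by exact: tspanD.
have VN p x : V p x -> V p (- x) by exact: tspanN.
have Vsum p (I : Type) (t : seq I) (P : pred I) (g : I -> F) :
    (forall i, P i -> V p (g i)) -> V p (\sum_(i <- t | P i) g i).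
  by move=> h; elim/big_ind: _ => // i; apply: VD.
have NS f : N f -> S f.
  move=> [f0 hf]; split=> // -[|p]; first by rewrite f0.
  exact: V_leq (hf p).
have c0 (f g : {poly F}) : f`_0 = 0 -> (f * g)`_0 = 0.
  by move=> f0; rewrite coefM big_ord1 f0 mul0r.
split=> //.
- by split=> [|p]; rewrite coef0.
- move=> f g [f0 hf] [g0 hg]; split=> [|p]; rewrite coefD ?f0 ?g0 ?addr0 //.
  exact: VD.
- move=> f g [f0 hf] [g0 hg]; split=> [|p]; first exact: c0.
  rewrite coefM; apply: Vsum => i _; have ip : (i <= p)%N by rewrite -ltnS.
  by rewrite -[p in V p _](subnKC ip); apply: V_mul.
- move=> f g [f0 hf] [g0 hg]; split=> [|p]; rewrite coefD ?f0 ?g0 ?addr0 //.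
  exact: VD.
- move=> f [f0 hf]; split=> [|p]; rewrite coefN ?f0 ?oppr0 //; exact: VN.
- move=> f [f0 hf]; split=> [|p]; rewrite coefN ?f0 ?oppr0 //; exact: VN.
- by split=> [|p]; rewrite coef0.
- move=> f g [f0 hf] [g0 hg]; split=> [|p]; first exact: c0.
  rewrite coefM; apply: Vsum => i _; have ip : (i <= p.+1)%N by rewrite -ltnS.
  move: ip; rewrite leq_eqVlt => /orP[/eqP ->|ip]; first by rewrite subnn g0 mulr0.
  rewrite ltnS in ip; rewrite subSn // -[p in V p _](subnKC ip); exact: V_mul.
- move=> f g [f0 hf] [g0 hg]; split=> [|p]; first exact: c0.
  rewrite coefM; apply: Vsum => -[[|i] ip] _ /=; first by rewrite f0 mul0r.
  rewrite !ltnS in ip; rewrite subSS -[p in V p _](subnKC ip); exact: V_mul.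
move=> m f [f0 _] [_ hf]; split=> // p; have := hf p.
rewrite coefMn -scaler_nat => /(tspanZ Csub (m.+1%:R)^-1).
by rewrite scalerA mulVf // scale1r.
Qed.

(** Write f = g T with T the indeterminate. In the equation for g multiplied by T^(n+1), the
    coefficient of f^k is chi_k T^(n+1-k): coefficients in C cost no word length, while the factor T
    gains at least one degree. *)
Lemma rees_nil f : S f -> N (f ^+ n.+1).
Proof.
move=> [f0 hf]; pose g := drop_poly 1 f.
have fE : f = g * 'X.
  by rewrite -[LHS](poly_take_drop 1) expr1 [take_poly _ _](_ : _ = 0) ?add0r //;
     apply/polyP => p; rewrite coef_take_poly coef0; case: p => //.
have [chi [hC e]] := hCH (X := g) (fun p => ltac:(rewrite coef_drop_poly; exact: V_U (hf _))).
have Sk k p : V p (f ^+ k)`_p.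
  case: k => [|k]; last by have [_] := nh_exp rees_ideal k (conj f0 hf); apply.
  by rewrite expr0 coef1; case: eqP => [->|_]; [exact: V1|exact: tspan0].
have gX k : f ^+ k = g ^+ k * 'X^k by rewrite fE exprMn_comm //; exact: commr_polyX.
have eN : f ^+ n.+1 = - \sum_(k < n.+1) (chi k * f ^+ k) * 'X^(n.+1 - k).
  rewrite gX e mulNr mulr_suml; congr (- _); apply: eq_bigr => k _.
  rewrite gX -!mulrA -exprD subnKC //; exact: ltnW.
split=> [|p]; first by rewrite exprS coefM big_ord1 f0 mul0r.
rewrite eN coefN; apply: tspanN => //; rewrite coef_sum; apply: tspan_sum => k _.
rewrite coefMXn; case: ltnP => hp; first exact: tspan0.
rewrite coefM; apply: tspan_sum => i _; apply: tspanC => //.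
apply: V_leq (Sk _ _); have := ltn_ord k; lia.
Qed.

Lemma finite_module : fg_module C U.
Proof.
pose m := (2 ^ n.+1 - 1)%N.
have m0 : (0 < m)%N.
  have : (2 ^ 1 <= 2 ^ n.+1)%N by rewrite leq_exp2l.
  by rewrite /m; lia.
(* Each letter is marked with the indeterminate; the coefficient of degree m of an element of N lies
   one step lower in the filtration. *)
have wm w : size w = m -> (forall g, g \in w -> g \in s) -> V m.-1 (\prod_(g <- w) g).
  move=> sw ws.
  have := @nagata_higman {poly F} n S N rees_ideal rees_nil [seq g *: 'X | g <- w].
  rewrite size_map => /(_ sw) h.
  have [|_ /(_ m.-1)] := h.
    move=> f /mapP[g /ws gs ->]; split=> [|[|[|p]]]; rewrite coefZ coefX ?mulr0 ?mulr1 //.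
    - exact: tspan0.
    - exact: V_gen.
    exact: tspan0.
  have -> : \prod_(f <- [seq g *: 'X | g <- w]) f = (\prod_(g <- w) g) *: 'X^m.
    rewrite -sw; elim: (w) => [|g w' IH]; first by rewrite !big_nil expr0 scale1r.
    rewrite /= !big_cons IH exprS -!mul_polyC polyCM -!mulrA; congr (_ * _).
    by rewrite !mulrA -commr_polyX.
  by rewrite coefZ coefXn prednK // eqxx mulr1.
have wprod p w : w \in words p -> exists t, [/\ (size t <= p)%N, forall g, g \in t -> g \in s & w = \prod_(g <- t) g].
  elim: p w => [|p IH] w; first by rewrite inE => /eqP ->; exists [::]; rewrite big_nil.
  rewrite wordsS mem_cat => /orP[/IH[t [h1 h2 h3]]|/flatten_mapP[g gs /mapP[w' /IH[t [h1 h2 h3]] ->]]].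
    by exists t; split=> //; apply: leqW.
  exists (g :: t); rewrite big_cons -h3; split=> // x; rewrite inE => /orP[/eqP ->//|].
  exact: h2.
have prodV t : (forall g, g \in t -> g \in s) -> V (size t) (\prod_(g <- t) g).
  elim: t => [|g t IH] h; first by rewrite big_nil; apply: V1.
  rewrite big_cons /=; apply: (@V_mul 1); first by apply/V_gen/h; rewrite inE eqxx.
  by apply: IH => x xt; apply: h; rewrite inE xt orbT.
(* The last m letters of a long word are replaced by combinations of at most m - 1 letters, so the
   length drops; r bounds it. *)
have red r t : (size t <= r)%N -> (forall g, g \in t -> g \in s) -> V m.-1 (\prod_(g <- t) g).
  elim: r t => [|r IH] t st ht.
    by apply: V_leq (prodV t ht); apply: leq_trans st _.
  case: (leqP (size t) m.-1) => tm; first exact: V_leq tm (prodV t ht).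
  rewrite -(cat_take_drop (size t - m) t) big_cat /=.
  have hd : V m.-1 (\prod_(g <- drop (size t - m) t) g).
    apply: wm => [|g /mem_drop /ht //]; rewrite size_drop subKn //.
    by rewrite -(prednK m0).
  have ht' : forall g, g \in take (size t - m) t -> g \in s by move=> g /mem_take /ht.
  have := V_mul (prodV _ ht') hd.
  have -> : (size (take (size t - m) t) + m.-1 = (size t).-1)%N.
    by rewrite size_takel ?leq_subr //; move: tm; rewrite -{1}(prednK m0); lia.
  elim/(tspan_ind (C0 := C)) => [|x y|c w hc /wprod[u [su us ->]]].
  - exact: tspan0.
  - exact: tspanD.
  apply: tspanC => //; apply: IH => //; apply: leq_trans su _.
  by move: st; case: (size t) tm.
have UV x : U x -> V m.-1 x.
  have VV p y : V p y -> V m.-1 y.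
    elim/(tspan_ind (C0 := C)) => [|y1 y2|c w hc /wprod[u [su us ->]]].
    - exact: tspan0.
    - exact: tspanD.
    by apply: tspanC => //; apply: (red (size u)).
  rewrite Ugen; move: x; apply: alg_gen_min => [|g /= gs]; last exact: VV (V_gen gs).
  apply/is_subalgP; split=> [|a x y hx hy|x y hx hy].
  - exact: VV V1.
  - by apply: tspanD => //; apply: tspanZ.
  exact: VV (V_mul hx hy).
pose W := words m.-1; exists (size W), (fun i => nth 0 W i); split=> [i|x /UV].
  by apply: (@V_U m.-1); apply: (tspanM1 Csub id) => //; apply: mem_nth.
elim/(tspan_ind (C0 := C)): x / => [|x y [a [ha ->]] [a' [ha' ->]]|c w hc hw].
- exists (fun=> 0); split=> [_|]; first exact: (subalg0 Csub).
  by rewrite big1 // => i _; rewrite mul0r.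
- exists (fun i => a i + a' i); split=> [i|]; first exact: (subalgD Csub).
  by rewrite -big_split; apply: eq_bigr => i _; rewrite mulrDl.
have iw : (index w W < size W)%N by rewrite index_mem.
exists (fun i => if i == Ordinal iw then c else 0); split=> [i|].
  by case: ifP => _ //; exact: (subalg0 Csub).
rewrite (bigD1 (Ordinal iw)) //= eqxx nth_index // big1 ?addr0 // => i /negPf ->.
by rewrite mul0r.
Qed.
End FiniteModule.

(** * Regular trace *)

Section RegularTrace.
Variables (K : fieldType) (A : algType K) (Cs Rs : set A).
Hypotheses (Csub : is_subalg Cs) (Ccomm : forall c x, Cs c -> c * x = x * c).

(* The two trace forms agree because tr (Q a P) = tr (a P Q) for the
   rectangular base changes P, Q between the bases; their sizes are not
   assumed to be equal. *)
Lemma free_basis_trace n (b : 'I_n -> A) (a : 'M[A]_n) m (b' : 'I_m -> A)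
    (a' : 'M[A]_m) x : free_basis Cs Rs b -> free_basis Cs Rs b' ->
  (forall i j, Cs (a i j)) -> (forall i j, Cs (a' i j)) ->
  (forall j, x * b j = \sum_i a i j * b i) ->
  (forall j, x * b' j = \sum_i a' i j * b' i) -> \tr a = \tr a'.
Proof.
move=> [Rb spb frb] [Rb' spb' frb'] ha ha' xb xb'.
have ex1 j : {p : 'I_n -> A | (forall i, Cs (p i)) /\ b' j = \sum_i p i * b i}.
  by apply: cid; apply: spb.
have ex2 j : {p : 'I_m -> A | (forall i, Cs (p i)) /\ b j = \sum_i p i * b' i}.
  by apply: cid; apply: spb'.
pose P r j := proj1_sig (ex1 j) r; pose Q i s := proj1_sig (ex2 s) i.
have P_C r j : Cs (P r j) by rewrite /P; case: (ex1 j) => p [].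
have Q_C i s : Cs (Q i s) by rewrite /Q; case: (ex2 s) => p [].
have bP j : b' j = \sum_r P r j * b r by rewrite /P; case: (ex1 j) => p [].
have bQ s : b s = \sum_i Q i s * b' i by rewrite /Q; case: (ex2 s) => p [].
have comb (I J : finType) (c : I -> A) (e : J -> I -> A) (g : J -> A) :
    \sum_i c i * (\sum_j e j i * g j) = \sum_j (\sum_i c i * e j i) * g j.
  under eq_bigr do rewrite mulr_sumr.
  by rewrite exchange_big /=; apply: eq_bigr => j _; rewrite mulr_suml;
     apply: eq_bigr => i _; rewrite mulrA.
have xc c z : Cs c -> x * (c * z) = c * (x * z).
  by move=> hc; rewrite !mulrA (Ccomm _ hc).
have PQ r s : \sum_j Q j r * P s j = (s == r)%:R.
  apply/eqP; rewrite -subr_eq0; apply/eqP.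
  apply: (frb (fun s => \sum_j Q j r * P s j - (s == r)%:R)) => [i|].
    apply: (subalgB Csub); first by apply: (subalg_sum Csub) => j _; apply: (subalgM Csub).
    by case: (i == r); [apply: (subalg1 Csub)|apply: (subalg0 Csub)].
  under eq_bigr do rewrite mulrBl.
  rewrite sumrB -comb; under eq_bigr do rewrite -bP.
  rewrite -bQ (bigD1 r) //= eqxx mul1r big1 ?addr0 ?subrr // => i /negPf ir.
  by rewrite ir mul0r.
have a'E i j : a' i j = \sum_s (\sum_r P r j * a s r) * Q i s.
  apply/eqP; rewrite -subr_eq0; apply/eqP.
  apply: (frb' (fun i => a' i j - \sum_s (\sum_r P r j * a s r) * Q i s)) => [i'|].
    apply: (subalgB Csub) => //; apply: (subalg_sum Csub) => s _.
    by apply: (subalgM Csub) => //; apply: (subalg_sum Csub) => r _; apply: (subalgM Csub).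
  under eq_bigr do rewrite mulrBl.
  rewrite sumrB -xb' -comb; under [X in _ - X]eq_bigr do rewrite -bQ.
  rewrite -comb; under [X in _ - X]eq_bigr do rewrite -xb.
  by rewrite bP mulr_sumr -sumrB big1 // => r _; rewrite xc // subrr.
rewrite /mxtrace; under [RHS]eq_bigr do rewrite a'E.
rewrite [RHS]exchange_big /=; apply: eq_bigr => s _.
under [RHS]eq_bigr do rewrite mulr_suml.
rewrite [RHS]exchange_big /= (bigD1 s) //= [X in X + _](_ : _ = a s s).
  rewrite [X in _ + X]big1 ?addr0 // => r rs.
  under eq_bigr do rewrite -mulrA (Ccomm _ (P_C _ _)) -mulrA.
  by rewrite -mulr_sumr PQ (negPf rs) mulr0.
under eq_bigr do rewrite -mulrA (Ccomm _ (P_C _ _)) -mulrA.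
by rewrite -mulr_sumr PQ eqxx mulr1.
Qed.

Lemma reg_traceE n (b : 'I_n -> A) (a : 'M[A]_n) x : free_basis Cs Rs b ->
  (forall i j, Cs (a i j)) -> (forall j, x * b j = \sum_i a i j * b i) ->
  reg_trace Cs Rs x = \tr a.
Proof.
move=> hb ha xb; rewrite /reg_trace; case: xgetP => [y _ [m [b' [a' [hb' ha' xb' ->]]]]|h].
  exact: (free_basis_trace hb' hb ha' ha xb' xb).
by case: (h (\tr a)); exists n, b, a.
Qed.
End RegularTrace.

(** * Roots of unity *)

Section PrimitivePower.
Variables (K : fieldType) (l : nat) (z : K).
Hypotheses (zprim : l.-primitive_root z) (lodd : odd l).

(** Substitute -X in the factorization of X^l - 1. Oddness of l fixes the sign, and evaluation at 0
    determines the constant [c] collected from the linear factors. *)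
Lemma prod_add_prim_root :
  \prod_(0 <= i < l) (1 + z ^+ i *: 'X) = 1 + 'X^l :> {poly K}.
Proof.
have l0 := prim_order_gt0 zprim.
have z0 : z != 0.
  by apply/eqP => z0; move: (prim_expr_order zprim); rewrite z0 expr0n gtn_eqF // => /eqP; rewrite eq_sym oner_eq0.
have zVprim : l.-primitive_root z^-1.
  have -> : z^-1 = z ^+ l.-1.
    by apply: (mulfI z0); rewrite mulfV // -exprS prednK // prim_expr_order.
  by rewrite prim_root_exp_coprime // coprime_sym coprimenP.
have := congr1 (fun p => p \Po - 'X) (factor_Xn_sub_1 zVprim).
rewrite /= rmorphB rmorph1 rmorphXn /= comp_polyX rmorph_prod /=.
rewrite exprNn -signr_odd lodd expr1 mulN1r -opprD addrC.
set c := \prod_(0 <= i < l) (- (z^-1 ^+ i)).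
have eP n : \prod_(0 <= i < n) (('X - ((z^-1 ^+ i)%:P)) \Po - 'X) =
    (\prod_(0 <= i < n) (- (z^-1 ^+ i))) *: \prod_(0 <= i < n) (1 + z ^+ i *: 'X).
  elim: n => [|n IH]; first by rewrite !big_nil scale1r.
  rewrite !big_nat_recr //= IH -scalerAl -scalerA; congr (_ *: _).
  rewrite scalerAr; congr (_ * _); rewrite rmorphB /= comp_polyX comp_polyC.
  rewrite exprVn scalerDr scalerA mulNr mulVf ?expf_neq0 // scaleN1r.
  by rewrite alg_polyC polyCN addrC.
rewrite eP -/c => e1.
have c1 : c = -1.
  have := congr1 (horner^~ 0) e1; rewrite /= !hornerE expr0n gtn_eqF // addr0.
  rewrite horner_prod big1 ?mulr1 // => i _.
  by rewrite !hornerE ?mulr0 ?addr0.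
by move: e1; rewrite c1 scaleN1r => /oppr_inj.
Qed.

(** Moving all factors a to the left leaves the product of the factors 1 + z^i u, evaluated by the
    preceding identity; this is the vanishing of the middle quantum binomial coefficients. *)
Lemma prim_power_add (A : algType K) (a u : A) : u * a = z *: (a * u) ->
  (a * (1 + u)) ^+ l = a ^+ l * (1 + u ^+ l).
Proof.
move=> ua; pose P n := \prod_(0 <= i < n) (1 + z ^+ i *: u).
have uX n : u * a ^+ n = z ^+ n *: (a ^+ n * u).
  elim: n => [|n IH]; first by rewrite !expr0 mulr1 mul1r scale1r.
  by rewrite [a ^+ n.+1]exprS mulrA ua -scalerAl -(mulrA a u) IH -scalerAr scalerA mulrA -!exprS.
have Pc n c : (1 + c *: u) * P n = P n * (1 + c *: u).
  rewrite /P; elim: n => [|n IH]; first by rewrite big_nil mulr1 mul1r.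
  rewrite big_nat_recr //= mulrA IH -!mulrA; congr (_ * _).
  rewrite !mulrDl !mulrDr !mul1r !mulr1 -!scalerAl -!scalerAr !scalerA [c * _]mulrC.
  by rewrite addrACA.
have aP n : (a * (1 + u)) ^+ n = a ^+ n * P n.
  elim: n => [|n IH]; first by rewrite !expr0 /P big_nil mulr1.
  rewrite exprS IH /P big_nat_recr //= -/(P n) -Pc exprS -!mulrA; congr (_ * _).
  by rewrite !mulrA; congr (_ * _); rewrite mulrDl mul1r uX mulrDr mulr1 -scalerAr.
rewrite aP; congr (_ * _).
have := congr1 (horner_alg u) prod_add_prim_root.
rewrite rmorph_prod rmorphD rmorph1 rmorphXn /= horner_algX => <-.
apply: eq_bigr => i _.
by rewrite rmorphD rmorph1 -mul_polyC rmorphM /= horner_algC horner_algX mulr_algl.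
Qed.
End PrimitivePower.

Section RootOfUnity.
#[local] Set Default Proof Using "All".
Variables (K : fieldType) (F : unitAlgType K) (l : nat) (eps : K) (N : nat).
Variables (ex : {set 'I_N}) (d : dir ex -> nat).
Hypotheses (eprim : l.-primitive_root eps) (lodd : odd l).
Hypothesis (dcop : forall k, coprime l (d k)).
Hypothesis (Fdiv : forall x : F, x != 0 -> x \is a GRing.unit).
Local Notation v := (eps%:A : F).
Local Notation C0 := (lcoef v).

Lemma eps_neq0 : eps != 0.
Proof using eprim.
apply/eqP => z0; move: (prim_expr_order eprim).
by rewrite z0 expr0n gtn_eqF ?(prim_order_gt0 eprim) // => /eqP; rewrite eq_sym oner_eq0.
Qed.
Lemma epsA_central x : v * x = x * v.
Proof using. by rewrite mulr_algl mulr_algr. Qed.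
Lemma epsA_unit : v \is a GRing.unit.
Proof using eprim. by rewrite scaler_unit ?unitr1 // unitfE eps_neq0. Qed.
Lemma epsA_base : coef_base v C0.
Proof using eprim. exact: (lcoef_base epsA_central epsA_unit). Qed.
Local Notation H := epsA_base.
#[local] Hint Extern 0 (is_subalg C0) => exact: (cb_subalg H) : core.
#[local] Hint Extern 0 (C0 (v ^ _)) => exact: (cb_pow H) : core.

Lemma epsA_exp (z : int) : v ^ z = (eps ^ z)%:A.
Proof using eprim.
case: z => n; first by rewrite -!exprnP exprZn expr1n.
by rewrite NegzE -!exprnN exprZn expr1n invrZ ?unitfE ?expf_neq0 ?eps_neq0 ?unitr1 // invr1.
Qed.
Lemma epsA_dvd (z : int) : (l %| z)%Z -> v ^ z = 1.
Proof using eprim.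
move=> /dvdzP[m ->]; rewrite epsA_exp mulrC -exprz_exp -exprnP.
by rewrite (prim_expr_order eprim) exp1rz scale1r.
Qed.

Definition lz : pred 'cV[int]_N := [pred f | [forall i, (l %| co i f)%Z]].
Lemma lzP f : reflect (exists g, f = l%:Z *: g) (lz f).
Proof using.
apply: (iffP forallP) => [h|[g ->] i]; last by rewrite coZ dvdz_mulr.
exists (\col_i (f i ord0 %/ l)%Z); apply/colP => i; rewrite !mxE mulrC divzK //.
exact: h.
Qed.
Lemma lz0 : lz 0.
Proof using. by apply/forallP => i; rewrite co0 dvdz0. Qed.
Lemma lzD f g : lz f -> lz g -> lz (f + g).
Proof using.
by move=> /forallP hf /forallP hg; apply/forallP => i; rewrite coD rpredD ?hf ?hg.
Qed.
Lemma lzDr f g : lz g -> lz (f + g) = lz f.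
Proof using.
move=> /forallP hg; apply/forallP/forallP => h i; have := h i; have := hg i; rewrite coD => h1.
  by rewrite rpredDr.
by rewrite rpredDr.
Qed.
Lemma lzN f : lz f -> lz (- f).
Proof using. by move=> /forallP hf; apply/forallP => i; rewrite coN rpredN; apply: hf. Qed.
Lemma lzZ g : lz (l%:Z *: g).
Proof using. by apply/lzP; exists g. Qed.
Lemma form_lzl (L : 'M[int]_N) f g : lz f -> (l %| form L f g)%Z.
Proof using. by move=> /lzP[h ->]; rewrite formZl dvdz_mulr. Qed.
Lemma form_lzr (L : 'M[int]_N) f g : lz g -> (l %| form L f g)%Z.
Proof using. by move=> /lzP[h ->]; rewrite formZr dvdz_mulr. Qed.

Definition central (x : F) := forall y, x * y = y * x.
Lemma centralM x y : central x -> central y -> central (x * y).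
Proof using. by move=> hx hy z; rewrite -mulrA hy mulrA hx mulrA. Qed.
Lemma centralD x y : central x -> central y -> central (x + y).
Proof using. by move=> hx hy z; rewrite mulrDl mulrDr hx hy. Qed.
Lemma central1 : central 1.
Proof using. by move=> z; rewrite mulr1 mul1r. Qed.
Lemma centralX x n : central x -> central (x ^+ n).
Proof using.
by move=> hx; elim: n => [|n IH]; rewrite ?expr0 ?exprS; [exact: central1|exact: centralM].
Qed.
Lemma centralV x : central x -> central x^-1.
Proof using. by move=> hx z; apply/esym/commrV/esym/hx. Qed.

Section Seed.
Variables (s : seed F ex) (gs : good v C0 d s).
Local Notation M := (frame s).
Local Notation L := (qform s).
Local Notation T := (tspan C0 M).
Local Notation frM := (good_frame gs).

Lemma lz_frameD f g : lz f || lz g -> M f * M g = M (f + g).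
Proof using eprim gs.
move=> fg; rewrite (qframeM frM) epsA_dvd ?mul1r //.
by case/orP: fg => h; [apply: form_lzl|apply: form_lzr].
Qed.

(** The quotient u of the two exchange monomials commutes with the first up to eps^(2 d_k). This is
    a primitive l-th root of unity because l is odd and coprime to d_k. *)
Lemma exch_powl k : exch s k ^+ l =
  M (l%:Z *: exch_exp (exmat s) k true) + M (l%:Z *: exch_exp (exmat s) k false).
Proof.
set a := exch_exp _ _ true; set c := exch_exp _ _ false.
have sk := good_skew gs.
have fca : form L c a = (d k)%:Z.
  have -> : a = bcol (exmat s) k + c by rewrite -(exch_exp_sub H Fdiv gs k) subrK.
  rewrite formDr (form_alt c sk) addr0 (form_skew _ _ sk) (good_compat gs).
  by rewrite (co_exch_exp H Fdiv gs); ring.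
pose u := M (- a) * M c.
have xE : exch s k = M a * (1 + u).
  by rewrite /u mulrDr mulr1 mulrA (qframe_mulN H sk frM) mul1r.
have ua : u * M a = (eps ^+ (2 * d k)) *: (M a * u).
  rewrite /u -mulrA (qframeC H sk frM c) fca epsA_exp mulr_algl -scalerAr.
  rewrite (mulrA (M (- a)) (M a)) (qframe_Nmul H sk frM a) mul1r.
  rewrite (mulrA (M a) (M (- a))) (qframe_mulN H sk frM a) mul1r.
  by congr (_ *: _); rewrite exprnP; congr (_ ^ _); lia.
have zprim : l.-primitive_root (eps ^+ (2 * d k)).
  by rewrite prim_root_exp_coprime // coprimeMl coprime2n lodd coprime_sym dcop.
rewrite xE (prim_power_add zprim lodd ua) mulrDr mulr1 (qframeX H sk frM) -scaler_nat natz.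
congr (_ + _).
have uE : u = v ^ form L (- a) c * M (- a + c) by rewrite /u (qframeM frM).
have -> : u ^+ l = M (l%:Z *: (- a + c)).
  rewrite uE exprMn_comm; last by apply: (vzC H).
  rewrite [X in X * _](_ : _ = 1) ?mul1r.
    by rewrite (qframeX H sk frM) -scaler_nat natz.
  by rewrite exprnP exprz_exp epsA_dvd // dvdz_mull.
by rewrite lz_frameD ?lzZ // -scalerDr addrA subrr add0r.
Qed.
End Seed.

Section Orbit.
Variables (s0 : seed F ex) (gs0 : good v C0 d s0).
Hypothesis frac0 : forall x, exists a b, [/\ tspan C0 (frame s0) predT a,
  tspan C0 (frame s0) predT b, b != 0 & x = a / b].
Local Notation sp p := (muts v p s0).
Local Notation T s := (tspan C0 (frame s)).
Let gp p : good v C0 d (sp p) := muts_good H Fdiv p gs0.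

(** In the initial torus all powers of v involved are 1, and centrality extends to its fractions. A
    mutation preserves it, since the l-th power of the exchange element is a sum of two such
    monomials. *)
Lemma lz_central p f : lz f -> central (frame (sp p) f).
Proof.
elim/last_ind: p f => [|p k IH] f hf.
  have cT x : T s0 predT x -> frame s0 f * x = x * frame s0 f.
    elim/tspan_ind => [|x1 x2 e1 e2|c g hc _].
    - by rewrite mulr0 mul0r.
    - by rewrite mulrDr mulrDl e1 e2.
    rewrite mulrA -(cb_comm H _ hc) -!mulrA !(lz_frameD gs0) ?hf ?orbT //.
    by rewrite addrC.
  move=> x; have [a [b [Ta Tb b0 ->]]] := frac0 x.
  by rewrite mulrA (cT a Ta) -mulrA -[RHS]mulrA; congr (a * _); apply/commrV/cT.
rewrite muts_rcons [frame _ f]/(mutframe v k (sp p) f) /mutframe.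
have /lzP[g gE] := hf.
have lk : lz (co (val k) f *: e_ (val k)).
  by apply/lzP; exists (co (val k) g *: e_ (val k)); rewrite gE coZ scalerA.
have lr : lz (rem k f) by rewrite /rem; apply: lzD => //; apply: lzN.
have cv z : central (v ^ z) by move=> y; apply: (vzC H).
apply: centralM => //; apply: centralM; first exact: IH.
have cx : central (exch (sp p) k ^+ l).
  by rewrite (exch_powl (gp p)); apply: centralD; apply: IH; apply: lzZ.
rewrite gE coZ -exprz_exp -exprnP; case: (co (val k) g) => n.
  by rewrite -exprnP; apply: centralX.
by rewrite NegzE -exprnN; apply/centralV/centralX.
Qed.

Lemma proj_mulr p (P Q : pred 'cV[int]_N) x y : (forall f g, Q g -> P (f + g) = P f) ->
  T (sp p) predT x -> T (sp p) Q y ->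
  proj C0 (frame (sp p)) P (x * y) = proj C0 (frame (sp p)) P x * y.
Proof.
move=> PQ Tx Qy; have fM := good_free (gp p); have Ty := tspanT Qy.
suff: T (sp p) predT x -> T (sp p) predT x /\
    proj C0 (frame (sp p)) P (x * y) = proj C0 (frame (sp p)) P x * y.
  by move=> h; have [] := h Tx.
clear Tx; elim/tspan_ind: x / => [|x1 x2 [T1 e1] [T2 e2]|c f hc _].
- by rewrite mul0r proj0 // mul0r; split; first exact: tspan0.
- split; first exact: tspanD.
  rewrite mulrDl !projD ?e1 ?e2 ?mulrDl //; exact: (seedMT H Fdiv (gp p)).
split; first exact: tspan_gen.
have hM : T (sp p) [pred g | P g == P f] (c * frame (sp p) f * y).
  have hf : T (sp p) (pred1 f) (c * frame (sp p) f) by apply: tspan_gen => //=.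
  by apply: (seedM H Fdiv (gp p) _ hf Qy) => a b /eqP -> hb /=; rewrite PQ.
rewrite [proj _ _ _ (c * frame _ f)]proj_gen //; case: (boolP (P f)) => Pf.
  by rewrite proj_id //; apply: tspanS hM => g /eqP gE; rewrite -topredE /= gE.
rewrite mul0r (proj_eq0 _ _ hM) // => g /eqP gE; by rewrite gE.
Qed.

Lemma lz_exchX p k n : T (sp p) lz (exch (sp p) k ^+ (l * n)).
Proof.
rewrite exprM; apply: (seedX H Fdiv (gp p) _ lz0 lzD).
by rewrite (exch_powl (gp p)); apply: tspanD; apply: tspanM1 => //; apply: lzZ.
Qed.

(** Consider a monomial with exponent m at k. If l divides m, the power of the exchange element is
    supported on l Z^N and membership of the exponent in l Z^N is preserved; otherwise the
    e_k-degree -m excludes l Z^N on both sides. *)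
Lemma proj_lz_poly p k y :
  T (mut v k (sp p)) [pred f | 0 <= co (val k) f] y ->
  proj C0 (frame (sp p)) lz y = proj C0 (frame (mut v k (sp p))) lz y.
Proof.
have g1 := mut_good H Fdiv (gp p) k; set s := sp p; set s1 := mut v k s in g1 *.
have f1 := good_free g1; have f0 := good_free (gp p).
suff: T s1 [pred f | 0 <= co (val k) f] y -> [/\ T s1 predT y, T s predT y &
    proj C0 (frame s) lz y = proj C0 (frame s1) lz y].
  by move=> h /h[].
elim/tspan_ind: y / => [|y1 y2 [T1a Ta e1] [T1b Tb e2]|c f hc hf].
- by rewrite !proj0 //; split=> //; exact: tspan0.
- by rewrite !projD // e1 e2; split=> //; exact: tspanD.
have {}hf : 0 <= co (val k) f := hf.
have [m mE] : exists m : nat, co (val k) f = m%:Z by exists (absz (co (val k) f)); lia.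
have hP (P : pred 'cV[int]_N) : T s P (frame s (rem k f) * exch s k ^+ m) ->
    T s P (c * frame s1 f).
  move=> h; apply: tspanC => //; rewrite [frame s1 f]/(mutframe v k s f) /mutframe mE -exprnP.
  exact: tspanC.
have hr (P : pred 'cV[int]_N) : P (rem k f) -> T s P (frame s (rem k f)) by move=> ?; apply: tspanM1.
have hx := exchX_gr H Fdiv (gp p) k m.
have hgr : T s (gr (co (val k)) (- m%:Z)) (c * frame s1 f).
  apply: hP; apply: (seedMgr H Fdiv (gp p) (degree_co (val k)) (esym (add0r _))).
    by apply: hr; rewrite /gr inE co_rem.
  exact: hx.
split; [exact: tspan_gen|exact: tspanT hgr|].
rewrite [RHS]proj_gen //.
have lzk : (l %| m)%N -> lz (rem k f) = lz f.
  move=> lm; rewrite /rem lzDr // -scaleNr mE; apply/lzP.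
  exists ((- (m %/ l)%N%:Z) *: e_ (val k)).
  by rewrite scalerA mulrN -PoszM mulnC divnK.
case: (boolP (lz f)) => lf.
  have lm : (l %| m)%N by move/forallP: lf => /(_ (val k)); rewrite mE.
  rewrite proj_id //; apply: hP.
  have := lz_exchX p k (m %/ l); rewrite mulnC divnK // => hxl.
  by apply: (seedM H Fdiv (gp p) lzD (hr _ _) hxl); rewrite lzk.
case: (boolP (l %| m)%N) => lm.
  have := lz_exchX p k (m %/ l); rewrite mulnC divnK // => hxl.
  have hh : T s (predC lz) (c * frame s1 f).
    apply: hP; apply: (seedM H Fdiv (gp p) _ (hr (predC lz) _) hxl).
      by move=> a b /= ha hb; rewrite lzDr.
    by rewrite /= lzk.
  by rewrite (proj_eq0 _ _ hh).
rewrite (proj_eq0 _ _ hgr) // => g /eqP gE; apply/negP => /forallP /(_ (val k)).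
by rewrite gE rpredN => h; case/negP: lm.
Qed.

Lemma proj_lz_mut p k y : T (sp p) predT y -> T (mut v k (sp p)) predT y ->
  proj C0 (frame (sp p)) lz y = proj C0 (frame (mut v k (sp p))) lz y.
Proof.
move=> Ty T1y; have [n hn] := mut_clear H Fdiv (gp p) T1y.
have l0 : (0 < l)%N := prim_order_gt0 eprim.
have := proj_lz_poly (hn (l * n)%N _); rewrite leq_pmull // => /(_ isT).
have lzD' f g : lz g -> lz (f + g) = lz f by apply: lzDr.
rewrite (proj_mulr lzD' Ty (lz_exchX p k n)).
have hx : T (sp (rcons p k)) lz (exch (sp p) k ^+ (l * n)).
  rewrite muts_rcons -(mut_frame_k H Fdiv (gp p)); apply: tspanM1 => //.
  by apply/lzP; exists (n%:Z *: e_ (val k)); rewrite scalerA PoszM.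
rewrite -!muts_rcons in T1y *; rewrite (proj_mulr lzD' T1y hx).
by move/(mulIr (exchXU H Fdiv (gp p) k (l * n))).
Qed.

Definition upper_alg : set F := [set w | forall p, T (sp p) (frozen_nneg ex) w].
Definition upper_center : set F := [set w | forall p, T (sp p) (latt ex l) w].

Lemma proj_lz_all p w : upper_alg w ->
  proj C0 (frame s0) lz w = proj C0 (frame (sp p)) lz w.
Proof.
move=> hw; elim/last_ind: p => [|p k IH]; first by [].
rewrite muts_rcons -proj_lz_mut //; first exact: tspanT (hw p).
by rewrite -muts_rcons; apply: tspanT (hw (rcons p k)).
Qed.

(** In each seed the same element is also the projection in that torus, hence supported there on the
    divisible exponents of w. *)
Lemma proj_lz_center w : upper_alg w -> upper_center (proj C0 (frame s0) lz w).
Proof.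
move=> hw p; rewrite (proj_lz_all p hw).
apply: tspanS (seed_proj H Fdiv (gp p) lz (hw p)) => f /andP[h1 h2].
by apply/andP.
Qed.

Lemma upper_subalg : is_subalg upper_alg.
Proof.
have hS p := tspan_subalg H (good_skew (gp p)) (good_frame (gp p)) (@frozen_nneg0 _ ex) (@frozen_nnegD _ ex).
apply/is_subalgP; split=> [p|a x y hx hy p|x y hx hy p].
- exact: (subalg1 (hS p)).
- by apply: (subalgD (hS p)) => //; apply: (subalgZ (hS p)).
- by apply: (subalgM (hS p)).
Qed.
Lemma center_subalg : is_subalg upper_center.
Proof.
have hS p := tspan_subalg H (good_skew (gp p)) (good_frame (gp p)) (@latt0 _ ex l) (@lattD _ ex l).
apply/is_subalgP; split=> [p|a x y hx hy p|x y hx hy p].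
- exact: (subalg1 (hS p)).
- by apply: (subalgD (hS p)) => //; apply: (subalgZ (hS p)).
- by apply: (subalgM (hS p)).
Qed.

Lemma center_upper : upper_center `<=` upper_alg.
Proof. by move=> w hw p; apply: tspanS (hw p) => f /andP[]. Qed.

Lemma center_lz w : upper_center w -> T s0 lz w.
Proof. by move=> /(_ [::]); apply: tspanS => f /andP[]. Qed.

Lemma tspan_lz_central w : T s0 lz w -> central w.
Proof.
elim/tspan_ind => [|x y|c f hc hf].
- by move=> y; rewrite mul0r mulr0.
- exact: centralD.
apply: centralM; last exact: (@lz_central [::]).
by move=> y; apply: (cb_comm H).
Qed.

Lemma center_central w : upper_center w -> central w.
Proof. by move=> /center_lz; apply: tspan_lz_central. Qed.

Definition nneg : pred 'cV[int]_N := [pred f | [forall i, 0 <= co i f]].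

(** Up to a scalar this is a product of initial cluster variables, to which [mixed_laurent]
    applies. *)
Lemma nneg_upper f : nneg f -> upper_alg (frame s0 f).
Proof.
move=> /forallP nf.
have -> : f = \sum_i co i f *: e_ i.
  apply: co_eqP => j; rewrite /co summxE (bigD1 j) //= big1 => [|i /negPf ij].
    by rewrite !mxE !eqxx mulr1 addr0.
  by rewrite !mxE eq_sym ij mulr0.
elim/big_ind: _ => [|g h hg hh|i _].
- by rewrite (qframe1 (good_frame gs0)); apply: (subalg1 upper_subalg).
- rewrite (qframeD H (good_skew gs0) (good_frame gs0)) epsA_exp mulr_algl.
  by apply: (subalgZ upper_subalg); apply: (subalgM upper_subalg).
have -> : co i f = (absz (co i f))%:Z by have := nf i; lia.
rewrite -natz scaler_nat -(qframeX H (good_skew gs0) (good_frame gs0)).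
apply: (subalgX upper_subalg) => p.
exact: (mixed_laurent H Fdiv [::] p i gs0).
Qed.

Lemma lz_upper_center w : upper_alg w -> T s0 lz w -> upper_center w.
Proof.
move=> hw hl; rewrite -(proj_id (cb_subalg H) (good_free gs0) hl).
exact: proj_lz_center.
Qed.
Lemma nneg_span_upper w : T s0 nneg w -> upper_alg w.
Proof.
elim/tspan_ind => [|x y|c f hc hf].
- exact: (subalg0 upper_subalg).
- exact: (subalgD upper_subalg).
have [a ->] := lcoef_scalar hc; rewrite mulr_algl.
by apply: (subalgZ upper_subalg); apply: nneg_upper.
Qed.

(** * The basis of residues modulo l and the regular trace *)

Local Notation M := (frame s0).
Local Notation T0 := (tspan C0 M).
Local Notation box := {ffun 'I_N -> 'I_l}.
Local Notation fM := (good_free gs0).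
Local Notation frM := (good_frame gs0).
#[local] Hint Extern 0 (tfree C0 M) => exact: fM : core.

Definition bx (r : box) : 'cV[int]_N := \col_i (r i : nat)%:Z.
(** The coordinate of w at the basis element [M (bx r)] over the central part of the torus. *)
Definition cf (r : box) (w : F) : F := proj C0 M lz (w * M (- bx r)).

Lemma co_bx i r : co i (bx r) = (r i : nat)%:Z.
Proof using. by rewrite /co mxE. Qed.

Lemma lz_bx r r' : lz (bx r - bx r') = (r == r').
Proof.
apply/forallP/eqP => [h|-> i]; last by rewrite coD coN subrr dvdz0.
apply/ffunP => i; apply: ord_inj; have := h i; rewrite coD coN !co_bx => /dvdzP[m e].
have := ltn_ord (r i); have := ltn_ord (r' i); move: e.
by move: (nat_of_ord (r i)) (nat_of_ord (r' i)) => a b; case: (ltrgtP m 0) => [hm|hm|->]; nia.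
Qed.

Lemma residue_ex f : exists r, lz (f - bx r).
Proof.
have l0 : (0 < l)%N := prim_order_gt0 eprim.
have hr i : (absz (co i f %% l)%Z < l)%N.
  have := @modz_ge0 (co i f) l%:Z; have := @ltz_pmod (co i f) l%:Z; lia.
exists [ffun i => Ordinal (hr i)]; apply/forallP => i; rewrite coD coN co_bx ffunE /=.
have -> : (absz (co i f %% l)%Z)%:Z = (co i f %% l)%Z.
  by have := @modz_ge0 (co i f) l%:Z; lia.
by rewrite {1}(divz_eq (co i f) l) addrK dvdz_mull.
Qed.

Lemma lz_residue f r r' : lz (f - bx r) -> lz (f - bx r') = (r == r').
Proof.
move=> h; have -> : f - bx r' = (bx r - bx r') + (f - bx r).
  by rewrite [RHS]addrC addrA subrK.
by rewrite lzDr // lz_bx.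
Qed.

Lemma frame_box_mul f r : M f * M (- bx r) * M (bx r) = M f.
Proof. by rewrite -mulrA (qframe_Nmul H (good_skew gs0) frM) mulr1. Qed.

Lemma cf_gen c f r : C0 c ->
  cf r (c * M f) = if lz (f - bx r) then c * M f * M (- bx r) else 0.
Proof.
move=> hc; rewrite /cf -mulrA (qframeM frM) mulrA proj_gen //.
by apply: (subalgM (cb_subalg H)) => //; apply: (cb_pow H).
Qed.
Lemma cfD r x y : T0 predT x -> T0 predT y -> cf r (x + y) = cf r x + cf r y.
Proof.
move=> Tx Ty; rewrite /cf mulrDl projD //; apply: (seedMT H Fdiv gs0) => //;
exact: (seed_frT H Fdiv gs0).
Qed.
Lemma cf0 r : cf r 0 = 0.
Proof. by rewrite /cf mul0r proj0. Qed.

Lemma box_sum w : T0 predT w -> w = \sum_r cf r w * M (bx r).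
Proof.
suff: T0 predT w -> T0 predT w /\ w = \sum_r cf r w * M (bx r) by move=> h /h[].
elim/tspan_ind: w / => [|x y [Tx ex'] [Ty ey]|c f hc _].
- split; first exact: tspan0.
  by rewrite big1 // => r _; rewrite cf0 mul0r.
- split; first exact: tspanD.
  by rewrite {1}ex' {1}ey -big_split; apply: eq_bigr => r _; rewrite cfD // mulrDl.
split; first exact: tspan_gen.
have [r hr] := residue_ex f.
rewrite (bigD1 r) //= big1 ?addr0 => [|r' rr']; rewrite cf_gen //.
  by rewrite hr -!mulrA (mulrA (M f)) frame_box_mul.
by rewrite (lz_residue r' hr) eq_sym (negPf rr') mul0r.
Qed.

Lemma cf_in (P Q : pred 'cV[int]_N) r w :
  (forall f, P f -> lz (f - bx r) -> Q (f - bx r)) -> T0 P w -> T0 Q (cf r w).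
Proof.
move=> PQ hw; suff: T0 P w -> T0 predT w /\ T0 Q (cf r w) by move=> h; have [] := h hw.
clear hw; elim/tspan_ind: w / => [|x y [Tx hx] [Ty hy]|c f hc hf].
- by rewrite cf0; split; apply: tspan0.
- by rewrite cfD //; split; apply: tspanD.
split; first exact: tspan_gen.
rewrite cf_gen //; case: ifP => hl; last exact: tspan0.
rewrite -mulrA (qframeM frM); apply: tspanC => //; apply: tspan_gen; last exact: PQ.
exact: (cb_pow H).
Qed.

Lemma cf_lz r w : T0 predT w -> T0 lz (cf r w).
Proof. by apply: cf_in. Qed.

(** The representatives are smaller than l: a multiple of l greater than -l is nonnegative. Hence
    the residue basis also works for the mixed torus and for nonnegative exponents. *)
Lemma shift_nneg f r i : 0 <= co i f -> lz (f - bx r) -> 0 <= co i (f - bx r).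
Proof.
move=> f0 /forallP /(_ i); rewrite coD coN co_bx => /dvdzP[m]; move: f0.
have := ltn_ord (r i); by move: (nat_of_ord (r i)) (co i f) => a b; case: (ltrgtP m 0) => [hm|hm|->]; nia.
Qed.

Lemma cf_latt r w : T0 (frozen_nneg ex) w -> T0 (latt ex l) (cf r w).
Proof.
apply: cf_in => f /frozen_nnegP hf hl; apply/andP; split=> //.
by apply/frozen_nnegP => i ie; apply: shift_nneg => //; apply: hf.
Qed.
Lemma cf_nneg r w : T0 nneg w -> T0 (predI lz nneg) (cf r w).
Proof.
apply: cf_in => f /forallP hf hl; apply/andP; split=> //.
by apply/forallP => i; apply: shift_nneg.
Qed.

Lemma proj_lz_mul a w : T0 lz a -> T0 predT w ->
  proj C0 M lz (a * w) = a * proj C0 M lz w.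
Proof.
move=> ha Tw; have ca := tspan_lz_central ha; rewrite !ca.
by apply: (@proj_mulr [::] lz lz) => // f g; apply: lzDr.
Qed.

Lemma cf_mul a r w : T0 lz a -> T0 predT w -> cf r (a * w) = a * cf r w.
Proof.
move=> ha Tw; rewrite /cf -mulrA proj_lz_mul //.
by apply: (seedMT H Fdiv gs0) => //; apply: (seed_frT H Fdiv gs0).
Qed.

Lemma cf_bx r r' : cf r (M (bx r')) = (r == r')%:R.
Proof.
have := @cf_gen 1 (bx r') r; rewrite !mul1r => ->; last exact: (subalg1 (cb_subalg H)).
rewrite lz_bx eq_sym; case: eqP => [->|] //.
by rewrite (qframe_mulN H (good_skew gs0) frM).
Qed.

Lemma cf_sum r (a : box -> F) : (forall r, T0 lz (a r)) ->
  cf r (\sum_r' a r' * M (bx r')) = a r.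
Proof.
move=> ha; have TM r' := seed_frT H Fdiv gs0 (bx r').
have Ta r' : T0 predT (a r' * M (bx r')).
  by apply: (seedMT H Fdiv gs0) => //; apply: tspanT (ha r').
rewrite /cf mulr_suml proj_sum //; last first.
  by move=> r' _; apply: (seedMT H Fdiv gs0) => //; apply: (seed_frT H Fdiv gs0).
rewrite (bigD1 r) //= big1 ?addr0 => [|r' rr'].
  by rewrite -/(cf r _) cf_mul // cf_bx eqxx mulr1.
by rewrite -/(cf r _) cf_mul // cf_bx eq_sym (negPf rr') mulr0.
Qed.

Lemma cf_trace w : T0 predT w ->
  \sum_r cf r (w * M (bx r)) = proj C0 M lz w *+ (l ^ N).
Proof.
move=> Tw; have -> : (l ^ N)%N = #|box| by rewrite card_ffun !card_ord.
rewrite -sumr_const; apply: eq_bigr => r _.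
by rewrite /cf -mulrA (qframe_mulN H (good_skew gs0) frM) mulr1.
Qed.

Local Notation L0 := (mixed_torus v l s0).
Local Notation R0 := (mixed_torus v 1 s0).

Lemma L0E : L0 = tspan C0 M (latt ex l) :> set F.
Proof. exact: (mixed_torusE epsA_central epsA_unit Fdiv (prim_order_gt0 eprim) gs0). Qed.
Lemma R0E : R0 = tspan C0 M (frozen_nneg ex) :> set F.
Proof.
rewrite (mixed_torusE epsA_central epsA_unit Fdiv (ltn0Sn 0) gs0) eqEsubset.
by split=> w; apply: tspanS => f; rewrite -!topredE /= latt1.
Qed.

Lemma box_frozen r : frozen_nneg ex (bx r).
Proof. by apply/frozen_nnegP => i _; rewrite co_bx. Qed.

(** In the residue basis every diagonal entry of left multiplication equals the projection of w, and
    there are l^N of them. *)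
Lemma reg_trace_proj w : R0 w -> reg_trace L0 R0 w = proj C0 M lz w *+ (l ^ N).
Proof.
move=> Rw; have hw : T0 (frozen_nneg ex) w by move: Rw; rewrite R0E.
have lz_latt x : T0 (latt ex l) x -> T0 lz x by apply: tspanS => f /andP[].
have Lsub : is_subalg L0 by apply: alg_gen_subalg.
have Lc c x : L0 c -> c * x = x * c.
  by rewrite L0E => hc; apply: tspan_lz_central; apply: lz_latt.
pose b (i : 'I_#|box|) := M (bx (enum_val i)).
have bR i : T0 (frozen_nneg ex) (b i) by apply: tspanM1 => //; apply: box_frozen.
have sum_box (g : box -> F) : \sum_r g r = \sum_(i < #|box|) g (enum_val i).
  by rewrite (reindex (@enum_val box predT)) //; apply: onW_bij; apply: enum_val_bij.
have hb : free_basis L0 R0 b.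
  split=> [i|x|a ha h0 i]; first by rewrite R0E.
    rewrite R0E => hx; exists (fun i => cf (enum_val i) x); split=> [i|].
      by rewrite L0E; apply: cf_latt.
    by rewrite {1}(box_sum (tspanT hx)) sum_box.
  pose a' r := a (enum_rank r).
  have ha' r : T0 lz (a' r) by apply: lz_latt; rewrite -L0E; apply: ha.
  have := cf_sum (enum_val i) ha'; rewrite {2}/a' enum_valK => <-.
  rewrite sum_box; under eq_bigr do rewrite /a' enum_valK.
  by rewrite h0 cf0.
pose a : 'M[F]_#|box| := \matrix_(i, j) cf (enum_val i) (w * b j).
have hwb j : T0 (frozen_nneg ex) (w * b j).
  exact: (seedM H Fdiv gs0 (@frozen_nnegD _ ex) hw (bR j)).
have ha i j : L0 (a i j) by rewrite mxE L0E; apply: cf_latt.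
have xb j : w * b j = \sum_i a i j * b i.
  rewrite {1}(box_sum (tspanT (hwb j))) sum_box.
  by apply: eq_bigr => i _; rewrite mxE.
rewrite (reg_traceE Lsub Lc hb ha xb) -(cf_trace (tspanT hw)) sum_box.
by apply: eq_bigr => i _; rewrite mxE.
Qed.

(** * Derivations preserving CU commute with the projection *)

Section Derivation.
Variable D : F -> F.
Hypotheses (Dder : derivation_on upper_alg D).
Hypothesis (Dcen : forall c, upper_center c -> upper_center (D c)).
Hypothesis char0 : forall n, n.+1%:R != 0 :> K.

Lemma derivU w : upper_alg w -> upper_alg (D w).
Proof. by have [h _ _] := Dder; apply: h. Qed.
Lemma derivM' x y : upper_alg x -> upper_alg y -> D (x * y) = D x * y + x * D y.
Proof. by have [_ _ h] := Dder; apply: h. Qed.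
Lemma derivD' x y : upper_alg x -> upper_alg y -> D (x + y) = D x + D y.
Proof. by have [_ h _] := Dder => hx hy; have := h 1 x y hx hy; rewrite !scale1r. Qed.
Lemma deriv0' : D 0 = 0.
Proof.
have h0 := subalg0 upper_subalg.
by have := derivD' h0 h0; rewrite addr0 => /(congr1 (fun x => x - D 0)); rewrite subrr addrK.
Qed.
Lemma deriv1' : D 1 = 0.
Proof.
have h1 := subalg1 upper_subalg.
have := derivM' h1 h1; rewrite !mulr1 mul1r => /(congr1 (fun x => x - D 1)).
by rewrite subrr addrK.
Qed.
Lemma deriv_sum' (I : Type) (t : seq I) (g : I -> F) :
  (forall i, upper_alg (g i)) -> D (\sum_(i <- t) g i) = \sum_(i <- t) D (g i).
Proof.
move=> hg; elim: t => [|i t IH]; first by rewrite !big_nil deriv0'.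
rewrite !big_cons derivD' ?IH //.
exact: (subalg_sum upper_subalg).
Qed.
Lemma derivX' x n : upper_alg x ->
  D (x ^+ n) = \sum_(0 <= i < n) x ^+ i * D x * x ^+ (n - i.+1).
Proof.
move=> hx; elim: n => [|n IH]; first by rewrite expr0 deriv1' big_nil.
rewrite exprS derivM' ?IH //; last exact: (subalgX upper_subalg).
rewrite big_nat_recl // expr0 mul1r subn1; congr (_ + _).
rewrite mulr_sumr; apply: eq_bigr => i _.
by rewrite exprS !mulrA subSS.
Qed.

Lemma upper_T w : upper_alg w -> T0 predT w.
Proof. by move=> /(_ [::]); apply: tspanT. Qed.

(** Expand D of the l-th power of [M f] and project onto the coset of (l - 1) f: each of the l
    summands contributes the projection of [D (M f)] times the same unit. That coset does not meet l
    Z^N, which supports the left side, so l times the projection is zero. *)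
Lemma proj_deriv_frame f : nneg f -> ~~ lz f -> proj C0 M lz (D (M f)) = 0.
Proof.
move=> nf lf; have Uf := nneg_upper nf; have l0 : (0 < l)%N := prim_order_gt0 eprim.
pose P : pred 'cV[int]_N := [pred g | lz (g - f *+ l.-1)].
have sk := good_skew gs0.
have hproj i : (i < l)%N -> proj C0 M P (M f ^+ i * D (M f) * M f ^+ (l - i.+1)) =
    proj C0 M lz (D (M f)) * M f ^+ l.-1.
  move=> il; have Tw := upper_T (derivU Uf); move: (D (M f)) Tw => w Tw.
  rewrite !(qframeX H sk frM).
  suff: T0 predT w -> T0 predT w /\ proj C0 M P (M (f *+ i) * w * M (f *+ (l - i.+1))) =
      proj C0 M lz w * M (f *+ l.-1) by move=> h; have [] := h Tw.
  have TM (g : 'cV[int]_N) : T0 predT (M g) by apply: (seed_frT H Fdiv gs0).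
  clear Tw; elim/tspan_ind: w / => [|x y [Tx e1] [Ty e2]|c g hc _].
  - by rewrite mulr0 !mul0r !proj0 // mul0r; split; first exact: tspan0.
  - split; first exact: tspanD.
    rewrite mulrDr mulrDl !projD ?e1 ?e2 ?mulrDl //; do ?apply: (seedMT H Fdiv gs0) => //.
  split; first exact: tspan_gen.
  have fi : f *+ i + f *+ (l - i.+1) = f *+ l.-1.
    by rewrite -mulrnDr; congr (_ *+ _); lia.
  case: (boolP (lz g)) => lg.
    have cg : central (c * M g).
      by apply: tspan_lz_central; apply: tspan_gen.
    rewrite -(cg (M (f *+ i))) -mulrA (qframeM frM) fi.
    have -> : v ^ form (qform s0) (f *+ i) (f *+ (l - i.+1)) = 1.
      rewrite -!scaler_nat formZl formZr (form_alt _ sk) !mulr0; exact: expr0z.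
    rewrite mul1r proj_id; [|by []|by []|].
      by rewrite proj_gen // lg.
    apply: (seedM H Fdiv gs0 (P := lz) (Q := pred1 (f *+ l.-1))) => [a b ha /eqP ->||].
    - by rewrite /P inE addrK.
    - exact: tspan_gen.
    - by apply: tspanM1 => //=.
  rewrite [proj _ _ lz _]proj_gen // (negPf lg) mul0r.
  have hp : T0 (pred1 (f *+ i + g + f *+ (l - i.+1))) (M (f *+ i) * (c * M g) * M (f *+ (l - i.+1))).
    have hg : T0 (pred1 g) (c * M g) by apply: tspan_gen => //=.
    have h1 (h : 'cV[int]_N) : T0 (pred1 h) (M h) by apply: tspanM1 => //=.
    apply: (seedM H Fdiv gs0 (P := pred1 (f *+ i + g)) _ _ (h1 _)) => [a b /eqP -> /eqP -> //=|].
    by apply: (seedM H Fdiv gs0 _ (h1 _) hg) => a b /eqP -> /eqP -> //=.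
  apply: (proj_eq0 (cb_subalg H) fM hp) => h /eqP ->.
  by rewrite /P inE (addrC (f *+ i) g) -(addrA g) fi addrK.
have Ul : upper_center (M f ^+ l).
  rewrite (qframeX H sk frM) -scaler_nat natz.
  apply: lz_upper_center; last by apply: tspanM1 => //; apply: lzZ.
  apply: nneg_upper; apply/forallP => i; rewrite coZ.
  by move/forallP: nf => /(_ i); case: (co i f).
have hD := center_lz (Dcen Ul).
have h0 : proj C0 M P (D (M f ^+ l)) = 0.
  apply: (proj_eq0 (cb_subalg H) fM hD) => g lg; rewrite /P inE.
  apply/negP => hg; case/negP: lf.
  (* If g and g - (l - 1) f are divisible by l, then so is f, a contradiction. *)
  have -> : f = l%:Z *: f + ((g - f *+ l.-1) - g).
    have e : f *+ l = f + f *+ l.-1 by rewrite -mulrS prednK.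
    by rewrite -natz scaler_nat e [X in _ + X]addrAC subrr add0r addrK.
  by apply: lzD; [exact: lzZ|apply: lzD => //; apply: lzN].
move: h0; rewrite derivX' // proj_sum //; last first.
  move=> i _; apply: (seedMT H Fdiv gs0); last by apply: (seedXT H Fdiv gs0); apply: upper_T.
  by apply: (seedMT H Fdiv gs0); [apply: (seedXT H Fdiv gs0); apply: upper_T|apply/upper_T/derivU].
rewrite big_nat; under eq_bigr => i /andP[_ il] do rewrite hproj //.
rewrite -big_nat sumr_const_nat subn0 => h.
have hU : M f ^+ l.-1 \is a GRing.unit.
  by rewrite (qframeX H sk frM); apply: (seedU H Fdiv gs0).
apply: (mulIr hU); rewrite mul0r; apply/eqP.
have : (l%:R : K) *: (proj C0 M lz (D (M f)) * M f ^+ l.-1) == 0 by rewrite scaler_nat h.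
by rewrite scaler_eq0 -(prednK l0) (negPf (char0 _)).
Qed.

Lemma cleared w : T0 predT w -> exists h, [/\ lz h, nneg h & T0 nneg (M h * w)].
Proof.
have lzs (h : 'cV[int]_N) : nneg h -> nneg (l%:Z *: h).
  by move=> /forallP nh; apply/forallP => i; rewrite coZ; have := nh i; case: (co i h).
have nD f g : nneg f -> nneg g -> nneg (f + g).
  move=> /forallP hf /forallP hg; apply/forallP => i.
  by rewrite coD addr_ge0 ?hf ?hg.
elim/tspan_ind: w / => [|x y [h1 [l1 n1 e1]] [h2 [l2 n2 e2]]|c f hc _].
- exists 0; rewrite mulr0 lz0; split=> //; last exact: tspan0.
  by apply/forallP => i; rewrite co0.
- exists (h1 + h2); split; [exact: lzD|exact: nD|].
  rewrite mulrDr; apply: tspanD.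
    rewrite [h1 + h2]addrC -(lz_frameD gs0) ?l1 ?l2 // -mulrA.
    by apply: (seedM H Fdiv gs0 nD _ e1); apply: tspanM1.
  rewrite -(lz_frameD gs0) ?l1 ?l2 // -mulrA.
  by apply: (seedM H Fdiv gs0 nD _ e2); apply: tspanM1.
pose h : 'cV[int]_N := \col_i `|co i f|.
have hn : nneg h by apply/forallP => i; rewrite /co mxE.
exists (l%:Z *: h); split; [exact: lzZ|exact: lzs|].
rewrite (@lz_central [::] _ (lzZ h)) -mulrA (qframeM frM); apply: tspanC => //.
apply: tspan_gen; first exact: (cb_pow H).
apply/forallP => i; rewrite coD coZ /h {2}/co mxE.
have l0 : (0 < l)%N := prim_order_gt0 eprim.
by move: (co i f) => a; have : 1 <= l%:Z by []; nia.
Qed.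

(** A central monomial [M h] in CU makes the exponents of w nonnegative, so that each coordinate in
    the residue basis lies in CU and D applies to every term. The projection of [D (M h * w)] is
    then computed in two ways, and [M h] cancels. *)
Lemma proj_deriv w : upper_alg w -> proj C0 M lz (D w) = D (proj C0 M lz w).
Proof.
move=> Uw; have [h [lh nh hw]] := cleared (upper_T Uw).
have Uh := nneg_upper nh.
have Ch : upper_center (M h) by apply: lz_upper_center => //; apply: tspanM1.
have lDh := center_lz (Dcen Ch).
have lMh : T0 lz (M h) by apply: tspanM1.
have TDw := upper_T (derivU Uw).
have Tw := upper_T Uw.
have e1 : proj C0 M lz (D (M h * w)) =
    D (M h) * proj C0 M lz w + M h * proj C0 M lz (D w).
  rewrite derivM' // projD //; [|exact: (seedMT H Fdiv gs0 (tspanT lDh) Tw)|exact: (seedMT H Fdiv gs0 (tspanT lMh) TDw)].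
  by rewrite !proj_lz_mul.
pose p r := cf r (M h * w).
have hp r : T0 (predI lz nneg) (p r) by apply: cf_nneg.
have lp r : T0 lz (p r) by apply: tspanS (hp r) => f /andP[].
have Cp r : upper_center (p r).
  apply: lz_upper_center => //; apply: nneg_span_upper.
  by apply: tspanS (hp r) => f /andP[].
have nbx r : nneg (bx r) by apply/forallP => i; rewrite co_bx.
have Ubx r := nneg_upper (nbx r).
have Up r := center_upper (Cp r).
pose r0 : box := [ffun => Ordinal (prim_order_gt0 eprim)].
have br0 : bx r0 = 0 by apply: co_eqP => i; rewrite co_bx co0 ffunE.
have lbx r : lz (bx r) = (r == r0) by rewrite -lz_bx br0 subr0.
have Mr0 : M (bx r0) = 1 by rewrite br0 (qframe1 frM).
(* For a nonzero residue both terms of the product rule project to zero: D of the coordinate is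
   central and multiplies a monomial outside l Z^N, and the other term vanishes by
   [proj_deriv_frame]. *)
have e2 : proj C0 M lz (D (M h * w)) = D (p r0).
  rewrite {1}(box_sum (tspanT hw)) deriv_sum'; last first.
    by move=> r; exact: (subalgM upper_subalg (Up r) (Ubx r)).
  rewrite proj_sum //; last first.
    by move=> r _; apply/upper_T/derivU; exact: (subalgM upper_subalg (Up r) (Ubx r)).
  rewrite (bigD1 r0) //= big1 ?addr0 => [|r rr0].
    by rewrite -/(p r0) Mr0 mulr1; apply: proj_id => //; exact: (center_lz (Dcen (Cp r0))).
  rewrite -/(p r) derivM' // projD //; first last.
  - by apply: (seedMT H Fdiv gs0); [exact: upper_T|apply/upper_T/derivU].
  - by apply: (seedMT H Fdiv gs0); [apply/upper_T/derivU|exact: upper_T].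
  rewrite !proj_lz_mul //; [|exact/upper_T/derivU|exact: (center_lz (Dcen (Cp r)))|exact: upper_T].
  rewrite proj_deriv_frame ?lbx // mulr0 addr0.
  by rewrite -[M (bx r)]mul1r proj_gen ?lbx ?(negPf rr0) ?mulr0 //; apply: (subalg1 (cb_subalg H)).
have p0 : p r0 = M h * proj C0 M lz w.
  by rewrite /p /cf br0 oppr0 (qframe1 frM) mulr1 proj_lz_mul.
have Upw := center_upper (proj_lz_center Uw).
apply: (mulrI (seedU H Fdiv gs0 h)); apply: (addrI (D (M h) * proj C0 M lz w)).
by rewrite -e1 e2 p0 derivM'.
Qed.
End Derivation.

(** The matrices of left multiplication have entries in the central part of the initial torus, not
    in CU; only their traces lie in CU, which is what [poly_cayley_hamilton] asks for. *)
Lemma upper_fg (gens : seq F) : (forall n, n.+1%:R != 0 :> K) ->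
  upper_alg = alg_gen [set x | x \in gens] -> fg_module upper_center upper_alg.
Proof.
move=> char0 Ugen.
have UT w : upper_alg w -> T0 predT w by move=> /(_ [::]); apply: tspanT.
have [n nE] : exists n, #|box| = n.+1.
  exists #|box|.-1; rewrite prednK // card_ffun !card_ord expn_gt0.
  by rewrite (prim_order_gt0 eprim).
pose ev (i : 'I_n.+1) : box := enum_val (cast_ord (esym nE) i).
pose b i := M (bx (ev i)).
pose rk r : 'I_n.+1 := cast_ord nE (enum_rank r).
have evK r : ev (rk r) = r by rewrite /ev /rk cast_ordK enum_rankK.
have rkK i : rk (ev i) = i by rewrite /ev /rk enum_valK cast_ordKV.
have sum_box (g : box -> F) : \sum_r g r = \sum_i g (ev i).
  by rewrite (reindex ev) //; apply: onW_bij; exists rk.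
pose r0 : box := [ffun => Ordinal (prim_order_gt0 eprim)].
have br0 : bx r0 = 0 by apply: co_eqP => i; rewrite co_bx co0 ffunE.
pose e w : 'M[F]_n.+1 := \matrix_(i, j) cf (ev i) (w * b j).
have Tb w j : upper_alg w -> T0 predT (w * b j).
  by move=> /UT Tw; exact: (seedMT H Fdiv gs0 Tw (seed_frT H Fdiv gs0 _)).
have hS : is_subalg (T0 lz) := tspan_subalg H (good_skew gs0) frM lz0 lzD.
apply: (finite_module (n := n) center_subalg center_upper _ char0 _ Ugen).
  by move=> c x /center_central.
move=> X UX.
apply: (poly_cayley_hamilton (b := b) (e := e) (j0 := rk r0) upper_subalg center_subalg hS _ char0 _ _ _ _ _ UX).
- by move=> z x /tspan_lz_central.
- by move=> x i j Ux; rewrite mxE; apply: cf_lz; apply: Tb.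
- move=> x j Ux; rewrite {1}(box_sum (Tb x j Ux)) sum_box.
  by apply: eq_bigr => i _; rewrite mxE.
- move=> a ha h0 i; pose a' r := a (rk r).
  have ha' r : T0 lz (a' r) by apply: ha.
  have := cf_sum (ev i) ha'; rewrite {2}/a' rkK => <-.
  by rewrite sum_box; under eq_bigr do rewrite /a' rkK; rewrite h0 cf0.
- move=> x Ux; have -> : \tr (e x) = proj C0 M lz x *+ (l ^ N).
    rewrite -(cf_trace (UT _ Ux)) sum_box.
    by apply: eq_bigr => i _; rewrite mxE.
  by rewrite -scaler_nat; apply: (subalgZ center_subalg); apply: proj_lz_center.
by rewrite /b evK br0 (qframe1 frM).
Qed.
End Orbit.
End RootOfUnity.

(** * The specialization place *)

Section Place.
#[local] Set Default Proof Using "All".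
Variables (K : fieldType) (F Fq : unitAlgType K) (eps : K) (v : Fq) (N : nat).
Variables (L : 'M[int]_N) (X : 'cV[int]_N -> F) (Xq : 'cV[int]_N -> Fq).
Hypotheses (eps0 : eps != 0) (vC : forall x, v * x = x * v).
Hypothesis vU : v \is a GRing.unit.
Hypothesis Fdiv : forall x : F, x != 0 -> x \is a GRing.unit.
Hypothesis Fqdiv : forall x : Fq, x != 0 -> x \is a GRing.unit.
Hypothesis XM : forall f g, X f * X g = eps ^ form L f g *: X (f + g).
Hypothesis XqM : forall f g, Xq f * Xq g = v ^ form L f g * Xq (f + g).
Hypotheses (X1 : X 0 = 1) (Xq1 : Xq 0 = 1).
Hypotheses (Xind : lin_indep X) (Xqind : lin_indep (laurent_monomial v Xq)).
Hypothesis frac : forall x : Fq, exists a b,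
  [/\ lin_span (laurent_monomial v Xq) a, lin_span (laurent_monomial v Xq) b,
      b != 0 & x = a / b].
Local Notation term := (K * (int * 'cV[int]_N))%type.
Local Notation h := (v - eps%:A).
Implicit Types (t u : seq term) (x y a b c : Fq) (z w : F).

Let Fmul0 z w : z != 0 -> w != 0 -> z * w != 0.
Proof. by move=> /Fdiv zU w0; rewrite mulrI_eq0 //; apply: mulrI. Qed.

Definition gen_comb t : Fq := \sum_(p <- t) p.1 *: laurent_monomial v Xq p.2.
Definition spec_comb t : F := \sum_(p <- t) (p.1 * eps ^ p.2.1) *: X p.2.2.
(** The graph of the substitution of eps for v on the initial torus; linear independence of the
    generic monomials makes it functional. *)
Definition spec y z : Prop := exists t, y = gen_comb t /\ z = spec_comb t.

Lemma spec_comb0 t : gen_comb t = 0 -> spec_comb t = 0.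
Proof.
move=> h0; have h1 := lin_indep_comb Xqind h0.
pose t' : seq (K * (int * 'cV[int]_N)) := t.
have -> : spec_comb t = \sum_(p <- t') p.1 *: (eps ^ p.2.1 *: X p.2.2).
  by apply: eq_bigr => p _; rewrite scalerA.
rewrite (scale_group (fun i : int * 'cV[int]_N => eps ^ i.1 *: X i.2)) big1 // => i _.
by rewrite h1 scale0r.
Qed.

Lemma spec_uniq y z w : spec y z -> spec y w -> z = w.
Proof.
move=> [t [-> ->]] [u [e ->]]; pose u' := [seq (- p.1, p.2) | p <- u].
have e1 : gen_comb (t ++ u') = 0.
  rewrite /gen_comb big_cat big_map /=; move: e; rewrite /gen_comb => ->.
  by rewrite -big_split big1 // => p _ /=; rewrite scaleNr subrr.
have := spec_comb0 e1; rewrite /spec_comb big_cat big_map /=.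
under [X in _ + X]eq_bigr do rewrite mulNr scaleNr.
by rewrite sumrN => /eqP; rewrite subr_eq0 => /eqP.
Qed.

Lemma spec0 : spec 0 0.
Proof. by exists [::]; rewrite /gen_comb /spec_comb !big_nil. Qed.
Lemma specD x y z w : spec x z -> spec y w -> spec (x + y) (z + w).
Proof.
by move=> [t [-> ->]] [u [-> ->]]; exists (t ++ u); rewrite /gen_comb /spec_comb !big_cat.
Qed.
Lemma specZ (k : K) x z : spec x z -> spec (k *: x) (k *: z).
Proof.
move=> [t [-> ->]]; exists [seq (k * p.1, p.2) | p <- t].
rewrite /gen_comb /spec_comb !big_map !scaler_sumr; split; apply: eq_bigr => p _ /=.
  by rewrite scalerA.
by rewrite scalerA mulrA.
Qed.
Lemma spec_mono (m : int) f : spec (v ^ m * Xq f) (eps ^ m *: X f).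
Proof.
exists [:: (1, (m, f))]; rewrite /gen_comb /spec_comb !big_seq1 /= scale1r mul1r.
by [].
Qed.
Lemma spec_sum (I : Type) (s : seq I) (g : I -> Fq) (g' : I -> F) :
  (forall i, spec (g i) (g' i)) -> spec (\sum_(i <- s) g i) (\sum_(i <- s) g' i).
Proof.
move=> hg; elim: s => [|i s IH]; first by rewrite !big_nil; apply: spec0.
by rewrite !big_cons; apply: specD.
Qed.
Lemma specM x y z w : spec x z -> spec y w -> spec (x * y) (z * w).
Proof.
move=> [t [-> ->]] [u [-> ->]]; rewrite /gen_comb /spec_comb !mulr_suml.
apply: spec_sum => p; rewrite !mulr_sumr; apply: spec_sum => q.
rewrite /laurent_monomial -!scalerAl -!scalerAr !scalerA.
have -> : v ^ p.2.1 * Xq p.2.2 * (v ^ q.2.1 * Xq q.2.2) =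
    v ^ (p.2.1 + q.2.1 + form L p.2.2 q.2.2) * Xq (p.2.2 + q.2.2).
  have vz n y' : v ^ n * y' = y' * v ^ n by apply/esym/commrXz/esym/vC.
  by rewrite -mulrA (mulrA (Xq _)) -vz -(mulrA (v ^ q.2.1)) XqM !mulrA -!exprzDr.
have -> : p.1 * eps ^ p.2.1 * (q.1 * eps ^ q.2.1) =
    p.1 * q.1 * (eps ^ p.2.1 * eps ^ q.2.1) by ring.
rewrite XM scalerA.
have -> : p.1 * q.1 * (eps ^ p.2.1 * eps ^ q.2.1) * eps ^ form L p.2.2 q.2.2 =
    p.1 * q.1 * eps ^ (p.2.1 + q.2.1 + form L p.2.2 q.2.2).
  by rewrite !expfzDr // !mulrA.
by rewrite -[X in spec _ X]scalerA; apply/specZ/spec_mono.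
Qed.
Lemma spec_pow (m : int) : spec (v ^ m) (eps ^ m)%:A.
Proof. by have := spec_mono m 0; rewrite X1 Xq1 mulr1. Qed.
Lemma spec_frame f : spec (Xq f) (X f).
Proof. by have := spec_mono 0 f; rewrite !expr0z mul1r scale1r. Qed.
Lemma spec1 : spec 1 1.
Proof. by rewrite -X1 -Xq1; apply: spec_frame. Qed.
Lemma spec_scalar k : spec k%:A k%:A.
Proof. exact/specZ/spec1. Qed.

Lemma lin_span_spec y : lin_span (laurent_monomial v Xq) y -> exists z, spec y z.
Proof.
move=> [s [k ->]]; exists (spec_comb [seq (k i, i) | i <- s]).
by exists [seq (k i, i) | i <- s]; rewrite /gen_comb big_map.
Qed.

Lemma specializeE y z : spec y z -> specialize eps X v Xq y = z.
Proof.
move=> [t [yE zE]]; rewrite /specialize; case: xgetP => [w _ [s [k [e1 e2]]]|].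
  apply: (@spec_uniq y); last by exists t.
  by exists [seq (k i, i) | i <- s]; rewrite /gen_comb /spec_comb !big_map.
move/(_ z); case; pose k i := \sum_(p <- t | p.2 == i) p.1.
exists (undup (map snd t)), k; split.
  by rewrite yE /gen_comb scale_group.
rewrite zE /spec_comb.
under [LHS]eq_bigr do rewrite -scalerA.
rewrite (scale_group (fun i : int * 'cV[int]_N => eps ^ i.1 *: X i.2)).
by apply: eq_bigr => i _; rewrite scalerA.
Qed.

(* The size bound terminates the cancellation of powers of [v - eps]. *)
Definition poly_comb n y : Prop := exists (s : seq 'cV[int]_N) (p : 'cV[int]_N -> {poly K}),
  [/\ uniq s, forall f, (size (p f) <= n)%N & y = \sum_(f <- s) horner_alg v (p f) * Xq f].

Lemma horner_alg_spec (p : {poly K}) : spec (horner_alg v p) (p.[eps])%:A.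
Proof.
elim/poly_ind: p => [|p k IH]; first by rewrite rmorph0 horner0 scale0r; apply: spec0.
rewrite rmorphD rmorphM /= horner_algX horner_algC hornerMXaddC scalerDl.
apply: specD; last exact: spec_scalar.
rewrite -[(p.[eps] * eps)%:A]scalerA -mulr_algl; apply: specM => //.
by have := spec_pow 1; rewrite !expr1z.
Qed.

Lemma horner_alg_central p x : horner_alg v p * x = x * horner_alg v p.
Proof.
elim/poly_ind: p => [|p k IH]; first by rewrite rmorph0 mul0r mulr0.
rewrite rmorphD rmorphM /= horner_algX horner_algC mulrDl mulrDr mulr_algl mulr_algr.
by rewrite -mulrA vC mulrA IH mulrA.
Qed.

Lemma poly_comb_spec s (p : 'cV[int]_N -> {poly K}) :
  spec (\sum_(f <- s) horner_alg v (p f) * Xq f) (\sum_(f <- s) (p f).[eps] *: X f).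
Proof.
apply: spec_sum => f; rewrite -mulr_algl.
by apply: specM; [exact: horner_alg_spec|exact: spec_frame].
Qed.

(** Independence of the X f forces every coefficient polynomial to have the root eps; dividing by X
    - eps lowers all the size bounds. *)
Lemma poly_comb_step n y z : poly_comb n.+1 y -> spec y z -> z = 0 ->
  exists2 y', poly_comb n y' & y = h * y'.
Proof.
move=> [s [p [us hp yE]]] hs z0; have := poly_comb_spec s p.
rewrite -yE => /(spec_uniq hs); rewrite z0 => e0.
have p0 f : f \in s -> root (p f) eps.
  by move=> fs; apply/rootP; apply: (Xind us (esym e0)).
pose q f := if f \in s then p f %/ ('X - eps%:P) else 0.
have qE f : f \in s -> p f = q f * ('X - eps%:P).
  by move=> fs; rewrite /q fs divpK // dvdp_XsubCl p0.
exists (\sum_(f <- s) horner_alg v (q f) * Xq f).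
  exists s, q; split=> // f; rewrite /q; case: ifP => fs; last by rewrite size_poly0.
  by rewrite size_divp ?polyXsubC_eq0 // size_XsubC subn1 -ltnS; have := hp f; case: (size _).
rewrite yE mulr_sumr; apply: eq_big_seq => f fs.
rewrite (qE f fs) rmorphM rmorphB /= horner_algX horner_algC mulrA.
by rewrite horner_alg_central.
Qed.

Lemma gen_comb_poly t : (forall p, p \in t -> 0 <= p.2.1) -> exists n, poly_comb n (gen_comb t).
Proof.
move=> ht; pose p f := \sum_(q <- t | q.2.2 == f) q.1 *: 'X^(absz q.2.1) : {poly K}.
pose s := undup [seq q.2.2 | q <- t].
exists (\max_(f <- s) size (p f)), s, p; split; first exact: undup_uniq.
  move=> f; case: (boolP (f \in s)) => fs; first exact: (leq_bigmax_seq (F := fun f => size (p f))).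
  rewrite /p big1_seq ?size_poly0 // => q /andP[/eqP qf qt]; move: fs.
  by rewrite mem_undup -qf (map_f (fun q : term => q.2.2) qt).
have -> : gen_comb t = \sum_(q <- [seq (q.1 *: v ^ q.2.1, q.2.2) | q <- t]) q.1 * Xq q.2.
  by rewrite big_map; apply: eq_bigr => q _; rewrite /laurent_monomial scalerAl.
rewrite comb_group -map_comp; apply: eq_bigr => f _; congr (_ * _).
rewrite big_map rmorph_sum /= big_seq_cond [RHS]big_seq_cond.
apply: eq_bigr => q /andP[/ht q0 _].
rewrite linearZ /= rmorphXn /= horner_algX exprnP.
have e : (absz q.2.1)%:Z = q.2.1 by lia.
by rewrite e mulr_algl.
Qed.

Lemma clear_pow t : exists m : nat, forall n : nat, (m <= n)%N ->
  exists k, poly_comb k (v ^ n * gen_comb t).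
Proof.
exists (\max_(q <- t) absz q.2.1)%N => n mn.
have -> : v ^ n * gen_comb t = gen_comb [seq (q.1, (n%:Z + q.2.1, q.2.2)) | q <- t].
  rewrite /gen_comb mulr_sumr big_map; apply: eq_bigr => q _.
  by rewrite /laurent_monomial -scalerAr mulrA -exprzDr.
apply: gen_comb_poly => _ /mapP[q qt ->] /=.
have := leq_bigmax_seq (F := fun q : term => absz q.2.1) (P := predT) _ qt isT.
by move: mn; move: (\max_(_ <- _) _)%N => M; lia.
Qed.

(** Elements with a representation whose denominator survives at eps; a relation, because elements
    such as the inverse of v - eps have no value. *)
Definition place x z : Prop := exists a b (a' b' : F),
  [/\ spec a a', spec b b', b' != 0, x = a / b & z = a' / b'].

Lemma spec_neq0 b (b' : F) : spec b b' -> b' != 0 -> b != 0.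
Proof.
by move=> hb; apply: contraNneq => e; move: hb; rewrite e => /spec_uniq/(_ spec0) ->.
Qed.

(** While both terms of a fraction specialize to 0, the central factor v - eps is cancelled from
    both. *)
Lemma descent n c1 c2 : poly_comb n c1 -> poly_comb n c2 -> c2 != 0 ->
  exists d1 d2 (z1 z2 : F), [/\ spec d1 z1, spec d2 z2, (z1 != 0) || (z2 != 0),
    d2 != 0 & c1 / c2 = d1 / d2].
Proof.
elim: n c1 c2 => [|n IH] c1 c2 h1 h2 c20.
  have [s [p [_ hp e]]] := h2; case/eqP: c20; rewrite e big1 // => f _.
  by have := hp f; rewrite leqn0 size_poly_eq0 => /eqP ->; rewrite rmorph0 mul0r.
have [z1 s1] : exists z1, spec c1 z1.
  by have [s [p [_ _ ->]]] := h1; eexists; apply: poly_comb_spec.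
have [z2 s2] : exists z2, spec c2 z2.
  by have [s [p [_ _ ->]]] := h2; eexists; apply: poly_comb_spec.
case: (boolP ((z1 != 0) || (z2 != 0))) => zz; first by exists c1, c2, z1, z2.
move: zz; rewrite negb_or !negbK => /andP[/eqP z10 /eqP z20].
have [c1' h1' e1] := poly_comb_step h1 s1 z10.
have [c2' h2' e2] := poly_comb_step h2 s2 z20.
have hh0 : h != 0 by apply: contraNneq c20 => hh; rewrite e2 hh mul0r.
have c20' : c2' != 0 by apply: contraNneq c20 => e; rewrite e2 e mulr0.
have hC x : h * x = x * h by rewrite mulrBl mulrBr vC mulr_algl mulr_algr.
have [d1 [d2 [w1 [w2 [hd1 hd2 hw hd e]]]]] := IH _ _ h1' h2' c20'.
exists d1, d2, w1, w2; split=> //; rewrite -e e1 e2.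
have hU := Fqdiv hh0; have cU := Fqdiv c20'.
by rewrite (hC c1') (hC c2') invrM // -mulrA mulVKr.
Qed.

Lemma ore_mul a b c d : b != 0 -> d != 0 -> b^-1 * a = c / d -> a * d = b * c.
Proof.
move=> b0 d0 e; have bU := Fqdiv b0; have dU := Fqdiv d0.
by rewrite -[LHS](mulVKr bU) (mulrA b^-1) e mulrVK.
Qed.

(** An Ore condition for denominators that survive at eps. After [descent], if the new denominator
    specialized to 0, then a d = b c would specialize to a product of two nonzero elements equal to
    0. *)
Lemma specialization_ore a b (a' b' : F) : spec a a' -> spec b b' -> b' != 0 ->
  exists c d (c' d' : F), [/\ spec c c', spec d d', d' != 0, d != 0 & b^-1 * a = c / d].
Proof.
move=> ha hb b0; have [c [d [hc hd d0 e]]] := frac (b^-1 * a).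
have [zc [t [cE _]]] := lin_span_spec hc; have [zd [u [dE _]]] := lin_span_spec hd.
have [m1 H1] := clear_pow t; have [m2 H2] := clear_pow u.
pose m := maxn m1 m2; have [k1 p1] := H1 m (leq_maxl _ _); have [k2 p2] := H2 m (leq_maxr _ _).
rewrite -cE in p1; rewrite -dE in p2.
have mono k k' y : (k <= k')%N -> poly_comb k y -> poly_comb k' y.
  by move=> kk [s [p [us hp ->]]]; exists s, p; split=> // f; apply: leq_trans (hp f) kk.
have vmU : v ^ m \is a GRing.unit by apply: unitrXz.
have vmd : v ^ m * d != 0 by rewrite mulrI_eq0 //; apply: mulrI.
have [d1 [d2 [z1 [z2 [h1 h2 hz d20 e1]]]]] :=
  descent (mono _ _ _ (leq_maxl k1 k2) p1) (mono _ _ _ (leq_maxr k1 k2) p2) vmd.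
have vmC x : v ^ m * x = x * v ^ m by apply/esym/commrXz/esym/vC.
have e2 : b^-1 * a = d1 / d2.
  by rewrite e -e1 (vmC c) (vmC d) (invrM (Fqdiv d0) vmU) -mulrA mulVKr.
exists d1, d2, z1, z2; split=> //; apply: contraT; rewrite negbK => /eqP z20.
move: hz; rewrite z20 eqxx orbF => z10.
have ad := ore_mul (spec_neq0 hb b0) d20 e2.
have := specM ha h2; rewrite ad => /spec_uniq/(_ (specM hb h1)).
by rewrite z20 mulr0 => /esym/eqP; rewrite (negPf (Fmul0 b0 z10)).
Qed.

Lemma place_uniq x z w : place x z -> place x w -> z = w.
Proof.
move=> [a1 [b1 [a1' [b1' [ha1 hb1 b10 xE ->]]]]] [a2 [b2 [a2' [b2' [ha2 hb2 b20 xE2 ->]]]]].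
have B1 := spec_neq0 hb1 b10; have B2 := spec_neq0 hb2 b20.
have [c [d [c' [d' [hc hd d0' d0 e]]]]] := specialization_ore hb2 hb1 b10.
have e1 := ore_mul B1 d0 e.
have e2 : a2 * d = a1 * c.
  have -> : a2 = x * b2 by rewrite xE2 mulrVK ?Fqdiv.
  by rewrite -mulrA e1 xE mulrA mulrVK ?Fqdiv.
have e1' : b2' * d' = b1' * c' by apply: spec_uniq (specM hb2 hd) _; rewrite e1; apply: specM.
have e2' : a2' * d' = a1' * c' by apply: spec_uniq (specM ha2 hd) _; rewrite e2; apply: specM.
have c0' : c' != 0.
  apply: contraTneq (Fmul0 b20 d0') => c0; rewrite e1' c0 mulr0 eqxx; exact.
have U := (Fdiv b10, Fdiv b20, Fdiv c0', Fdiv d0').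
have -> : a1' / b1' = (a1' * c') / (b1' * c') by rewrite invrM ?U // mulrA mulrK ?U.
by rewrite -e1' -e2' invrM ?U // mulrA mulrK ?U.
Qed.

Lemma place_spec y z : spec y z -> place y z.
Proof.
move=> hy; exists y, 1, z, 1; split=> //; rewrite ?divr1 //; [exact: spec1|exact: oner_neq0].
Qed.

Lemma placeD x y z w : place x z -> place y w -> place (x + y) (z + w).
Proof.
move=> [a1 [b1 [a1' [b1' [ha1 hb1 b10 -> ->]]]]] [a2 [b2 [a2' [b2' [ha2 hb2 b20 -> ->]]]]].
have B1 := spec_neq0 hb1 b10; have B2 := spec_neq0 hb2 b20.
have [c [d [c' [d' [hc hd d0' d0 e]]]]] := specialization_ore hb2 hb1 b10.
have e1 := ore_mul B1 d0 e.
have e1' : b2' * d' = b1' * c' by apply: spec_uniq (specM hb2 hd) _; rewrite e1; apply: specM.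
have c0' : c' != 0.
  by apply: contraTneq (Fmul0 b20 d0') => c0; rewrite e1' c0 mulr0 eqxx.
have c0 := spec_neq0 hc c0'.
have U := (Fdiv b10, Fdiv b20, Fdiv c0', Fdiv d0').
have Uq := (Fqdiv B1, Fqdiv B2, Fqdiv c0, Fqdiv d0).
exists (a1 * c + a2 * d), (b1 * c), (a1' * c' + a2' * d'), (b1' * c'); split.
- by apply: specD; apply: specM.
- exact: specM.
- exact: Fmul0.
- rewrite mulrDl; congr (_ + _); first by rewrite invrM ?Uq // mulrA mulrK ?Uq.
  by rewrite -e1 invrM ?Uq // mulrA mulrK ?Uq.
rewrite mulrDl; congr (_ + _); first by rewrite invrM ?U // mulrA mulrK ?U.
by rewrite -e1' invrM ?U // mulrA mulrK ?U.
Qed.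

Lemma placeM x y z w : place x z -> place y w -> place (x * y) (z * w).
Proof.
move=> [a1 [b1 [a1' [b1' [ha1 hb1 b10 -> ->]]]]] [a2 [b2 [a2' [b2' [ha2 hb2 b20 -> ->]]]]].
have B1 := spec_neq0 hb1 b10; have B2 := spec_neq0 hb2 b20.
have [c [d [c' [d' [hc hd d0' d0 e]]]]] := specialization_ore ha2 hb1 b10.
have e1 := ore_mul B1 d0 e.
have e1' : a2' * d' = b1' * c' by apply: spec_uniq (specM ha2 hd) _; rewrite e1; apply: specM.
have U := (Fdiv b10, Fdiv b20, Fdiv d0').
have Uq := (Fqdiv B1, Fqdiv B2, Fqdiv d0).
exists (a1 * c), (b2 * d), (a1' * c'), (b2' * d'); split; try exact: specM; first exact: Fmul0.
  by rewrite invrM ?Uq // !mulrA -(mulrA a1) e !mulrA.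
rewrite invrM ?U // !mulrA -(mulrA a1' b1'^-1).
have -> : b1'^-1 * a2' = c' / d' by rewrite -[a2'](mulrK U.2) e1' -mulrA mulKr ?U.
by rewrite !mulrA.
Qed.

Lemma placeV x z : place x z -> z != 0 -> place x^-1 z^-1.
Proof.
move=> [a [b [a' [b' [ha hb b0 -> ->]]]]] z0.
have a0' : a' != 0 by apply: contraNneq z0 => ->; rewrite mul0r.
exists b, a, b', a'; split=> //.
  by rewrite invrM ?unitrV ?Fqdiv ?(spec_neq0 ha) ?(spec_neq0 hb) // invrK.
by rewrite invrM ?unitrV ?Fdiv // invrK.
Qed.
End Place.

(** * Brackets of a deformation *)

(** The letters stand for the six orderings of a triple product; this is the Jacobi identity of
    commutators. *)
Lemma jacobi_cancel (V : zmodType) (a b c d e f : V) :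
  a - b - (c - d) + (c - e - (f - b)) + (f - d - (a - e)) = 0.
Proof.
rewrite !opprB !addrA !subrK (addrAC _ (- e) b) (addrAC _ d b) subrK.
by rewrite (addrAC (a + d)) addrK subrK subrr.
Qed.

Section Deformation.
#[local] Set Default Proof Using "All".
Variables (K : fieldType) (F Fq : unitAlgType K) (T : set Fq) (U : set F) (h : Fq).
Variables (G : Fq -> F -> Prop) (theta : Fq -> F) (iota : F -> Fq).
Hypotheses (Tsub : is_subalg T) (Usub : is_subalg U).
Hypotheses (hC : forall x, h * x = x * h) (hU : h \is a GRing.unit).
Hypothesis Gu : forall x z w, G x z -> G x w -> z = w.
Hypothesis GM : forall x y z w, G x z -> G y w -> G (x * y) (z * w).
Hypothesis GD : forall x y z w, G x z -> G y w -> G (x + y) (z + w).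
Hypothesis GZ : forall (k : K) x z, G x z -> G (k *: x) (k *: z).
Hypothesis Gh : forall x z, G x z -> G (h * x) 0.
Hypothesis Gtheta : forall y, T y -> G y (theta y).
Hypothesis thetaU : forall y, T y -> U (theta y).
Hypothesis theta_surj : forall w, U w -> exists2 y, T y & theta y = w.
Hypothesis theta_ker : forall y, T y -> G y 0 -> T (h^-1 * y).
Hypothesis iotaP : center_section U T theta iota.
Local Notation D := (d_sp T h theta iota).
Local Notation br x y := (h^-1 * (x * y - y * x)).

Let GN x z : G x z -> G (- x) (- z).
Proof. by move=> /(GZ (-1)); rewrite !scaleN1r. Qed.
Let GB x y z w : G x z -> G y w -> G (x - y) (z - w).
Proof. by move=> hx hy; apply: GD => //; apply: GN. Qed.
Let G0 : G 0 0.
Proof. by have h0 := subalg0 Tsub; have := GB (Gtheta h0) (Gtheta h0); rewrite !subrr. Qed.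
Let thetaE y z : T y -> G y z -> theta y = z.
Proof. by move=> /Gtheta h1 h2; apply: Gu h1 h2. Qed.
Let hVC x : h^-1 * x = x * h^-1.
Proof. by apply/esym/commrV/esym/hC. Qed.
Let Tiota c : alg_center U c -> T (iota c). Proof. by case: iotaP => _ /[apply] -[]. Qed.
Let theta_iota c : alg_center U c -> theta (iota c) = c.
Proof. by case: iotaP => _ /[apply] -[]. Qed.
Let Giota c : alg_center U c -> G (iota c) c.
Proof. by move=> hc; rewrite -{2}(theta_iota hc); apply/Gtheta/Tiota. Qed.

Let brDl x y z : br (x + y) z = br x z + br y z.
Proof. by rewrite -mulrDr mulrDl [z * _]mulrDr opprD addrACA. Qed.
Let brDr x y z : br z (x + y) = br z x + br z y.
Proof. by rewrite -mulrDr mulrDl [z * (x + y)]mulrDr opprD addrACA. Qed.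
Let brZl (k : K) x y : br (k *: x) y = k *: br x y.
Proof. by rewrite -!scalerAr -scalerAl -scalerBr -scalerAr. Qed.
Let brZr (k : K) x y : br y (k *: x) = k *: br y x.
Proof. by rewrite -!scalerAr -scalerAl -scalerBr -scalerAr. Qed.
Let brhr x y : br x (h * y) = x * y - y * x.
Proof. by rewrite (mulrA x) -(hC x) -!mulrA -mulrBr mulKr. Qed.
Let brhl x y : br (h * x) y = x * y - y * x.
Proof. by rewrite (mulrA y) -(hC y) -!mulrA -mulrBr mulKr. Qed.

(** The commutator specializes to that of a central element, hence to 0, and is divisible by h. *)
Lemma bracket_T c y : alg_center U c -> T y -> T (br (iota c) y).
Proof.
move=> hc Ty; have Tc := Tiota hc; apply: theta_ker.
  by apply: (subalgB Tsub); apply: (subalgM Tsub).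
have h1 := Gtheta Ty; rewrite -(subrr (c * theta y)).
rewrite {2}(hc.2 _ (thetaU Ty)); apply: GB; apply: GM => //; exact: Giota.
Qed.

(** Two lifts differ by h w with w in T; the difference of the results is the commutator of [iota c]
    with w, which specializes to 0 because c is central. *)
Lemma d_spE c y : alg_center U c -> T y -> D c (theta y) = theta (br (iota c) y).
Proof.
move=> hc Ty; rewrite /d_sp; case: xgetP => [z _ [y' [Ty' e ->]]|]; last first.
  by move/(_ (theta (br (iota c) y))); case; exists y.
have Tw : T (h^-1 * (y' - y)).
  apply: theta_ker; first exact: (subalgB Tsub).
  by rewrite -(subrr (theta y)); apply: GB; [rewrite -e|]; apply: Gtheta.
set w := h^-1 * (y' - y) in Tw.
have yE : y' = y + h * w by rewrite /w mulVKr // addrC subrK.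
apply: thetaE; first exact: bracket_T.
have -> : br (iota c) y' = br (iota c) y + (iota c * w - w * iota c).
  by rewrite yE brDr brhr.
rewrite -[X in G _ X]addr0; apply: GD; first exact/Gtheta/bracket_T.
rewrite -(subrr (c * theta w)) {2}(hc.2 _ (thetaU Tw)).
by apply: GB; apply: GM; auto.
Qed.

Lemma G_d_sp c y : alg_center U c -> T y -> G (br (iota c) y) (D c (theta y)).
Proof. by move=> hc Ty; rewrite d_spE //; apply/Gtheta/bracket_T. Qed.

(* On two central elements the bracket may be computed from arbitrary lifts. *)
Lemma G_d_sp_lift c c' x y (z w : F) : alg_center U c -> alg_center U c' ->
  G x z -> G y w -> c * w = w * c -> c' * z = z * c' ->
  G (br (iota c + h * x) (iota c' + h * y)) (D c c').
Proof.
move=> hc hc' gx gy cw cz.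
have -> : br (iota c + h * x) (iota c' + h * y) = br (iota c) (iota c') +
    ((iota c * y - y * iota c) + (x * iota c' - iota c' * x) + h * (x * y - y * x)).
  rewrite brDl !brDr !brhl brhr (mulrA x) -(hC x) -!(mulrA h) -mulrBr.
  by rewrite !addrA.
rewrite -[X in G _ X]addr0; apply: GD.
  by rewrite -[c' in D c c'](theta_iota hc'); apply: G_d_sp => //; exact: Tiota.
rewrite -(addr0 0) -{1}(addr0 0); apply: GD; last by apply: Gh; apply: GB; apply: GM; eauto.
apply: GD.
  by rewrite -(subrr (c * w)) {2}cw; apply: GB; apply: GM; auto.
by rewrite -(subrr (z * c')) -{2}cz; apply: GB; apply: GM; auto.
Qed.

Lemma d_sp_derivation c : alg_center U c -> derivation_on U (D c).
Proof.
move=> hc; split=> [r /theta_surj[y Ty <-]|k r s /theta_surj[x Tx <-] /theta_surj[y Ty <-]|r s /theta_surj[x Tx <-] /theta_surj[y Ty <-]].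
- by rewrite d_spE //; apply/thetaU/bracket_T.
- have Txy : T (k *: x + y) by apply: (subalgD Tsub) => //; apply: (subalgZ Tsub).
  have -> : k *: theta x + theta y = theta (k *: x + y).
    by apply/esym/thetaE => //; apply: GD; [apply: GZ|]; apply: Gtheta.
  apply: Gu (G_d_sp hc Txy) _.
  have -> : br (iota c) (k *: x + y) = k *: br (iota c) x + br (iota c) y.
    by rewrite brDr brZr.
  by apply: GD; [apply: GZ|]; apply: G_d_sp.
have Txy : T (x * y) by apply: (subalgM Tsub).
have -> : theta x * theta y = theta (x * y).
  by apply/esym/thetaE => //; apply: GM; apply: Gtheta.
apply: Gu (G_d_sp hc Txy) _.
have -> : br (iota c) (x * y) = br (iota c) x * y + x * br (iota c) y.
  rewrite -(mulrA h^-1) (mulrA x h^-1) -(hVC x) -(mulrA h^-1) -mulrDr; congr (_ * _).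
  by rewrite mulrBl mulrBr !mulrA addrA subrK.
by apply: GD; apply: GM; [exact: G_d_sp|exact: Gtheta|exact: Gtheta|exact: G_d_sp].
Qed.

Lemma d_sp_linear r : U r -> linear_on (alg_center U) (D^~ r).
Proof.
move=> /theta_surj[y Ty <-] k c c' hc hc' /=.
have hcc : alg_center U (k *: c + c').
  have [hc1 hc2] := hc; have [hc1' hc2'] := hc'; split.
    by apply: (subalgD Usub) => //; apply: (subalgZ Usub).
  by move=> s Us; rewrite mulrDl mulrDr -scalerAl -scalerAr hc2 // hc2'.
apply: Gu (G_d_sp hcc Ty) _; have [lin _] := iotaP; rewrite (lin k c c' hc hc').
have -> : br (k *: iota c + iota c') y = k *: br (iota c) y + br (iota c') y.
  by rewrite brDl brZl.
by apply: GD; [apply: GZ|]; apply: G_d_sp.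
Qed.

(** Iterated brackets of elements of C have iterated divided commutators of the lifts as
    representatives, so the Jacobi identity descends from commutators. *)
Lemma d_sp_poisson_order (C : set F) : is_subalg C -> C `<=` alg_center U ->
  fg_module C U -> (forall c c', C c -> C c' -> C (D c c')) -> poisson_order U C D D.
Proof.
move=> Csub CZ fg hD.
have CU c : C c -> U c by move=> /CZ[].
have dU c (hc : C c) := d_sp_derivation (CZ _ hc).
have lin r (Ur : U r) : linear_on C (D^~ r).
  by move=> k c c' /CZ hc /CZ hc'; apply: d_sp_linear.
split=> //; split.
- by split=> // x y /CZ[_ hx] /CU; apply: hx.
- move=> c hc; have [_ d1 d2] := dU c hc; split=> [x|k x y /CU hx /CU|x y /CU hx /CU].
  + exact: hD.
  + exact: d1.
  exact: d2.
- by move=> y /CU; apply: lin.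
- move=> c /CZ hc; have := G_d_sp hc (Tiota hc); rewrite subrr mulr0 theta_iota //.
  by move=> /Gu/(_ G0).
move=> x y z Cx Cy Cz; have hx := CZ _ Cx; have hy := CZ _ Cy; have hz := CZ _ Cz.
have step a b e : alg_center U a -> alg_center U b -> alg_center U e ->
    G (br (iota a) (br (iota b) (iota e))) (D a (D b e)).
  move=> ha hb he; rewrite -[e in D b e](theta_iota he) (d_spE hb (Tiota he)).
  by apply: (G_d_sp ha); apply: bracket_T hb (Tiota he).
apply: (Gu (GD (GD (step _ _ _ hx hy hz) (step _ _ _ hy hz hx)) (step _ _ _ hz hx hy))).
set X := iota x; set Y := iota y; set W := iota z.
rewrite -!mulrDr [X in G X _](_ : _ = 0); first exact: G0.
have kx a b e : a * br b e = h^-1 * (a * (b * e - e * b)).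
  by rewrite (mulrA a) -(hVC a) -mulrA.
rewrite !kx -!(mulrA h^-1) -!mulrBr -!mulrDr; apply/eqP; rewrite !mulrI_eq0 ?unitrV //; try by apply: mulrI; rewrite unitrV.
apply/eqP; rewrite !mulrBl !mulrBr !mulrA.
exact: jacobi_cancel.
Qed.
End Deformation.

(** * Specialization of cluster algebras *)

Section Specialize.
#[local] Set Default Proof Using "All".
Variables (K : fieldType) (F Fq : unitAlgType K) (eps : K) (v : Fq) (N : nat).
Variables (ex : {set 'I_N}) (d : dir ex -> nat).
Hypothesis eps0 : eps != 0.
Local Notation eA := (eps%:A : F).
Hypotheses (HE : coef_base eA (lcoef eA)) (HQ : coef_base v (lcoef v)).
Hypothesis Fdiv : forall x : F, x != 0 -> x \is a GRing.unit.
Hypothesis Fqdiv : forall x : Fq, x != 0 -> x \is a GRing.unit.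
Variables (s0 : seed F ex) (sq0 : seed Fq ex).
Hypotheses (gs0 : good eA (lcoef eA) d s0) (gq0 : good v (lcoef v) d sq0).
Hypotheses (exE : exmat s0 = exmat sq0) (qfE : qform s0 = qform sq0).
Hypothesis Xind : lin_indep (frame s0).
Hypothesis Xqind : lin_indep (laurent_monomial v (frame sq0)).
Hypothesis fracq : forall x : Fq, exists a b,
  [/\ lin_span (laurent_monomial v (frame sq0)) a,
      lin_span (laurent_monomial v (frame sq0)) b, b != 0 & x = a / b].
Local Notation h := (v - eps%:A).
Local Notation se p := (muts eA p s0).
Local Notation sq p := (muts v p sq0).
Local Notation Te p := (tspan (lcoef eA) (frame (se p))).
Local Notation Tq p := (tspan (lcoef v) (frame (sq p))).
Local Notation G := (place eps v (frame s0) (frame sq0)).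
Let gse p : good eA (lcoef eA) d (se p) := muts_good HE Fdiv p gs0.
Let gsq p : good v (lcoef v) d (sq p) := muts_good HQ Fqdiv p gq0.

Lemma scalar_exp (z : int) : eA ^ z = (eps ^ z)%:A.
Proof using eps0.
case: z => n; first by rewrite -!exprnP exprZn expr1n.
by rewrite NegzE -!exprnN exprZn expr1n invrZ ?unitfE ?expf_neq0 ?unitr1 // invr1.
Qed.

Let XM f g : frame s0 f * frame s0 g = eps ^ form (qform s0) f g *: frame s0 (f + g).
Proof. by rewrite (qframeM (good_frame gs0)) scalar_exp mulr_algl. Qed.
Let XqM f g : frame sq0 f * frame sq0 g = v ^ form (qform s0) f g * frame sq0 (f + g).
Proof. by rewrite qfE (qframeM (good_frame gq0)). Qed.
Let X1 := qframe1 (good_frame gs0).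
Let Xq1 := qframe1 (good_frame gq0).
Let gM := placeM eps0 (cb_central HQ) (cb_unit HQ) Fdiv Fqdiv XM XqM X1 Xq1 Xind Xqind fracq.
Let gD := placeD eps0 (cb_central HQ) (cb_unit HQ) Fdiv Fqdiv XM XqM X1 Xq1 Xind Xqind fracq.
Let gV := placeV eps0 (cb_central HQ) (cb_unit HQ) Fdiv Fqdiv XM XqM X1 Xq1 Xind Xqind fracq.
Let gU := place_uniq eps0 (cb_central HQ) (cb_unit HQ) Fdiv Fqdiv XM XqM X1 Xq1 Xind Xqind fracq.
Let gS := place_spec eps0 (cb_central HQ) (cb_unit HQ) Fdiv Fqdiv XM XqM X1 Xq1 Xind Xqind fracq.
Let sP := spec_pow eps0 (cb_central HQ) (cb_unit HQ) Fdiv Fqdiv XM XqM X1 Xq1 Xind Xqind fracq.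
Let sK := spec_scalar eps0 (cb_central HQ) (cb_unit HQ) Fdiv Fqdiv XM XqM X1 Xq1 Xind Xqind fracq.
Let sF := spec_frame eps0 (cb_central HQ) (cb_unit HQ) Fdiv Fqdiv XM XqM X1 Xq1 Xind Xqind fracq.

Lemma special_uniq x z w : G x z -> G x w -> z = w. Proof. exact: gU. Qed.
Lemma specialM x y z w : G x z -> G y w -> G (x * y) (z * w). Proof. exact: gM. Qed.
Lemma specialD x y z w : G x z -> G y w -> G (x + y) (z + w). Proof. exact: gD. Qed.
Lemma special_pow (z : int) : G (v ^ z) (eA ^ z).
Proof. by rewrite scalar_exp; apply/gS/sP. Qed.
Lemma special_scalar k : G k%:A k%:A. Proof. exact/gS/sK. Qed.
Lemma special1 : G 1 1. Proof. by have := special_scalar 1; rewrite !scale1r. Qed.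
Lemma special0 : G 0 0. Proof. by have := special_scalar 0; rewrite !scale0r. Qed.
Lemma specialZ k x z : G x z -> G (k *: x) (k *: z).
Proof.
by move=> hx; rewrite -[k *: x]mulr_algl -[k *: z]mulr_algl; apply: specialM => //; apply: special_scalar.
Qed.
Lemma specialN x z : G x z -> G (- x) (- z).
Proof. by move=> hx; rewrite -scaleN1r -[- z]scaleN1r; apply: specialZ. Qed.
Lemma specialB x y z w : G x z -> G y w -> G (x - y) (z - w).
Proof. by move=> hx hy; apply: specialD => //; apply: specialN. Qed.
Lemma special_h : G h 0.
Proof.
rewrite -(subrr eA); apply: specialB; last exact: special_scalar.
by have := special_pow 1; rewrite !expr1z.
Qed.
Lemma special_hM x z : G x z -> G (h * x) 0.
Proof. by move=> hx; rewrite -(mul0r z); apply: specialM => //; apply: special_h. Qed.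
Lemma special_exp x z (n : int) : G x z -> z != 0 -> G (x ^ n) (z ^ n).
Proof.
move=> hx z0; have hn (m : nat) : G (x ^+ m) (z ^+ m).
  by elim: m => [|m IH]; rewrite ?expr0 ?exprS; [exact: special1|exact: specialM].
case: n => n; first by rewrite -!exprnP.
rewrite NegzE -!exprnN; apply: gV => //.
by have := unitrX n.+1 (Fdiv z0); apply: contraTneq => ->; rewrite unitr0.
Qed.
Lemma h_central x : h * x = x * h.
Proof. by rewrite mulrBl mulrBr (cb_central HQ) mulr_algl mulr_algr. Qed.
Lemma h_lcoef : lcoef v h.
Proof.
have hs := cb_subalg HQ; apply: (subalgB hs); last exact: (subalgA hs).
by have := cb_pow HQ 1; rewrite expr1z.
Qed.

Lemma muts_data p : exmat (se p) = exmat (sq p) /\ qform (se p) = qform (sq p).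
Proof.
elim/last_ind: p => [|p k [IH1 IH2]]; first by [].
by rewrite !muts_rcons /= /mutqform IH1 IH2.
Qed.

(** Negative exponents invert exchange elements; these specialize to the corresponding ones, which
    are nonzero, so the place can be evaluated. *)
Lemma special_frame p f : G (frame (sq p) f) (frame (se p) f).
Proof.
elim/last_ind: p f => [|p k IH] f; first exact/gS/sF.
have [eE qE] := muts_data p; rewrite !muts_rcons.
rewrite [frame (mut v _ _) f]/(mutframe v k (sq p) f) [frame (mut _ _ _) f]/(mutframe eA k (se p) f).
rewrite /mutframe /mutqform eE qE; apply: specialM; first exact: special_pow.
apply: specialM; first exact: IH.
apply: special_exp; first by rewrite /exch eE; apply: specialD; apply: IH.
exact: (exch_neq0 HE Fdiv (gse p)).
Qed.

Lemma lcoef_split c : lcoef v c -> exists a : K, exists2 c', lcoef v c' & c = a%:A + h * c'.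
Proof.
have hs := cb_subalg HQ.
move: c; apply: alg_gen_min => [|_ [->|->]].
- apply/is_subalgP; split=> [|k x y [a [x' hx ->]] [b [y' hy ->]]|x y [a [x' hx ->]] [b [y' hy ->]]].
  + by exists 1, 0; rewrite ?mulr0 ?addr0 ?scale1r //; apply: (subalg0 hs).
  + exists (k * a + b), (k *: x' + y'); first by apply: (subalgD hs) => //; apply: (subalgZ hs).
    by rewrite scalerDr scalerA scalerDl mulrDr -scalerAr addrACA.
  exists (a * b), (a *: y' + x' * (b%:A + h * y')).
    apply: (subalgD hs); first exact: (subalgZ hs).
    apply: (subalgM hs) => //; apply: (subalgD hs); first exact: (subalgA hs).
    by apply: (subalgM hs) => //; apply: h_lcoef.
  rewrite mulrDl [a%:A * _]mulrDr mulr_algl scalerA mulr_algl.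
  by rewrite [in RHS]mulrDr -scalerAr -addrA (mulrA h x').
- by exists eps, 1; [exact: (subalg1 hs)|rewrite mulr1 addrC subrK].
(* From v^-1 = eps^-1 - (v - eps) eps^-1 v^-1. *)
exists eps^-1, (- eps^-1 *: v^-1).
  by apply: (subalgZ hs); have := cb_pow HQ (-1); rewrite exprN1.
rewrite -scalerAr mulrBl divrr ?(cb_unit HQ) // mulr_algl scaleNr scalerBr scalerA mulVf //.
by rewrite scale1r opprB addrCA subrr addr0.
Qed.

(** Each coefficient is split into its value at eps and a multiple of h; support and seed do not
    change. *)
Lemma tspan_split p (P : pred 'cV[int]_N) y : Tq p P y -> exists (t : seq (K * 'cV[int]_N)),
  exists2 y', Tq p P y' & [/\ forall q, q \in t -> P q.2,
    y = \sum_(q <- t) q.1 *: frame (sq p) q.2 + h * y'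
  & G y (\sum_(q <- t) q.1 *: frame (se p) q.2)].
Proof.
have hs := cb_subalg HQ.
elim/tspan_ind: y / => [|x y [t [x' hx [tP -> gx]]] [u [y' hy [uP -> gy]]]|c f hc hf].
- exists [::], 0; first exact: tspan0.
  by rewrite !big_nil mulr0 addr0; split=> //; apply: special0.
- exists (t ++ u), (x' + y'); first exact: tspanD.
  rewrite !big_cat; split.
  + by move=> q; rewrite mem_cat => /orP[/tP|/uP].
  + by rewrite mulrDr addrACA.
  exact: specialD.
have [a [c' hc' ->]] := lcoef_split hc.
exists [:: (a, f)], (c' * frame (sq p) f); first exact: tspan_gen.
rewrite !big_seq1 /=; split=> [q|//|]; first by rewrite inE => /eqP ->.
  by rewrite mulrDl mulr_algl mulrA.
have e1 := special_frame p f.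
rewrite -[X in G _ X]mulr_algl; apply: (specialM _ e1); rewrite -[X in G _ X]addr0.
apply: specialD; first exact: special_scalar.
have [k [c2 _ _]] := lcoef_split hc'.
have [z hz] : exists z, G c' z.
  move: c' hc' {c2}; apply: alg_gen_min => [|_ [->|->]].
  - apply/is_subalgP; split=> [|r x y [z1 g1] [z2 g2]|x y [z1 g1] [z2 g2]].
    + by exists 1; apply: special1.
    + by exists (r *: z1 + z2); apply: specialD => //; apply: specialZ.
    by exists (z1 * z2); apply: specialM.
  - by exists (eA ^ 1); have := special_pow 1; rewrite expr1z.
  by exists (eA ^ (-1)); have := special_pow (-1); rewrite exprN1.
exact: special_hM hz.
Qed.

Lemma tspan_special p (P : pred 'cV[int]_N) y : Tq p P y -> exists2 z, Te p P z & G y z.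
Proof.
move=> /tspan_split[t [y' _ [tP _ gy]]]; exists (\sum_(q <- t) q.1 *: frame (se p) q.2) => //.
rewrite big_seq; apply: tspan_sum => q /tP Pq; apply: (tspanZ (cb_subalg HE)).
exact: (tspanM1 (cb_subalg HE)).
Qed.

Lemma tfree_lin_indep p : lin_indep (frame (se p)).
Proof.
move=> s c us e i si; have hs := cb_subalg HE.
have := good_free (gse p) us (c := fun i => (c i)%:A) (fun i => subalgA hs (c i)).
move=> /(_ _ i si) h1; apply/eqP; have : (c i)%:A == 0 :> F.
  by apply/eqP/h1; rewrite -[RHS]e; apply: eq_bigr => j _; rewrite mulr_algl.
by rewrite scaler_eq0 oner_eq0 orbF.
Qed.

(** The constant parts form a relation between independent monomials, hence cancel. As this holds in
    every seed with the support kept, dividing by h remains inside the intersection U_q. *)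
Lemma tspan_kernel p (P : pred 'cV[int]_N) y : Tq p P y -> G y 0 -> exists2 y', Tq p P y' & y = h * y'.
Proof.
move=> /tspan_split[t [y' hy' [_ e gy]]] /(special_uniq gy) e0; exists y' => //.
have hz := lin_indep_comb (@tfree_lin_indep p) e0.
rewrite e (scale_group (frame (sq p))) big1 ?add0r // => f _.
by rewrite hz scale0r.
Qed.

Lemma special_specialize y z : spec eps v (frame s0) (frame sq0) y z ->
  specialize eps (frame s0) v (frame sq0) y = z /\ G y z.
Proof.
move=> hs; split; last exact: gS.
exact: (specializeE eps0 (cb_central HQ) (cb_unit HQ) Fdiv Fqdiv XM XqM X1 Xq1 Xind Xqind fracq hs).
Qed.

Lemma h_neq0 : h != 0.
Proof.
apply/eqP => h0; pose i (m : int) : int * 'cV[int]_N := (m, 0).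
have := Xqind (s := [:: i 1; i 0]) (c := fun q => if q == i 1 then 1 else - eps).
rewrite big_cons big_seq1 /laurent_monomial /= Xq1 expr1z expr0z !mulr1 eqxx scale1r.
rewrite scaleNr h0 => /(_ isT erefl (i 1)); rewrite inE eqxx => /(_ isT)/eqP.
by rewrite oner_eq0.
Qed.

Variables (l : nat) (iota : F -> Fq).
Hypotheses (eprim : l.-primitive_root eps) (lodd : odd l).
Hypothesis dcop : forall k, coprime l (d k).
Hypothesis frac0 : forall x, exists a b, [/\ tspan (lcoef eA) (frame s0) predT a,
  tspan (lcoef eA) (frame s0) predT b, b != 0 & x = a / b].
Hypothesis char0 : forall n, n.+1%:R != 0 :> K.
Local Notation U := (upper_alg eps s0).
Local Notation C := (upper_center l eps s0).
Definition upper_generic : set Fq := [set y | forall p, Tq p (frozen_nneg ex) y].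
Local Notation T := upper_generic.
Local Notation theta := (specialize eps (frame s0) v (frame sq0)).
Local Notation D := (d_sp T h theta iota).
Hypothesis iotaP : center_section U T theta iota.
Hypothesis Ucluster : U `<=` alg_gen ([set x | exists p i, x = frame (se p) (e_ i)] `|` [set eA; eA^-1]).

Lemma upper_generic_subalg : is_subalg T.
Proof using HQ Fqdiv gq0.
have hS p := tspan_subalg HQ (good_skew (gsq p)) (good_frame (gsq p)) (@frozen_nneg0 _ ex) (@frozen_nnegD _ ex).
apply/is_subalgP; split=> [p|a x y hx hy p|x y hx hy p].
- exact: (subalg1 (hS p)).
- by apply: (subalgD (hS p)) => //; apply: (subalgZ (hS p)).
- by apply: (subalgM (hS p)).
Qed.

Lemma generic_spec y : T y -> exists z, spec eps v (frame s0) (frame sq0) y z.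
Proof.
move=> /(_ [::]) /=; pose sp := spec eps v (frame s0) (frame sq0).
have sD := specD eps0 (cb_central HQ) (cb_unit HQ) Fdiv Fqdiv XM XqM X1 Xq1 Xind Xqind fracq.
have sM := specM eps0 (cb_central HQ) (cb_unit HQ) Fdiv Fqdiv XM XqM X1 Xq1 Xind Xqind fracq.
have sZ := specZ eps0 (cb_central HQ) (cb_unit HQ) Fdiv Fqdiv XM XqM X1 Xq1 Xind Xqind fracq.
elim/tspan_ind: y / => [|x y [z hz] [w hw]|c f hc _].
- by exists 0; have := sK 0; rewrite !scale0r.
- by exists (z + w); apply: sD hz hw.
have [a ha] : exists a, sp c a.
  have [t ->] := lcoefP (cb_unit HQ) hc; elim: t => [|q t [a ha]].
    by exists 0; rewrite big_nil; have := sK 0; rewrite !scale0r.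
  exists (q.1 *: (eps ^ q.2)%:A + a); rewrite big_cons; apply: sD ha.
  exact: sZ (sP q.2).
by exists (a * frame s0 f); apply: sM ha (sF f).
Qed.

Lemma G_theta y : T y -> G y (theta y).
Proof. by move=> /generic_spec[z /special_specialize[-> ]]. Qed.
Lemma theta_upper y : T y -> U (theta y).
Proof.
move=> Ty p; have [z hz gz] := tspan_special (Ty p).
by rewrite (special_uniq (G_theta Ty) gz).
Qed.
(** By [Ucluster] it suffices to lift cluster variables; the frame of the same mutation path does
    so, and lies in U_q by the Laurent phenomenon. *)
Lemma theta_surjective w : U w -> exists2 y, T y & theta y = w.
Proof.
move=> /Ucluster hw; suff [y Ty gy] : exists2 y, T y & G y w.
  by exists y => //; apply: special_uniq (G_theta Ty) gy.
have hS := upper_generic_subalg; move: w hw; apply: alg_gen_min.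
  apply/is_subalgP; split=> [|k x y [x' hx gx] [y' hy gy]|x y [x' hx gx] [y' hy gy]].
  - by exists 1; [exact: (subalg1 hS)|exact: special1].
  - exists (k *: x' + y'); last by apply: specialD => //; apply: specialZ.
    by apply: (subalgD hS) => //; apply: (subalgZ hS).
  by exists (x' * y'); [exact: (subalgM hS)|exact: specialM].
move=> w [[p [i ->]]|[->|->]].
- exists (frame (sq p) (e_ i)); last exact: special_frame.
  by move=> q; apply: (mixed_laurent HQ Fqdiv p q i gq0).
- by exists eps%:A; [exact: (subalgA hS)|exact: special_scalar].
exists (eps^-1)%:A; first exact: (subalgA hS).
by rewrite invrZ ?unitfE ?unitr1 // invr1; apply: special_scalar.
Qed.
Lemma h_unit : h \is a GRing.unit. Proof. exact/Fqdiv/h_neq0. Qed.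
Lemma theta_kernel y : T y -> G y 0 -> T (h^-1 * y).
Proof.
move=> Ty gy p; have [y' Ty' ->] := tspan_kernel (Ty p) gy.
by rewrite (mulKr h_unit).
Qed.

Let Usub : is_subalg U := upper_subalg eprim lodd dcop Fdiv gs0 frac0.
Let Csub : is_subalg C := center_subalg eprim lodd dcop Fdiv gs0 frac0.
Let Ccentral c : C c -> forall x, c * x = x * c.
Proof. exact: (center_central eprim lodd dcop Fdiv gs0 frac0). Qed.
Let Cupper : C `<=` U.
Proof. exact: (center_upper eprim lodd dcop Fdiv gs0 frac0). Qed.

Lemma center_alg_center : C `<=` alg_center U.
Proof. by move=> c hc; split; [exact: Cupper|move=> r _; apply: Ccentral]. Qed.

(** The lift depends on p and need not lie in U_q; this is why brackets are compared through
    [G_d_sp_lift]. *)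
Lemma center_lift p c : C c -> exists2 x, G x c & exists t : seq (K * 'cV[int]_N),
  (forall q, q \in t -> latt ex l q.2) /\ x = \sum_(q <- t) q.1 *: frame (sq p) q.2.
Proof.
move=> /(_ p); elim/tspan_ind: c / => [|x y [x' gx [t [tl xE]]] [y' gy [u [ul yE]]]|c f hc hf].
- by exists 0; [exact: special0|exists [::]; rewrite big_nil].
- exists (x' + y'); first exact: specialD.
  exists (t ++ u); rewrite big_cat xE yE; split=> // q.
  by rewrite mem_cat => /orP[/tl|/ul].
have [a ->] := lcoef_scalar hc; exists (a *: frame (sq p) f).
  by rewrite mulr_algl; apply: specialZ; apply: special_frame.
by exists [:: (a, f)]; rewrite big_seq1; split=> // q; rewrite inE => /eqP ->.
Qed.

Lemma lift_iota p c x : C c -> G x c -> Tq p (frozen_nneg ex) x ->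
  exists x' z, [/\ G x' z & x = iota c + h * x'].
Proof.
move=> hc gx Tx; have [_ /(_ _ (center_alg_center hc))[Ti ti]] := iotaP.
have gi : G (iota c) c by rewrite -{2}ti; apply: G_theta.
have [x' Tx' e] : exists2 x', Tq p (frozen_nneg ex) x' & x - iota c = h * x'.
  by apply: tspan_kernel; [exact: (tspanB (cb_subalg HQ) Tx (Ti p))|rewrite -(subrr c); apply: specialB].
have [z _ gz] := tspan_special Tx'.
by exists x', z; split=> //; rewrite -e addrC subrK.
Qed.

(** The commutator is a difference of two powers of v times one monomial. Both exponents are
    multiples of l, so the difference vanishes at eps and h divides it. *)
Lemma bracket_monomial p f g : latt ex l f -> latt ex l g ->
  Tq p (latt ex l) (h^-1 * (frame (sq p) f * frame (sq p) g - frame (sq p) g * frame (sq p) f)).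
Proof.
move=> hf hg; have fr := good_frame (gsq p); have hs := cb_subalg HQ.
rewrite !(qframeM fr) (addrC g) -mulrBl mulrA.
have lz_latt f' : latt ex l f' -> lz l f' by case/andP.
set n := form _ f g; set m := form _ g f.
have hn : G (v ^ n - v ^ m) 0.
  rewrite -(subrr 1); apply: specialB.
    by rewrite -(epsA_dvd F eprim (form_lzl (qform (sq p)) g (lz_latt _ hf))); apply: special_pow.
  by rewrite -(epsA_dvd F eprim (form_lzl (qform (sq p)) f (lz_latt _ hg))); apply: special_pow.
have hl : Tq p (pred1 0) (v ^ n - v ^ m).
  rewrite -[_ - _]mulr1 -(qframe1 fr); apply: tspan_gen => //=.
  by apply: (subalgB hs); apply: (cb_pow HQ).
have [y hy ->] := tspan_kernel hl hn; rewrite (mulKr h_unit).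
apply: (tspanM HQ (good_skew (gsq p)) fr (P := pred1 0) (Q := pred1 (f + g)) _ hy).
  by move=> a b /eqP -> /eqP ->; rewrite add0r; apply: lattD.
by apply: (tspanM1 hs) => /=.
Qed.

Lemma center_poisson c c' : C c -> C c' -> C (D c c').
Proof.
move=> hc hc' p; have hs := cb_subalg HQ.
have [x gx [t [tl xE]]] := center_lift p hc.
have [y gy [u [ul yE]]] := center_lift p hc'.
have Tlift (r : seq (K * 'cV[int]_N)) : (forall q, q \in r -> latt ex l q.2) ->
    Tq p (frozen_nneg ex) (\sum_(q <- r) q.1 *: frame (sq p) q.2).
  move=> rl; rewrite big_seq; apply: tspan_sum => q /rl /andP[qf _].
  by apply: (tspanZ hs); apply: (tspanM1 hs).
have Tx : Tq p (frozen_nneg ex) x by rewrite xE; apply: Tlift.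
have Ty : Tq p (frozen_nneg ex) y by rewrite yE; apply: Tlift.
have [x' [z [gx' ex']]] := lift_iota hc gx Tx.
have [y' [w [gy' ey']]] := lift_iota hc' gy Ty.
have hG := G_d_sp_lift upper_generic_subalg Usub h_central h_unit special_uniq specialM
  specialD specialZ special_hM G_theta theta_upper theta_surjective theta_kernel iotaP
  (center_alg_center hc) (center_alg_center hc') gx' gy' (Ccentral hc w) (Ccentral hc' z).
rewrite -ex' -ey' in hG.
suff Txy : Tq p (latt ex l) (h^-1 * (x * y - y * x)).
  by have [r hr gr] := tspan_special Txy; rewrite (special_uniq hG gr).
have -> : h^-1 * (x * y - y * x) = \sum_(a <- t) \sum_(b <- u) (a.1 * b.1) *:
    (h^-1 * (frame (sq p) a.2 * frame (sq p) b.2 - frame (sq p) b.2 * frame (sq p) a.2)).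
  move: h^-1 => k; rewrite xE yE [X in _ - X]mulr_sumr mulr_suml -sumrB mulr_sumr; apply: eq_bigr => a _.
  rewrite mulr_sumr mulr_suml -sumrB mulr_sumr; apply: eq_bigr => b _.
  by rewrite -!scalerAl -!scalerAr !scalerA (mulrC b.1) -scalerBr -scalerAr.
rewrite big_seq; apply: tspan_sum => a /tl ha; rewrite big_seq; apply: tspan_sum => b /ul hb.
by apply: (tspanZ hs); apply: bracket_monomial.
Qed.

(** A product of monomials contributes only if f + g is divisible by l. Then [form f g] equals
    [form f (f + g)], a multiple of l, so both orders give the same term. *)
Lemma proj_lz_comm x y : Te [::] predT x -> Te [::] predT y ->
  proj (lcoef eA) (frame s0) (lz l (N := N)) (x * y) =
  proj (lcoef eA) (frame s0) (lz l (N := N)) (y * x).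
Proof.
have hs := cb_subalg HE; have fM := good_free gs0; have fr := good_frame gs0.
have TM a b : Te [::] predT a -> Te [::] predT b -> Te [::] predT (a * b).
  exact: (tspanMT HE (good_skew gs0) fr).
move=> Tx Ty; move: (Tx); suff: Te [::] predT x -> Te [::] predT x /\
  proj (lcoef eA) (frame s0) (lz l (N := N)) (x * y) =
  proj (lcoef eA) (frame s0) (lz l (N := N)) (y * x) by move=> h1 /h1[].
clear Tx; elim/tspan_ind: x / => [|x1 x2 [T1 e1] [T2 e2]|c f hc _].
- by rewrite mul0r mulr0; split; first exact: tspan0.
- split; first exact: tspanD.
  by rewrite mulrDl mulrDr !(projD hs fM) ?e1 ?e2 //; apply: TM.
have Tf : Te [::] predT (c * frame s0 f) by apply: tspan_gen.
split=> //; move: (Ty); suff: Te [::] predT y -> Te [::] predT y /\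
  proj (lcoef eA) (frame s0) (lz l (N := N)) (c * frame s0 f * y) =
  proj (lcoef eA) (frame s0) (lz l (N := N)) (y * (c * frame s0 f)) by move=> h1 /h1[].
clear Ty; elim/tspan_ind: y / => [|y1 y2 [T1 e1] [T2 e2]|b g hb _].
- by rewrite mul0r mulr0; split; first exact: tspan0.
- split; first exact: tspanD.
  by rewrite mulrDl mulrDr !(projD hs fM) ?e1 ?e2 //; apply: TM.
split; first exact: tspan_gen.
have mm a1 a2 f1 f2 : lcoef eA a1 -> lcoef eA a2 -> a1 * frame s0 f1 * (a2 * frame s0 f2) =
    a1 * a2 * eA ^ form (qform s0) f1 f2 * frame s0 (f1 + f2).
  move=> h1 h2; rewrite -mulrA (mulrA (frame s0 f1)) -(cb_comm HE (frame s0 f1) h2).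
  by rewrite -(mulrA a2) (qframeM fr) !mulrA.
have lc a1 a2 (n : int) : lcoef eA a1 -> lcoef eA a2 -> lcoef eA (a1 * a2 * eA ^ n).
  by move=> h1 h2; apply: (subalgM hs); [apply: (subalgM hs)|apply: (cb_pow HE)].
rewrite !mm // (proj_gen hs fM _ _ (lc _ _ _ hc hb)) (proj_gen hs fM _ _ (lc _ _ _ hb hc)).
rewrite (addrC g); case: ifP => // lfg.
have sk := good_skew gs0.
have e1 : form (qform s0) f g = form (qform s0) f (f + g) by rewrite formDr form_alt // add0r.
have e2 : form (qform s0) g f = form (qform s0) g (f + g) by rewrite formDr (form_alt g) // addr0.
by rewrite e1 e2 !(epsA_dvd F eprim (form_lzr _ _ lfg)) (cb_comm HE b hc).
Qed.

Lemma poisson_trace (gens : seq F) : U = alg_gen [set x | x \in gens] ->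
  poisson_trace_order U C D D (reg_trace (mixed_torus eA l s0) (mixed_torus eA 1 s0)).
Proof.
move=> Ugen; set tr := reg_trace _ _.
have UT r : U r -> Te [::] predT r by move=> /(_ [::]); apply: tspanT.
have trE r : U r -> tr r = proj (lcoef eA) (frame s0) (lz l (N := N)) r *+ (l ^ N).
  move=> Ur; apply: (reg_trace_proj eprim lodd dcop Fdiv gs0 frac0).
  by rewrite (R0E eprim lodd dcop Fdiv gs0 frac0); apply: (Ur [::]).
have hs := cb_subalg HE; have fM := good_free gs0.
have dU c (hc : C c) : derivation_on U (D c).
  exact: (d_sp_derivation upper_generic_subalg Usub h_central h_unit special_uniq specialM
  specialD specialZ special_hM G_theta theta_upper theta_surjective theta_kernel iotaP
  (center_alg_center hc)).
have projC r : U r -> C (proj (lcoef eA) (frame s0) (lz l (N := N)) r).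
  exact: (proj_lz_center eprim lodd dcop Fdiv gs0 frac0).
have TM a b : U a -> U b -> U (a * b) by exact: (subalgM Usub).
split.
- apply: (d_sp_poisson_order upper_generic_subalg Usub h_central h_unit special_uniq specialM
    specialD specialZ special_hM G_theta theta_upper theta_surjective theta_kernel iotaP
    Csub center_alg_center) => [|c c' hc hc'].
    exact: (upper_fg eprim lodd dcop Fdiv gs0 frac0 char0 Ugen).
  exact: center_poisson.
- by move=> r Ur; rewrite trE // -scaler_nat; apply: (subalgZ Csub); apply: projC.
- split=> [r s Ur Us|c r hc Ur].
    rewrite !trE //; last exact: (subalgD Usub).
    by rewrite (projD hs fM) ?mulrnDl //; apply: UT.
  rewrite !trE //; last by apply: TM => //; apply: Cupper.
  rewrite (proj_lz_mul eprim lodd dcop Fdiv gs0 frac0) ?mulrnAr //; last exact: UT.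
  exact: (center_lz eprim lodd dcop Fdiv gs0 frac0).
- move=> x y Ux Uy; rewrite (trE _ (TM _ _ Ux Uy)) (trE _ (TM _ _ Uy Ux)).
  by rewrite proj_lz_comm //; apply: UT.
move=> c r hc Ur; have [D1 D2 _] := dU c hc.
rewrite !trE //; last exact: D1.
rewrite (proj_deriv eprim lodd dcop Fdiv gs0 frac0 (dU c hc) _ char0 Ur); last by move=> c'; apply: center_poisson.
set w := proj _ _ _ _; have Uw : U w by apply/Cupper/projC.
have U0 := subalg0 Usub.
have D0 : D c 0 = 0.
  have := D2 1 0 0 U0 U0; rewrite !scale1r addr0 => e.
  by apply: (addrI (D c 0)); rewrite -e addr0.
have := D2 (l ^ N)%:R w 0 Uw U0; rewrite D0 !addr0 !scaler_nat => ->.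
by [].
Qed.
End Specialize.

(** * From reachable seeds to mutation paths, and the conclusion *)

Lemma mixed_torus_capE (K : fieldType) (F : unitAlgType K) (v : F) (N : nat)
    (ex : {set 'I_N}) (d : dir ex -> nat) (n : nat) (s t : seed F ex) :
  (forall x, v * x = x * v) -> v \is a GRing.unit ->
  (forall x : F, x != 0 -> x \is a GRing.unit) -> (0 < n)%N ->
  good v (lcoef v) d t -> twin v s t ->
  mixed_torus_cap v n s =
    [set w | forall p, tspan (lcoef v) (frame (muts v p t)) (latt ex n) w].
Proof.
move=> vC vU Fdiv n0 gt st; have HV := lcoef_base vC vU.
have E p s' : twin v s' (muts v p t) ->
    mixed_torus v n s' = tspan (lcoef v) (frame (muts v p t)) (latt ex n).
  move=> [e _ _]; rewrite -(mixed_torusE vC vU Fdiv n0 (muts_good HV Fdiv p gt)).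
  by rewrite /mixed_torus e.
rewrite eqEsubset; split=> w hw.
  move=> p; have [s' hs' tw] := muts_reach vC vU Fdiv p gt st.
  by rewrite -(E _ _ tw); apply: hw.
move=> s' hs'; have [p tw] := reach_muts vC vU Fdiv gt st hs'.
by rewrite (E _ _ tw); apply: hw.
Qed.

Lemma formE_sum N (L : 'M[int]_N) f g :
  form L f g = \sum_j (\sum_i f i ord0 * L i j) * g j ord0.
Proof.
rewrite /form mxE; apply: eq_bigr => j _; rewrite mxE; congr (_ * _).
by apply: eq_bigr => i _; rewrite mxE.
Qed.

Lemma form_mod N (l : nat) (L L' : 'M[int]_N) f g :
  (forall i j, (L i j = L' i j %[mod l])%Z) -> (l %| form L f g - form L' f g)%Z.
Proof.
move=> h; rewrite !formE_sum -sumrB; apply: rpred_sum => j _.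
rewrite -mulrBl dvdz_mulr // -sumrB; apply: rpred_sum => i _.
by rewrite -mulrBr dvdz_mull // -eqz_mod_dvd; apply/eqP.
Qed.

Lemma frame1 (K : fieldType) (F : unitAlgType K) (v : F) N (L : 'M[int]_N)
    (X : 'cV[int]_N -> F) : X 0 \is a GRing.unit ->
  (forall f g, X f * X g = v ^ form L f g * X (f + g)) -> X 0 = 1.
Proof.
move=> XU /(_ 0 0); rewrite form0l expr0z mul1r addr0 => e.
by apply: (mulrI XU); rewrite e mulr1.
Qed.

Theorem proposition6p4 (R : realType) (N : nat) (ex : {set 'I_N})
    (B : exmatrix ex) (l : nat) (eps : R[i]) (Om : 'M[int]_N)
    (d : dir ex -> nat)
    (* the division ring of fractions of T_eps(Om), eps standing for eps^{1/2} *)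
    (F : unitAlgType R[i]) (X : 'cV[int]_N -> F)
    (* a lift of Om, and the division ring of fractions of T_q(La), v = q^{1/2} *)
    (La : 'M[int]_N)
    (Fq : unitAlgType R[i]) (v : Fq) (Xq : 'cV[int]_N -> Fq)
    (iota : F -> Fq) :
  (0 < N)%N ->
  (0 < l)%N ->
  l.-primitive_root eps ->
  root_compatible l Om B d ->
  frac_qtorus eps Om X ->
  frac_generic_qtorus v La Xq ->
  let S := Seed X B Om in
  let Sq := Seed Xq B La in
  let A := cluster_algebra eps%:A S in
  let U := upper_cluster_algebra eps%:A S in
  let CU := mixed_torus_cap eps%:A l S in
  let Uq := upper_cluster_algebra v Sq in
  let theta := specialize eps X v Xq in
  let der := d_sp Uq (v - eps%:A) theta iota in
  let tr := reg_trace (mixed_torus eps%:A l S) (mixed_torus eps%:A 1 S) in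
  center_section U Uq theta iota ->
  (* (i) *) strict_lift l Om La B d ->
  (* (ii) *) odd l -> (forall k, coprime l (d k)) ->
  (* (iii) *) A = U ->
  (* (iv) *) (exists s : seq F, U = alg_gen [set x | x \in s]) ->
  poisson_trace_order U CU (* bracket *) der (* derivation *) der tr.

Proof.
move=> N0 l0 eprim [[dpos _] _ _] [XM Xind [Fdiv Ffrac]] [vC XqM Xqind [Fqdiv Fqfrac]].
move=> S Sq A U CU Uq theta der tr iotaP [Lskew Lmod Lcomp] lodd dcop AU [gens Ugen].
pose eA : F := eps%:A.
have eps0 := eps_neq0 eprim; have HE : coef_base eA (lcoef eA) := epsA_base F eprim.
have ne0 (K : fieldType) (E : algType K) (I : choiceType) (b : I -> E) i : lin_indep b -> b i != 0.
  move=> hb; apply/eqP => b0.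
  have := hb [:: i] (fun=> 1) isT; rewrite big_seq1 b0 scaler0 => /(_ erefl i).
  by rewrite inE eqxx => /(_ isT)/eqP; rewrite oner_eq0.
have v0 : v != 0.
  apply: contraTneq (ne0 _ _ _ _ (1, 0) Xqind) => v0.
  by rewrite /laurent_monomial /= expr1z v0 mul0r eqxx.
have vU := Fqdiv _ v0; have HQ := lcoef_base vC vU.
(* Powers of eps depend on the exponent only modulo l, so [La] may replace [Om]. *)
have XLa f g : X f * X g = eA ^ form La f g * X (f + g).
  rewrite XM (epsA_exp F eprim) mulr_algl; congr (_ *: _).
  rewrite -[form La f g](subrK (form Om f g)) expfzDr //.
  have /dvdzP[m ->] := form_mod f g Lmod.
  by rewrite [m * _]mulrC -exprz_exp -exprnP (prim_expr_order eprim) exp1rz mul1r.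
have X1 : X 0 = 1 by apply: frame1 XLa; apply/Fdiv/ne0.
have Xq0 : Xq 0 != 0.
  apply: contraTneq (ne0 _ _ _ _ (0, 0) Xqind) => e.
  by rewrite /laurent_monomial /= e mulr0 eqxx.
have Xq1 : Xq 0 = 1 by apply: frame1 XqM; apply/Fqdiv.
have compat k f : form La (bcol B k) f = (d k)%:Z * co (val k) f.
  rewrite formE_sum (bigD1 (val k)) //= [X in _ + X]big1 ?addr0 => [|j /negPf jk].
    under eq_bigr do rewrite mxE.
    by rewrite Lcomp eqxx mul1r.
  under eq_bigr do rewrite mxE.
  by rewrite Lcomp eq_sym jk !mul0r.
pose sE := Seed X B La : seed F ex; pose sQ := Seed Xq B La : seed Fq ex.
have gE : good eA (lcoef eA) d sE by split=> //; apply: scalar_tfree.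
have gQ : good v (lcoef v) d sQ by split=> //; apply: generic_tfree.
(* The given seed carries [Om], the theory uses [La]; their mutations stay twins and have the same
   tori. *)
have tE : twin eA S sE.
  split=> // f g; have h1 := XLa f g; rewrite XM -mulr_algl -(epsA_exp F eprim) in h1.
  have /Fdiv XU : X (f + g) != 0 by apply: ne0.
  exact: (mulIr XU h1).
have tQ : twin v Sq sQ by [].
have eU := @epsA_unit _ F _ _ eprim; have eC := @epsA_central _ F eps.
have UE : U = upper_alg eps sE.
  rewrite /U /upper_cluster_algebra (mixed_torus_capE eC eU Fdiv (ltn0Sn 0) gE tE).
  rewrite eqEsubset; split=> w hw p; apply: tspanS (hw p) => f; by rewrite -!topredE /= latt1.
have CUE : CU = upper_center l eps sE := mixed_torus_capE eC eU Fdiv l0 gE tE.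
have UqE : Uq = upper_generic v sQ.
  rewrite /Uq /upper_cluster_algebra (mixed_torus_capE vC vU Fqdiv (ltn0Sn 0) gQ tQ).
  rewrite eqEsubset; split=> w hw p; apply: tspanS (hw p) => f; by rewrite -!topredE /= latt1.
have frac0 x : exists a b, [/\ tspan (lcoef eA) X predT a, tspan (lcoef eA) X predT b, b != 0 & x = a / b].
  have [a [b [ha hb b0 e]]] := Ffrac x; exists a, b; split=> //.
    have [s [c ->]] := ha; apply: tspan_sum => i _; apply: (tspanZ (cb_subalg HE)).
    exact: (tspanM1 (cb_subalg HE)).
  have [s [c ->]] := hb; apply: tspan_sum => i _; apply: (tspanZ (cb_subalg HE)).
  exact: (tspanM1 (cb_subalg HE)).
(* The equality A = U, with the reachable seeds replaced by mutation paths. *)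
have Ucl : upper_alg eps sE `<=`
    alg_gen ([set x | exists p i, x = frame (muts eA p sE) (e_ i)] `|` [set eA; eA^-1]).
  rewrite -UE -AU; apply: alg_gen_min; first exact: alg_gen_subalg.
  move=> x [[s [i [hs ->]]]|hx]; apply: alg_gen_incl; last by right.
  by left; have [p [-> _ _]] := reach_muts eC eU Fdiv gE tE hs; exists p, i.
rewrite UE in Ugen; rewrite /der /tr CUE; rewrite UqE UE in iotaP *.
exact: (poisson_trace eps0 HE HQ Fdiv Fqdiv gE gQ erefl erefl Xind Xqind Fqfrac
  eprim lodd dcop frac0 (fun n => negbT (pnatr_eq0 _ n.+1)) iotaP Ucl Ugen).
Qed.
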